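(* The quadratic maximal regularity operators $\mathcal{Q}$ and $\widetilde{\mathcal{Q}}_{[0,T]}$ ($0<T<\infty$), initially defined on $L^2(\mathbb{R}_+;L^2(\mathbb{R}^n))=T^2$, extend to bounded sublinear operators from $T^p$ to $T^p$ for all $p\in[2,\infty]$.
   Context: Notation: $\mathbb{R}_+=(0,\infty)$; $B(x,r)$ is the Euclidean ball in $\mathbb{R}^n$; $e^{t\Delta}$ is the heat semigroup on $\mathbb{R}^n$. The operators are defined for $f\in L^2(\mathbb{R}_+;L^2(\mathbb{R}^n))$ by $$\mathcal{Q}(f)(t,x)=\Big(\int_0^t|\nabla e^{(t-s)\Delta}f(s,\cdot)(x)|_{\mathbb{C}^n}^2\,ds\Big)^{1/2},$$ $$\widetilde{\mathcal{Q}}_{[0,T]}(f)(t,x)=\Big(\frac{1_{[0,T]}(t)}{T}\int_0^t|e^{(t-s)\Delta}f(s,\cdot)(x)|^2\,ds\Big)^{1/2}.$$ Both are bounded from $L^2(\mathbb{R}_+;L^2(\mathbb{R}^n))$ to itself. Tent spaces: for $0<p<\infty$, $T^p$ is the space of measurable $g$ on $\mathbb{R}_+\times\mathbb{R}^n$ with $$\|g\|_{T^p}=\Big(\int_{\mathbb{R}^n}\Big(\int_0^\infty\frac{1}{|B(x,\sqrt t)|}\int_{B(x,\sqrt t)}|g(t,y)|^2\,dy\,dt\Big)^{p/2}dx\Big)^{1/p}<\infty,$$ and $T^\infty$ is the space of measurable $g$ with $$\|g\|_{T^\infty}=\sup_{x\in\mathbb{R}^n,\,r>0}\Big(\int_0^{r^2}\frac{1}{|B(x,r)|}\int_{B(x,r)}|g(t,y)|^2\,dy\,dt\Big)^{1/2}<\infty.$$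 $T^2=L^2(\mathbb{R}_+\times\mathbb{R}^n)$ isometrically. ''Extends'' means that there is a bounded sublinear operator on $T^p$ coinciding with the initially defined one on $T^p\cap T^2$. *)

(* Defs.v *)
From HB Require Import structures.
From mathcomp Require Import all_boot all_order all_algebra.
From mathcomp Require Import all_classical all_reals all_analysis.
From mathcomp Require Import complex.

Set Implicit Arguments.
Unset Strict Implicit.
Unset Printing Implicit Defensive.

Import Order.TTheory GRing.Theory Num.Theory.
Import numFieldNormedType.Exports.
Import ComplexField.Normc.

Local Open Scope classical_set_scope.
Local Open Scope ring_scope.
Local Open Scope complex_scope.

(* The space R^n is 'rV[R]_n, with the product sigma-algebra (the one generated
   by the coordinates), as the library does for n.-tuple. *)
Section measurable_rV.
Context {R : realType} {n : nat}.

Let coord : 'I_n -> 'rV[R]_n -> R := fun i x => x 0 i.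

Let rV_set0 : g_sigma_preimage coord set0.
Proof. exact: sigma_algebra0. Qed.

Let rV_setC A : g_sigma_preimage coord A -> g_sigma_preimage coord (~` A).
Proof. exact: sigma_algebraC. Qed.

Let rV_bigcup (F : _^nat) : (forall i, g_sigma_preimage coord (F i)) ->
  g_sigma_preimage coord (\bigcup_i (F i)).
Proof. exact: sigma_algebra_bigcup. Qed.

HB.instance Definition _ := @isMeasurable.Build default_measure_display
  'rV[R]_n (g_sigma_preimage coord) rV_set0 rV_setC rV_bigcup.

End measurable_rV.

Section lebesgue_rV.
Context {R : realType}.

Lemma measurable_coord_rV n (i : 'I_n) :
  measurable_fun [set: 'rV[R]_n] (fun x => x 0 i).
Proof.
move=> _ Y mY; rewrite setTI; apply: sub_sigma_algebra => /=.
rewrite -bigcup_seq/=; exists i => /=; first by rewrite mem_index_enum.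
by exists Y => //; rewrite setTI.
Qed.

Lemma measurable_fun_rVP d (T : measurableType d) n (f : T -> 'rV[R]_n) :
  measurable_fun [set: T] f <->
  forall i, measurable_fun [set: T] (fun x => f x 0 i).
Proof.
split=> [mf i|mf].
  exact: (measurableT_comp (measurable_coord_rV i) mf).
suff : g_sigma_preimage (fun (i : 'I_n) x => f x 0 i) `<=` measurable.
  move=> h _ A mA; rewrite setTI; apply: h.
  rewrite (@g_sigma_preimage_comp _ _ n _
    (fun (i : 'I_n) (x : 'rV[R]_n) => x 0 i) _ f).
  by exists A => //; rewrite setTI.
apply: smallest_sub; first exact: sigma_algebra_measurable.
case: n => [|n] in f mf *; first by rewrite big_ord0.
rewrite -bigcup_mkord_ord; apply: bigcup_sub => i Ii.
by move=> A [B mB <-]; exact: mf.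
Qed.

Definition cons_rV n (z : measurableTypeR R * 'rV[R]_n) : 'rV[R]_n.+1 :=
  row_mx (z.1)%:M z.2.

(* Lebesgue measure on the Borel subsets of R^n, as the n-fold product. *)
Fixpoint lebesgue_rV (n : nat) : set 'rV[R]_n -> \bar R :=
  match n with
  | 0 => \d_(0 : 'rV[R]_0)
  | m.+1 => pushforward (lebesgue_measure \x lebesgue_rV (n := m))%E
                        (@cons_rV m)
  end.

Lemma cons_rVE0 n z : @cons_rV n z 0 0 = z.1.
Proof.
have -> : (0 : 'I_n.+1) = lshift n (0 : 'I_1) by apply/val_inj.
by apply: etrans (row_mxEl _ _ _ _) _; rewrite mxE eqxx mulr1n.
Qed.

Lemma cons_rVES n z (j : 'I_n) : cons_rV z 0 (lift ord0 j) = z.2 0 j.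
Proof.
have -> : lift ord0 j = rshift 1 j by apply/val_inj.
exact: row_mxEr.
Qed.

Definition uncons_rV n (x : 'rV[R]_n.+1) : measurableTypeR R * 'rV[R]_n :=
  (x 0 0, \row_j x 0 (lift ord0 j)).

Lemma cons_rVK n : cancel (@cons_rV n) (@uncons_rV n).
Proof.
move=> [a v]; rewrite /uncons_rV cons_rVE0; congr pair.
by apply/rowP => j; rewrite mxE cons_rVES.
Qed.

Lemma measurable_cons_rV n : measurable_fun setT (@cons_rV n).
Proof.
apply/measurable_fun_rVP => i; case: (unliftP ord0 i) => [j ->|->].
  under eq_fun do rewrite cons_rVES.
  exact: measurableT_comp (measurable_coord_rV j) measurable_snd.
by under eq_fun do rewrite cons_rVE0; exact: measurable_fst.
Qed.

Lemma measurable_uncons_rV n : measurable_fun setT (@uncons_rV n).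
Proof.
apply: measurable_fun_pair; first exact: measurable_coord_rV.
apply/measurable_fun_rVP => i; under eq_fun do rewrite mxE.
exact: measurable_coord_rV.
Qed.

HB.instance Definition _ n :=
  isMeasurableFun.Build _ _ _ _ (@cons_rV n) (@measurable_cons_rV n).

Section lebesgue_cons.
Local Open Scope ereal_scope.
Variables (n : nat) (mu : {sigma_finite_measure set 'rV[R]_n -> \bar R}).

Let nu := pushforward (lebesgue_measure \x mu) (@cons_rV n).

Let nu0 : nu set0 = 0. Proof. exact: measure0. Qed.

Let nu_ge0 A : 0 <= nu A. Proof. exact: measure_ge0. Qed.

Let nu_sigma_additive : semi_sigma_additive nu.
Proof. exact: measure_semi_sigma_additive. Qed.

HB.instance Definition _ := isMeasure.Build _ _ _ nu
  nu0 nu_ge0 nu_sigma_additive.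

Let nu_sigma_finite : sigma_finite setT nu.
Proof.
have /sigma_finiteP[F [TF ndF Foo]] := sigma_finiteT (@lebesgue_measure R).
have /sigma_finiteP[G [TG ndG Goo]] := sigma_finiteT mu.
exists (fun k => @uncons_rV n @^-1` (F k `*` G k)).
  rewrite -preimage_bigcup -[LHS](preimage_setT (@uncons_rV n)).
  congr (_ @^-1` _); rewrite -setXTT TF TG predeqE => -[x y]; split.
    move=> [/= [k _ Fkx] [l _ Gly]]; exists (maxn k l) => //; split.
    - by move: x Fkx; exact/subsetPset/ndF/leq_maxl.
    - by move: y Gly; exact/subsetPset/ndG/leq_maxr.
  by move=> [k _ []/= ? ?]; split; exists k.
move=> k; have [mF Fk] := Foo k; have [mG Gk] := Goo k; split.
  rewrite -[X in measurable X]setTI; apply: measurable_uncons_rV => //.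
  exact: measurableX.
rewrite /nu /pushforward -comp_preimage.
rewrite (_ : _ \o _ = id); last by apply/funext => z /=; rewrite cons_rVK.
by rewrite product_measure1E// lte_mul_pinfty// ge0_fin_numE.
Qed.

HB.instance Definition _ := Measure_isSigmaFinite.Build _ _ _ nu
  nu_sigma_finite.

Definition lebesgue_cons : {sigma_finite_measure set 'rV[R]_n.+1 -> \bar R} :=
  nu.

End lebesgue_cons.

Lemma lebesgue_rV_measure n :
  exists mu : {sigma_finite_measure set 'rV[R]_n -> \bar R},
    lebesgue_rV (n := n) = mu.
Proof.
elim: n => [|n [mu IH]]; last by exists (lebesgue_cons mu); rewrite /= IH.
by exists (\d_(0 : 'rV[R]_0) : {finite_measure set _ -> \bar R}).
Qed.

Section lebesgue_rV_instances.
Local Open Scope ereal_scope.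
Variable n : nat.

Let lebesgue_rV0 : lebesgue_rV (n := n) set0 = 0.
Proof. by have [mu ->] := lebesgue_rV_measure n; exact: measure0. Qed.

Let lebesgue_rV_ge0 A : 0 <= lebesgue_rV (n := n) A.
Proof. by have [mu ->] := lebesgue_rV_measure n; exact: measure_ge0. Qed.

Let lebesgue_rV_sigma_additive : semi_sigma_additive (lebesgue_rV (n := n)).
Proof.
have [mu ->] := lebesgue_rV_measure n.
exact: measure_semi_sigma_additive.
Qed.

HB.instance Definition _ := isMeasure.Build _ _ _ (lebesgue_rV (n := n))
  lebesgue_rV0 lebesgue_rV_ge0 lebesgue_rV_sigma_additive.

Let lebesgue_rV_sigma_finite : sigma_finite setT (lebesgue_rV (n := n)).
Proof. by have [mu ->] := lebesgue_rV_measure n; exact: sigma_finiteT. Qed.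

HB.instance Definition _ := Measure_isSigmaFinite.Build _ _ _
  (lebesgue_rV (n := n)) lebesgue_rV_sigma_finite.

End lebesgue_rV_instances.

End lebesgue_rV.

Arguments lebesgue_rV {R} n _.

Section norms.
Context {R : realType} {n : nat}.

Definition enorm (x : 'rV[R]_n) : R := Num.sqrt (\sum_(i < n) x 0 i ^+ 2).

(* The library's [ball] on 'rV[R]_n is the one of the sup norm. *)
Definition eball (x : 'rV[R]_n) (r : R) : set 'rV[R]_n :=
  [set y | enorm (y - x) < r].

Definition cenorm (w : 'rV[R[i]]_n) : R :=
  Num.sqrt (\sum_(i < n) normc (w 0 i) ^+ 2).

End norms.

Section heat_semigroup.
Context {R : realType} {n : nat}.
Implicit Types (t : R) (u : 'rV[R]_n -> R[i]) (x : 'rV[R]_n).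

Definition heat_kernel t x : R :=
  (4 * pi * t) `^ (- (n%:R / 2)) * expR (- (enorm x ^+ 2 / (4 * t))).

(* e^{t Delta} u for t > 0, as the convolution of u with the Gaussian kernel. *)
Definition heat t u x : R[i] :=
  (\int[lebesgue_rV n]_y (heat_kernel t (x - y) * complex.Re (u y))) +i*
  (\int[lebesgue_rV n]_y (heat_kernel t (x - y) * complex.Im (u y))).

Definition gradient u x : 'rV[R[i]]_n :=
  \row_i ('D_(delta_mx 0 i) (@complex.Re R \o u) x +i*
          'D_(delta_mx 0 i) (@complex.Im R \o u) x).

End heat_semigroup.

(* Functions on (0, oo) x R^n are represented by functions on R x R^n of which
   only the restriction to [half_space] matters. *)
Notation spacetime R n := (measurableTypeR R * 'rV[R]_n)%type.

Section half_space.
Context {R : realType} {n : nat}.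

Definition half_space : set (spacetime R n) := `]0, +oo[ `*` setT.

Definition spacetime_measure : set (spacetime R n) -> \bar R :=
  (lebesgue_measure \x lebesgue_rV n)%E.

HB.instance Definition _ := Measure.on spacetime_measure.

End half_space.

Section operators.
Context {R : realType} {n : nat}.
Implicit Types (f : spacetime R n -> R[i]) (z : spacetime R n).

(* Extended-real valued: the integral over s may be infinite at some points. *)
Definition quad_max_reg f z : \bar R :=
  (((\int[lebesgue_measure]_(s in `]0%R, z.1[)
      (cenorm (gradient (heat (z.1 - s) (fun y => f (s, y))) z.2) ^+ 2)%:E))
   `^ 2^-1)%E.

Definition quad_max_reg_trunc (T : R) f z : \bar R :=
  (((\1_(`[0%R, T] : set R) z.1 / T)%:E *
    \int[lebesgue_measure]_(s in `]0%R, z.1[)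
      (normc (heat (z.1 - s) (fun y => f (s, y)) z.2) ^+ 2)%:E)
   `^ 2^-1)%E.

End operators.

Section tent_spaces.
Context {R : realType} {n : nat}.
Implicit Types (p : \bar R) (f g : spacetime R n -> R[i]).

Definition ball_average (x : 'rV[R]_n) (r : R) (h : 'rV[R]_n -> R) : \bar R :=
  ((fine (lebesgue_rV n (eball x r)))^-1%:E *
   \int[lebesgue_rV n]_(y in eball x r) (h y)%:E)%E.

Definition tent_norm_fin (q : R) g : \bar R :=
  ((\int[lebesgue_rV n]_x
      (\int[lebesgue_measure]_(t in `]0%R, +oo[)
         ball_average x (Num.sqrt t) (fun y => (normc (g (t, y)) ^+ 2)%R))
      `^ (q / 2))
   `^ q^-1)%E.

Definition tent_norm_infty g : \bar R :=
  ereal_sup [set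
    ((\int[lebesgue_measure]_(t in `]0%R, (xr.2 ^+ 2)%R[)
        ball_average xr.1 xr.2 (fun y => (normc (g (t, y)) ^+ 2)%R))
     `^ 2^-1)%E | xr in [set xr : 'rV[R]_n * R | 0 < xr.2]].

(* Meant for 0 < p <= +oo; the value at -oo is irrelevant. *)
Definition tent_norm p g : \bar R :=
  match p with
  | q%:E => tent_norm_fin q g
  | +oo%E => tent_norm_infty g
  | -oo%E => 0%E
  end.

Definition tent_space p g : Prop :=
  [/\ measurable_fun half_space (@complex.Re R \o g),
      measurable_fun half_space (@complex.Im R \o g) &
      (tent_norm p g < +oo)%E].

(* T^p consists of classes of functions modulo almost everywhere equality, so
   an operator on T^p is one on representatives that respects this relation. *)
Record bounded_sublinear p
    (S : (spacetime R n -> R[i]) -> (spacetime R n -> R[i])) : Prop := {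
  tent_stable : forall f, tent_space p f -> tent_space p (S f);
  tent_ae_compat : forall f g, tent_space p f -> tent_space p g ->
    f = g %[ae spacetime_measure in half_space] ->
    S f = S g %[ae spacetime_measure in half_space];
  tent_subadditive : forall f g, tent_space p f -> tent_space p g ->
    \forall z \ae spacetime_measure, half_space z ->
      normc (S (fun w => f w + g w) z) <= normc (S f z) + normc (S g z);
  tent_homogeneous : forall (a : R[i]) f, tent_space p f ->
    \forall z \ae spacetime_measure, half_space z ->
      normc (S (fun w => a * f w) z) = normc a * normc (S f z);
  tent_bounded : exists C : R, forall f, tent_space p f ->
    (tent_norm p (S f) <= C%:E * tent_norm p f)%E }.

Definition extends_to_tent p (Q : (spacetime R n -> R[i]) ->
    (spacetime R n -> \bar R)) : Prop :=
  exists S, bounded_sublinear p S /\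
    forall f, tent_space p f -> tent_space 2%:E f ->
      \forall z \ae spacetime_measure, half_space z ->
        exists2 r : R, Q f z = r%:E & S f z = r%:C.

End tent_spaces.

(* Main.v *)
From HB Require Import structures.
Require Import Defs.
From mathcomp Require Import all_boot all_order all_algebra.
From mathcomp Require Import all_classical all_reals all_analysis.
From mathcomp Require Import measurable_realfun complex ring lra.
Set Implicit Arguments.
Unset Strict Implicit.
Unset Printing Implicit Defensive.
Import Order.TTheory GRing.Theory Num.Theory.
Import numFieldNormedType.Exports.
Import ComplexField.Normc.
Local Open Scope classical_set_scope.
Local Open Scope ring_scope.

(** Write [P_t] for the heat semigroup acting on nonnegative functions ([hP] in the code). The
    square of either operator at [(t, x)] is, up to a constant and a cutoff in [t], the integral
    over [0 < s < t] of [F_s(t - s, x)], where [F_s] is the rate at which a nonnegative energy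
    density [G_s] is lost along the heat flow started from the slice [f(s)]:
    [G(t) + (t - s) F(t) <= P_(t-s) G(s)] ([dissipative]). For the gradient, [G_s] is the squared
    modulus of the heat extension of [f(s)]. The loss is Bessel's inequality for the Gaussian
    probability measure: the squared mean plus the squared component along the logarithmic
    derivative of the kernel is at most the second moment ([heat_bessel], [dheat_bessel]). For the
    truncated operator the same energy is multiplied by [exp(1 - t/T)], whose decay on [[0, T]] pays
    for [1/T] times the squared modulus ([expR_decay]). Integration in time gives [energy]: the
    integral of [P_(b-t) F(t)] over [[a, b)], plus [G(b)], is at most [P_(b-a) G(a)]. Everything
    after that uses only positivity, self-adjointness of [P_t], and comparison of Gaussian averages
    with averages over balls.

    Endpoint [p = +oo] ([sqfun_local]): for [0 < t < r^2] the average over a ball of radius [r] is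
    dominated by [P_(2r^2-t)]. Tonelli and [energy] then leave the integral of [P_(2r^2) |f(s)|^2]
    over [0 < s < r^2], which the Carleson norm controls ([local_mass_carleson]).

    Finite [p], with [q = p/2]: the conical square function is tested against a weight [h] in the
    dual space. After Tonelli the averages of [h] over balls of radius [sqrt t] appear, and on
    dyadic time blocks they are dominated by [P_(b-t) w] for suitable weights [w]. If the weights
    satisfy [P_(T_k) h <= w_k] and [P_(T_(k+1)-T_k) w_(k+1) <= w_k], the energy inequalities on
    consecutive blocks telescope ([sqfun_weighted]) and only a terminal majorant [winit] of [h]
    remains, paired with the conical square function of [|f|^2]. Such weights are built by a
    backward recursion whose [L^r] bound, with the constant of Doob's maximal inequality, does not
    depend on the number of blocks ([weights_exist]). Choosing [h] as a power of the truncated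
    square function and absorbing gives the bound for [q > 1] ([sqfun_Asq]); for [q = 1] all weights
    are [1].

    The extension is not obtained by density. For [f] in [T^p] almost every slice has finite
    Gaussian second moments ([local_mass_good]), so the defining integrals make sense, and they are
    finite almost everywhere ([Lint_fin_ae]). Sublinearity is the triangle inequality in the
    components followed by Minkowski's inequality in [s]. *)

(** * Nonnegative integrals, Tonelli and translation invariance *)

Section nonneg_integral.
Local Open Scope ereal_scope.
Context d (T : measurableType d) (R : realType).
Variable mu : {measure set T -> \bar R}.
Import HBNNSimple.
Implicit Types (D : set T) (f g : T -> \bar R).

(* Unlike the library's [ge0_le_integral], no measurability is needed. *)
Lemma le_integral_ge0 D f g : (forall x, D x -> 0 <= f x) ->
  (forall x, D x -> f x <= g x) ->
  \int[mu]_(x in D) f x <= \int[mu]_(x in D) g x.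
Proof.
move=> f0 fg; have g0 x : D x -> 0 <= g x.
  by move=> Dx; apply: le_trans (fg _ Dx); exact: f0.
rewrite !ge0_integralE//; apply: le_ereal_sup => _ /= [h hf <-].
exists h => // x; apply: le_trans (hf x) _; rewrite /patch.
by case: ifPn => // /set_mem; exact: fg.
Qed.

Lemma integral_indE D f : measurable D ->
  \int[mu]_(x in D) f x = \int[mu]_x (f x * (\1_D x)%:E).
Proof. by move=> mD; rewrite integral_mkcond epatch_indic. Qed.

(** A simple function below [f] keeps its integral when cut off to the complement of [N], and there
    it lies below [g]. No measurability of [f] or [g] enters, which suits integrands in [s]
    controlled only outside a null set of times. *)
Lemma eq_integral_null D N f g : measurable N -> mu N = 0 ->
  (forall x, D x -> 0 <= f x) -> (forall x, D x -> 0 <= g x) ->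
  (forall x, D x -> ~ N x -> f x = g x) ->
  \int[mu]_(x in D) f x = \int[mu]_(x in D) g x.
Proof.
move=> mN N0.
wlog suff : f g / (forall x, D x -> 0 <= f x) -> (forall x, D x -> 0 <= g x) ->
    (forall x, D x -> ~ N x -> f x = g x) ->
    \int[mu]_(x in D) f x <= \int[mu]_(x in D) g x.
  move=> H f0 g0 fg; apply/eqP; rewrite eq_le !H// => x Dx Nx.
  by rewrite fg.
move=> f0 g0 fg; rewrite !ge0_integralE//.
apply: ge_ereal_sup => _ /= [h hf <-].
have mC : measurable (~` N) by exact: measurableC.
have -> : sintegral mu h = \int[mu]_(x in ~` N) (h x)%:E.
  rewrite -integralT_nnsfun (ge0_negligible_integral mN)//.
  - by rewrite setTD.
  - exact/measurable_EFinP.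
  - by move=> x _; rewrite lee_fin; exact: fun_ge0.
rewrite integral_mkcond ge0_integralE; last first.
  by move=> x _; rewrite /patch; case: ifPn => // _; rewrite lee_fin; exact: fun_ge0.
rewrite patch_setT; apply: le_ereal_sup => _ /= [k kh <-].
exists k => // x; apply: le_trans (kh x) _; rewrite {1}/patch.
case: ifPn => [/set_mem Nx|_]; last first.
  by rewrite /patch; case: ifPn => // /set_mem; exact: g0.
apply: le_trans (hf x) _; rewrite /patch; case: ifPn => // /set_mem Dx.
by rewrite fg.
Qed.

End nonneg_integral.

Section tonelli_curried.
Local Open Scope ereal_scope.
Context d1 d2 (T1 : measurableType d1) (T2 : measurableType d2) (R : realType).

Lemma measurable_fun_int (m2 : {sigma_finite_measure set T2 -> \bar R})
    (f : T1 -> T2 -> \bar R) :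
  measurable_fun [set: T1 * T2] (fun z => f z.1 z.2) ->
  (forall x y, 0 <= f x y) ->
  measurable_fun [set: T1] (fun x => \int[m2]_y f x y).
Proof.
by move=> mf f0; apply: (measurable_fun_fubini_tonelli_F (fun z => f z.1 z.2)).
Qed.

Lemma tonelli (m1 : {sigma_finite_measure set T1 -> \bar R})
    (m2 : {sigma_finite_measure set T2 -> \bar R}) (f : T1 -> T2 -> \bar R) :
  measurable_fun [set: T1 * T2] (fun z => f z.1 z.2) ->
  (forall x y, 0 <= f x y) ->
  \int[m1]_x \int[m2]_y f x y = \int[m2]_y \int[m1]_x f x y.
Proof.
by move=> mf f0; apply: (fubini_tonelli (fun z => f z.1 z.2)).
Qed.

(** The positive and negative parts are treated separately, so no integrability in [y] is
    required. *)
Lemma measurable_fun_Rint (m2 : {sigma_finite_measure set T2 -> \bar R})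
    (f : T1 -> T2 -> R) :
  measurable_fun [set: T1 * T2] (fun z => f z.1 z.2) ->
  measurable_fun [set: T1] (fun x => \int[m2]_y f x y)%R.
Proof.
move=> mf; rewrite /Rintegral.
apply: (@measurableT_comp _ _ _ _ _ _ (@fine R)) => //.
rewrite (_ : (fun _ => _) = fun x => (\int[m2]_y maxe (f x y)%:E 0) -
   (\int[m2]_y maxe (- (f x y)%:E) 0)); last first.
  apply/funext => x; rewrite integralE; congr (_ - _); apply: eq_integral => y _.
    by rewrite funeposE.
  by rewrite funenegE.
have mF : measurable_fun [set: T1 * T2] (fun z => (f z.1 z.2)%:E).
  exact/measurable_EFinP.
apply: emeasurable_funB; apply: measurable_fun_int => [|x y]; rewrite ?le_max ?lexx ?orbT//.
  exact: measurable_maxe.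
by apply: measurable_maxe => //; exact: measurableT_comp.
Qed.

End tonelli_curried.

Section shift_lebesgue.
Local Open Scope ereal_scope.
Context {R : realType}.
Local Notation mu := (@lebesgue_measure R).

Lemma measurable_addr (c : R) :
  measurable_fun setT ((fun x => x + c)%R : measurableTypeR R -> measurableTypeR R).
Proof. by apply: measurable_funD. Qed.

Lemma lebesgue_measure_shift c (A : set R) : measurable A ->
  pushforward mu ((fun x => x + c)%R : _ -> measurableTypeR R) A = mu A.
Proof.
move=> mA; have mc := measurable_addr c.
pose m : {measure set (measurableTypeR R) -> \bar R} :=
  measure_function_pushforward__canonical__measure_function_Measure mu mc.
apply/esym; apply: (@lebesgue_measure_unique R m) => //= _ [[a b]] _ <-.
rewrite /m/= /pushforward/= (_ : _ @^-1` _ = `](a - c)%R, (b - c)%R]%classic).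
  rewrite !lebesgue_measure_itv/= !lte_fin ltrD2r -!EFinB.
  by case: ifP => // _; congr EFin; ring.
by apply/seteqP; split=> x /=; rewrite !in_itv/= ltrBlDr lerBrDr.
Qed.

Lemma ge0_integral_shift c (f : R -> \bar R) : measurable_fun setT f ->
  (forall x, 0 <= f x) ->
  \int[mu]_x f (x + c)%R = \int[mu]_x f x.
Proof.
move=> mf f0; have mc := measurable_addr c.
transitivity (\int[pushforward mu ((fun x => x + c)%R : _ -> measurableTypeR R)]_x f x).
  by rewrite ge0_integral_pushforward//= preimage_setT.
pose m : {measure set (measurableTypeR R) -> \bar R} :=
  measure_function_pushforward__canonical__measure_function_Measure mu mc.
by apply: (@eq_measure_integral _ _ _ _ mu m) => //= A mA _; exact: lebesgue_measure_shift.
Qed.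

End shift_lebesgue.

(** * Rules and tactics for measurability and nonnegativity *)

Section measurability_kit.
Context d (T : measurableType d) (R : realType).
Implicit Types (f g : T -> R) (n : nat).

Lemma mf_cst d' (U : measurableType d') (c : U) :
  measurable_fun [set: T] (fun=> c).
Proof. exact: measurable_cst. Qed.

Lemma mf_id : measurable_fun [set: T] (fun z => z).
Proof. exact: measurable_id. Qed.

Lemma mf_fst d1 d2 (U : measurableType d1) (V : measurableType d2)
    (f : T -> U * V) :
  measurable_fun [set: T] f -> measurable_fun [set: T] (fun z => (f z).1).
Proof. by move=> mf; apply: (measurableT_comp measurable_fst). Qed.

Lemma mf_snd d1 d2 (U : measurableType d1) (V : measurableType d2)
    (f : T -> U * V) :
  measurable_fun [set: T] f -> measurable_fun [set: T] (fun z => (f z).2).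
Proof. by move=> mf; apply: (measurableT_comp measurable_snd). Qed.

Lemma mf_pair d1 d2 (U : measurableType d1) (V : measurableType d2)
    (f : T -> U) (g : T -> V) :
  measurable_fun [set: T] f -> measurable_fun [set: T] g ->
  measurable_fun [set: T] (fun z => (f z, g z)).
Proof. by move=> mf mg; exact: measurable_fun_pair. Qed.

Lemma mf_app d1 d2 (U : measurableType d1) (V : measurableType d2)
    (h : U -> V) (f : T -> U) : measurable_fun [set: U] h ->
  measurable_fun [set: T] f -> measurable_fun [set: T] (fun z => h (f z)).
Proof. by move=> mh mf; exact: (measurableT_comp mh mf). Qed.

Lemma mf_app2 d1 d2 d3 (U : measurableType d1) (V : measurableType d2)
    (W : measurableType d3) (h : U -> V -> W) (f : T -> U) (g : T -> V) :
  measurable_fun [set: U * V] (fun z => h z.1 z.2) ->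
  measurable_fun [set: T] f -> measurable_fun [set: T] g ->
  measurable_fun [set: T] (fun z => h (f z) (g z)).
Proof. by move=> mh mf mg; apply: (measurableT_comp mh (mf_pair mf mg)). Qed.

Lemma mf_app3 d1 d2 d3 d4 (U : measurableType d1) (V : measurableType d2)
    (W : measurableType d3) (X : measurableType d4) (h : U -> V -> W -> X)
    (f : T -> U) (g : T -> V) (k : T -> W) :
  measurable_fun [set: U * V * W] (fun z => h z.1.1 z.1.2 z.2) ->
  measurable_fun [set: T] f -> measurable_fun [set: T] g ->
  measurable_fun [set: T] k ->
  measurable_fun [set: T] (fun z => h (f z) (g z) (k z)).
Proof.
by move=> mh mf mg mk; apply: (measurableT_comp mh (mf_pair (mf_pair mf mg) mk)).
Qed.

Lemma mf_add f g : measurable_fun [set: T] f -> measurable_fun [set: T] g ->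
  measurable_fun [set: T] (fun z => f z + g z).
Proof. exact: measurable_funD. Qed.

Lemma mf_opp f : measurable_fun [set: T] f ->
  measurable_fun [set: T] (fun z => - f z).
Proof. exact: measurable_funN. Qed.

Lemma mf_mul f g : measurable_fun [set: T] f -> measurable_fun [set: T] g ->
  measurable_fun [set: T] (fun z => f z * g z).
Proof. exact: measurable_funM. Qed.

Lemma mf_exprn f k : measurable_fun [set: T] f ->
  measurable_fun [set: T] (fun z => f z ^+ k).
Proof. exact: measurable_funX. Qed.

Lemma mf_sum (I : Type) (s : seq I) (h : I -> T -> R) :
  (forall i, measurable_fun [set: T] (h i)) ->
  measurable_fun [set: T] (fun z => \sum_(i <- s) h i z).
Proof. exact: measurable_sum. Qed.

Lemma mf_expR f : measurable_fun [set: T] f ->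
  measurable_fun [set: T] (fun z => expR (f z)).
Proof. by move=> mf; exact: (measurableT_comp (@measurable_expR R)). Qed.

Lemma mf_powR f r : measurable_fun [set: T] f ->
  measurable_fun [set: T] (fun z => f z `^ r).
Proof. by move=> mf; exact: (measurableT_comp (@measurable_powR R r)). Qed.

Lemma mf_sqrt f : measurable_fun [set: T] f ->
  measurable_fun [set: T] (fun z => Num.sqrt (f z)).
Proof.
move=> mf; apply: (measurableT_comp _ mf).
by apply: continuous_measurable_fun; exact: sqrt_continuous.
Qed.

Lemma mf_ltr f g : measurable_fun [set: T] f -> measurable_fun [set: T] g ->
  measurable_fun [set: T] (fun z => f z < g z).
Proof. exact: measurable_fun_ltr. Qed.

Lemma mf_ler f g : measurable_fun [set: T] f -> measurable_fun [set: T] g ->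
  measurable_fun [set: T] (fun z => f z <= g z).
Proof. exact: measurable_fun_ler. Qed.

Lemma mf_and (b c : T -> bool) : measurable_fun [set: T] b ->
  measurable_fun [set: T] c -> measurable_fun [set: T] (fun z => b z && c z).
Proof. exact: measurable_and. Qed.

Lemma mf_boolR (b : T -> bool) : measurable_fun [set: T] b ->
  measurable_fun [set: T] (fun z => (b z)%:R : R).
Proof.
move=> mb; rewrite (_ : (fun _ => _) = fun z => if b z then 1 else 0).
  by apply: measurable_fun_ifT.
by apply/funext => z; case: (b z).
Qed.

Lemma mf_inv f : measurable_fun [set: T] f ->
  measurable_fun [set: T] (fun z => (f z)^-1).
Proof.
move=> mf; apply: (measurableT_comp _ mf).
rewrite (_ : GRing.inv = fun x : R => x * (x ^+ 2) `^ (-1)); last first.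
  apply/funext => x; rewrite powR_inv1 ?sqr_ge0//.
  by have [->|x0] := eqVneq x 0; [rewrite invr0 mul0r|rewrite expr2; field].
apply: measurable_funM => //.
exact: (measurableT_comp (@measurable_powR R _) (@measurable_funX _ _ R setT id 2 _)).
Qed.

Local Open Scope ereal_scope.
Implicit Types (F G : T -> \bar R).

Lemma mf_EFin f : measurable_fun [set: T] f ->
  measurable_fun [set: T] (fun z => (f z)%:E).
Proof. by move=> mf; apply/measurable_EFinP. Qed.

Lemma mf_fine F : measurable_fun [set: T] F ->
  measurable_fun [set: T] (fun z => fine (F z)).
Proof. by move=> mF; exact: (measurableT_comp (@fine_measurable R _ measurableT)). Qed.

Lemma mf_adde F G : measurable_fun [set: T] F -> measurable_fun [set: T] G ->
  measurable_fun [set: T] (fun z => F z + G z).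
Proof. exact: emeasurable_funD. Qed.

Lemma mf_mule F G : measurable_fun [set: T] F -> measurable_fun [set: T] G ->
  measurable_fun [set: T] (fun z => F z * G z).
Proof. exact: emeasurable_funM. Qed.

Lemma mf_poweR F r : measurable_fun [set: T] F ->
  measurable_fun [set: T] (fun z => F z `^ r).
Proof. by move=> mF; exact: (measurableT_comp (@measurable_poweR R r)). Qed.

Lemma mf_maxr f g : measurable_fun [set: T] f -> measurable_fun [set: T] g ->
  measurable_fun [set: T] (fun z => Num.max (f z) (g z)).
Proof. exact: measurable_maxr. Qed.

End measurability_kit.

Section measurability_rV.
Context d (T : measurableType d) (R : realType) (n : nat).
Implicit Types (f g : T -> 'rV[R]_n).

Lemma mf_coord f i : measurable_fun [set: T] f ->
  measurable_fun [set: T] (fun z => f z 0 i).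
Proof. by move=> /measurable_fun_rVP. Qed.

Lemma mf_subV f g : measurable_fun [set: T] f -> measurable_fun [set: T] g ->
  measurable_fun [set: T] (fun z => f z - g z).
Proof.
move=> mf mg; apply/measurable_fun_rVP => i; under eq_fun do rewrite !mxE.
by apply: measurable_funB; exact: mf_coord.
Qed.

Lemma mf_enorm f : measurable_fun [set: T] f ->
  measurable_fun [set: T] (fun z => enorm (f z)).
Proof.
move=> mf; apply: mf_sqrt; apply: mf_sum => i; apply: mf_exprn.
exact: mf_coord.
Qed.

Lemma mf_heat (h : T -> R) f : measurable_fun [set: T] h ->
  measurable_fun [set: T] f ->
  measurable_fun [set: T] (fun z => heat_kernel (h z) (f z)).
Proof.
move=> mh mf; apply: mf_mul.
  by apply: mf_powR; apply: mf_mul => //; exact: mf_cst.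
apply: mf_expR; apply: mf_opp; apply: mf_mul.
  by apply: mf_exprn; exact: mf_enorm.
by apply: mf_inv; apply: mf_mul => //; exact: mf_cst.
Qed.

End measurability_rV.

Ltac meas1 := first
  [ lazymatch goal with
    | |- measurable_fun _ (fun _ => ?c) => exact: mf_cst
    | |- measurable_fun _ fst => exact: measurable_fst
    | |- measurable_fun _ snd => exact: measurable_snd
    | |- measurable_fun _ (fun z => z) => exact: mf_id
    | |- measurable_fun _ (fun _ => (_ : _ * _)%type.1) => apply: mf_fst
    | |- measurable_fun _ (fun _ => (_ : _ * _)%type.2) => apply: mf_snd
    | |- measurable_fun _ (fun _ => pair _ _) => apply: mf_pair
    | |- measurable_fun _ (fun _ => heat_kernel _ _) => apply: mf_heat
    | |- measurable_fun _ (fun _ => enorm _) => apply: mf_enorm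
    | |- measurable_fun _ (fun _ => GRing.add _ _) => first [apply: mf_adde | apply: mf_add | apply: mf_subV]
    | |- measurable_fun _ (fun _ => (- _)%R) => apply: mf_opp
    | |- measurable_fun _ (fun _ => (_ * _)%R) => apply: mf_mul
    | |- measurable_fun _ (fun _ => (_ ^-1)%R) => apply: mf_inv
    | |- measurable_fun _ (fun _ => (_ ^+ _)%R) => apply: mf_exprn
    | |- measurable_fun _ (fun _ => (_ `^ _)%R) => apply: mf_powR
    | |- measurable_fun _ (fun _ => expR _) => apply: mf_expR
    | |- measurable_fun _ (fun _ => Num.sqrt _) => apply: mf_sqrt
    | |- measurable_fun _ (fun _ => (_ < _)%R) => apply: mf_ltr
    | |- measurable_fun _ (fun _ => (_ <= _)%R) => apply: mf_ler
    | |- measurable_fun _ (fun _ => _ && _) => apply: mf_and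
    | |- measurable_fun _ (fun _ => (_ %:R)%R) => apply: mf_boolR
    | |- measurable_fun _ (fun _ => (_ * _)%E) => apply: mf_mule
    | |- measurable_fun _ (fun _ => (_ %:E)%E) => apply: mf_EFin
    | |- measurable_fun _ (fun _ => (_ `^ _)%E) => apply: mf_poweR
    | |- measurable_fun _ (fun _ => fine _) => apply: mf_fine
    | |- measurable_fun _ (fun _ => fun_of_matrix _ _ _) => apply: mf_coord
    | |- measurable_fun _ (fun _ => integral _ _ _) => apply: measurable_fun_int
    | |- measurable_fun _ (fun _ => Rintegral _ _ _) => apply: measurable_fun_Rint
    end
  | match goal with
    | mh : measurable_fun _ ?h |- measurable_fun _ (fun _ => ?h _) =>
        apply: (mf_app mh)
    | mh : measurable_fun _ (fun z => ?h z.1 z.2) |- measurable_fun _ (fun _ => ?h _ _) =>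
        apply: (mf_app2 mh)
    | mh : measurable_fun _ (fun z => ?h z.1.1 z.1.2 z.2) |-
        measurable_fun _ (fun _ => ?h _ _ _) => apply: (mf_app3 mh)
    end | assumption
  | lazymatch goal with
    | |- measurable_fun ?D (@Order.lt ?d ?T ?a) =>
        change (measurable_fun D (fun x => @Order.lt d T a x))
    | |- measurable_fun ?D (@Order.le ?d ?T ?a) =>
        change (measurable_fun D (fun x => @Order.le d T a x))
    | |- measurable_fun ?D (@heat_kernel ?d ?T ?a) =>
        change (measurable_fun D (fun x => @heat_kernel d T a x))
    end ].
Ltac meas := repeat meas1.


Lemma heat_kernel_ge0 (R : realType) n t (x : 'rV[R]_n) : 0 <= heat_kernel t x.
Proof. by rewrite mulr_ge0 ?powR_ge0// expR_ge0. Qed.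

Ltac pos1 := first
  [ lazymatch goal with
    | |- forall _, _ => intro
    | |- is_true (@Order.le _ _ _ ?x) =>
      lazymatch x with
      | (_ * _)%E => apply: mule_ge0
      | integral _ _ _ => apply: integral_ge0
      | (_ %:E)%E => rewrite lee_fin
      | (_ `^ _)%E => apply: poweR_ge0
      | (_ * _)%R => apply: mulr_ge0
      | GRing.add _ _ => first [apply: adde_ge0 | apply: addr_ge0]
      | (_ ^-1)%R => rewrite invr_ge0
      | (_ ^+ 2)%R => apply: sqr_ge0
      | (_ ^+ _)%R => apply: exprn_ge0
      | (_ `^ _)%R => apply: powR_ge0
      | (_ %:R)%R => apply: ler0n
      | heat_kernel _ _ => apply: heat_kernel_ge0
      | expR _ => apply: expR_ge0
      | Num.sqrt _ => apply: sqrtr_ge0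
      end
    end
  | match goal with
    | H : forall _, is_true (@Order.le _ _ _ (?f _)) |-
        is_true (@Order.le _ _ _ (?f _)) => apply: H
    | H : forall _ _, is_true (@Order.le _ _ _ (?f _ _)) |-
        is_true (@Order.le _ _ _ (?f _ _)) => apply: H
    | H : forall _ _ _, is_true (@Order.le _ _ _ (?f _ _ _)) |-
        is_true (@Order.le _ _ _ (?f _ _ _)) => apply: H
    | H : is_true (@Order.lt _ _ _ ?a) |- is_true (@Order.le _ _ _ ?a) =>
        exact: (ltW H)
    end
  | assumption | exact: lexx ].
Ltac pos := repeat pos1.
Ltac mp := meas; pos.

(** * The Gaussian kernel: unit mass and semigroup law *)

Section product_integral.
Context {R : realType}.

Lemma integral_lebesgue_rVS n (f : 'rV[R]_n.+1 -> \bar R) :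
  measurable_fun setT f -> (forall x, 0 <= f x)%E ->
  (\int[lebesgue_rV n.+1]_x f x =
   \int[lebesgue_measure]_a \int[lebesgue_rV n]_v f (cons_rV (a, v)))%E.
Proof.
move=> mf f0.
transitivity (\int[pushforward (lebesgue_measure \x lebesgue_rV n) (@cons_rV R n)]_x f x)%E.
  by [].
rewrite ge0_integral_pushforward//= preimage_setT fubini_tonelli1//=.
by apply: measurableT_comp => //; exact: measurable_cons_rV.
Qed.

(** Induction on the dimension, splitting off the first coordinate by Tonelli. *)
Lemma integral_lebesgue_rV_prod n (phi : 'I_n -> R -> R) (c : 'I_n -> R) :
  (forall i, measurable_fun setT (phi i)) -> (forall i x, 0 <= phi i x) ->
  (forall i, \int[lebesgue_measure]_a (phi i a)%:E = (c i)%:E)%E ->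
  (\int[lebesgue_rV n]_x (\prod_(i < n) phi i (x 0 i))%:E =
   (\prod_(i < n) c i)%:E)%E.
Proof.
elim: n phi c => [|n IH] phi c mphi phi0 phic.
  rewrite big_ord0; under eq_integral do rewrite big_ord0.
  by rewrite [LHS](@integral_dirac _ _ _ R)//= diracT mul1e.
rewrite integral_lebesgue_rVS; last 2 first.
- by apply: mf_EFin; apply: measurable_prod => i _; apply: mf_app; meas.
- by move=> x; rewrite lee_fin prodr_ge0.
under eq_integral => a _.
  under eq_integral => v _.
    rewrite big_ord_recl cons_rVE0 /=.
    under eq_bigr do rewrite cons_rVES.
    rewrite EFinM; over.
  rewrite ge0_integralZl_EFin//; last 2 first.
  - by move=> v _; rewrite lee_fin prodr_ge0.
  - by apply: mf_EFin; apply: measurable_prod => i _; apply: mf_app; meas.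
  rewrite (IH (fun i => phi (lift ord0 i)) (fun i => c (lift ord0 i)))//.
  over.
have c0 : 0 <= \prod_(i < n) c (lift ord0 i).
  apply: prodr_ge0 => i _; rewrite -lee_fin -phic.
  by apply: integral_ge0 => x _; rewrite lee_fin.
rewrite /= ge0_integralZr//=; last 2 first.
- by apply: mf_EFin; exact: mphi.
- by move=> x _; rewrite lee_fin.
by rewrite phic big_ord_recl EFinM.
Qed.

End product_integral.

Section gaussian.
Context {R : realType}.
Implicit Types (a b r s t : R).

(** The one-dimensional heat kernel, that is, the centred normal density of variance [2 * t]. *)
Definition gauss1 (t a : R) := (Num.sqrt (4 * pi * t))^-1 * expR (- (a ^+ 2 / (4 * t))).

Lemma integral_gauss1 t b : 0 < t ->
  (\int[lebesgue_measure]_a (gauss1 t (b - a))%:E = 1)%E.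
Proof.
move=> t0; rewrite -(integral_normal_pdf b (Num.sqrt (2 * t))).
apply: eq_integral => a _; congr EFin.
have s0 : Num.sqrt (2 * t) != 0 by rewrite gt_eqF// sqrtr_gt0 mulr_gt0.
rewrite normal_pdfE// /gauss1 /normal_peak /normal_fun sqr_sqrtr ?mulr_ge0 ?(ltW t0)//.
have t0' : t != 0 by rewrite gt_eqF.
congr (_^-1 * expR _); last by field.
by congr Num.sqrt; ring.
Qed.

Lemma enorm_sqr n (x : 'rV[R]_n) : enorm x ^+ 2 = \sum_(i < n) x 0 i ^+ 2.
Proof. by rewrite sqr_sqrtr// sumr_ge0// => i _; rewrite sqr_ge0. Qed.

Lemma enorm_ge0 n (x : 'rV[R]_n) : 0 <= enorm x.
Proof. exact: sqrtr_ge0. Qed.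

Lemma enormN n (x : 'rV[R]_n) : enorm (- x) = enorm x.
Proof.
by congr Num.sqrt; apply: eq_bigr => i _; rewrite mxE sqrrN.
Qed.

Lemma enormB n (x y : 'rV[R]_n) : enorm (x - y) = enorm (y - x).
Proof. by rewrite -enormN opprB. Qed.

Lemma heat_kernelE n t (x : 'rV[R]_n) : 0 < t ->
  heat_kernel t x = ((Num.sqrt (4 * pi * t)) ^+ n)^-1 * expR (- (enorm x ^+ 2 / (4 * t))).
Proof.
move=> t0; congr (_ * _); rewrite powRN; congr (_^-1).
rewrite (_ : n%:R / 2 = 2^-1 * n%:R); last by rewrite mulrC.
rewrite powRrM powR_mulrn ?powR_ge0// powR12_sqrt//.
by rewrite !mulr_ge0// ?pi_ge0// ltW.
Qed.

Lemma heat_kernel_prod n t (x : 'rV[R]_n) : 0 < t ->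
  heat_kernel t x = \prod_(i < n) gauss1 t (x 0 i).
Proof.
move=> t0; rewrite heat_kernelE// big_split/= -expR_sum prodr_const card_ord.
by rewrite exprVn enorm_sqr mulr_suml sumrN.
Qed.

Lemma heat_kernelN n t (x : 'rV[R]_n) : heat_kernel t (- x) = heat_kernel t x.
Proof. by rewrite /heat_kernel enormN. Qed.

Lemma heat_kernelB n t (x y : 'rV[R]_n) : heat_kernel t (x - y) = heat_kernel t (y - x).
Proof. by rewrite -heat_kernelN opprB. Qed.

Lemma integral_heat_kernel n t (x : 'rV[R]_n) : 0 < t ->
  (\int[lebesgue_rV n]_y (heat_kernel t (x - y))%:E = 1)%E.
Proof.
move=> t0; under eq_integral => y _ do rewrite heat_kernel_prod//.
transitivity ((\prod_(i < n) (1 : R))%:E); last by rewrite big1.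
under eq_integral => y _. under eq_bigr => i _ do rewrite !mxE. over.
apply: (@integral_lebesgue_rV_prod _ n (fun i a => gauss1 t (x 0 i - a))).
- by move=> i; rewrite /gauss1; mp.
- by move=> i a; rewrite /gauss1; pos.
- by move=> i; rewrite integral_gauss1.
Qed.

(* Completing the square. *)
Lemma heat_kernel_mul n s t (x y z : 'rV[R]_n) : 0 < s -> 0 < t ->
  heat_kernel s (x - z) * heat_kernel t (z - y) =
  heat_kernel (s + t) (x - y) *
  heat_kernel (s * t / (s + t)) (((t / (s + t)) *: x + (s / (s + t)) *: y) - z).
Proof.
move=> s0 t0; have st0 : 0 < s + t by rewrite addr_gt0.
rewrite !heat_kernel_prod ?divr_gt0 ?mulr_gt0//.
rewrite -!big_split/=; apply: eq_bigr => i _; rewrite /gauss1 !mxE.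
rewrite mulrACA -invfM [RHS]mulrACA -invfM -!expRD -!sqrtrM; last 2 first.
- by rewrite !mulr_ge0 ?pi_ge0// ltW.
- by rewrite !mulr_ge0 ?pi_ge0// ltW.
have ? : s != 0 by rewrite gt_eqF.
have ? : t != 0 by rewrite gt_eqF.
have ? : s + t != 0 by rewrite gt_eqF.
congr (_^-1 * expR _); first by congr Num.sqrt; field.
by field; apply/and3P.
Qed.

Lemma heat_kernel_semigroup n s t (x y : 'rV[R]_n) : 0 < s -> 0 < t ->
  (\int[lebesgue_rV n]_z (heat_kernel s (x - z) * heat_kernel t (z - y))%:E =
   (heat_kernel (s + t) (x - y))%:E)%E.
Proof.
move=> s0 t0; under eq_integral do rewrite heat_kernel_mul// EFinM.
have st0 : 0 < s * t / (s + t) by rewrite divr_gt0 ?mulr_gt0 ?addr_gt0.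
by rewrite ge0_integralZl_EFin//; [rewrite integral_heat_kernel// mule1|mp..].
Qed.

End gaussian.

(** * Comparison of heat kernels at nearby times and points *)

Section kernel_comparison.
Context {R : realType} {n : nat}.
Implicit Types (x y z : 'rV[R]_n) (a b r s t : R).

(** The constant of [heat_kernel_le_of] at [r = 2], used when two times differ by a factor at most
    [2]. *)
Definition Kcst : R := 2 ^+ n * expR 1.

Lemma Kcst_gt0 : 0 < Kcst.
Proof. by rewrite mulr_gt0 ?exprn_gt0 ?expR_gt0. Qed.

Lemma Kcst_ge0 : 0 <= Kcst.
Proof. exact: ltW Kcst_gt0. Qed.

(** The normalising factors contribute [(b / a)^(n/2) <= r ^ n]; a loss of at most [1] in the
    exponent costs the factor [expR 1]. *)
Lemma heat_kernel_le_of (a b r : R) x z : 0 < a -> a <= b -> b <= r ^+ 2 * a -> 0 <= r ->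
  enorm x ^+ 2 / (4 * b) <= enorm z ^+ 2 / (4 * a) + 1 ->
  heat_kernel a z <= r ^+ n * expR 1 * heat_kernel b x.
Proof.
move=> a0 ab bra r0 xz; have b0 : 0 < b := lt_le_trans a0 ab.
rewrite !heat_kernelE// [leRHS]mulrACA -expRD; apply: ler_pM.
- by pos.
- by pos.
- have sb : 0 < Num.sqrt (4 * pi * b) by rewrite sqrtr_gt0 !mulr_gt0// pi_gt0.
  have sa : 0 < Num.sqrt (4 * pi * a) by rewrite sqrtr_gt0 !mulr_gt0// pi_gt0.
  rewrite ler_pdivlMr ?exprn_gt0// mulrC ler_pdivrMr ?exprn_gt0// -exprMn.
  rewrite lerXn2r ?nnegrE ?mulr_ge0 ?sqrtr_ge0//.
  rewrite -{1}(ger0_norm r0) -sqrtr_sqr -sqrtrM ?sqr_ge0//.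
  rewrite ler_sqrt; last by rewrite !mulr_ge0 ?pi_ge0 ?sqr_ge0 ?(ltW a0).
  by have := pi_gt0 R; nra.
- by rewrite ler_expR; lra.
Qed.

Lemma heat_kernel_le_time (a b : R) z : 0 < a -> a <= b -> b <= 2 * a ->
  heat_kernel a z <= Kcst * heat_kernel b z.
Proof.
move=> a0 ab b2a; apply: heat_kernel_le_of => //; first by nra.
apply: le_trans (_ : enorm z ^+ 2 / (4 * a) <= _); last by lra.
have b0 : 0 < b by exact: lt_le_trans ab.
by rewrite ler_wpM2l ?sqr_ge0// lef_pV2 ?posrE ?mulr_gt0// ler_pM2l.
Qed.

Lemma enorm_young (u v : 'rV[R]_n) (e : R) : 0 < e ->
  enorm (u + v) ^+ 2 <= (1 + e) * enorm u ^+ 2 + (1 + e^-1) * enorm v ^+ 2.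
Proof.
move=> e0; rewrite !enorm_sqr !mulr_sumr -big_split/=; apply: ler_sum => i _.
rewrite mxE; move: (u 0 i) (v 0 i) => a b.
have -> : (1 + e) * a ^+ 2 + (1 + e^-1) * b ^+ 2 =
  (a + b) ^+ 2 + e^-1 * (e * a - b) ^+ 2 by field; rewrite gt_eqF.
by rewrite lerDl mulr_ge0 ?sqr_ge0// invr_ge0 ltW.
Qed.

(** The gain of time from [a] to [b] pays for moving the point by a distance [sqrt (b - a)]. *)
Lemma heat_kernel_le_near (a b : R) x y z : 0 < a -> a < b -> b <= 2 * a ->
  enorm (y - z) ^+ 2 <= b - a ->
  heat_kernel a (x - y) <= Kcst * heat_kernel b (x - z).
Proof.
move=> a0 ab b2a yz; apply: heat_kernel_le_of => //; [exact: ltW|by nra|].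
have ba0 : 0 < b - a by rewrite subr_gt0.
have b0 : 0 < b by exact: lt_trans ab.
(* With the parameter [(b - a) / a] the two coefficients become [b / a] and [b / (b - a)]; after
   division by [4 * b] the first term is exactly the exponent at time [a] and the second is at most
   [1/4]. *)
have H := enorm_young (x - y) (y - z) (divr_gt0 ba0 a0).
rewrite addrA subrK in H.
have {}H : enorm (x - z) ^+ 2 <= b / a * enorm (x - y) ^+ 2 + b / (b - a) * (b - a).
  apply: le_trans H _; apply: lerD.
    by rewrite (_ : 1 + _ = b / a)//; field; rewrite gt_eqF.
  rewrite (_ : 1 + _ = b / (b - a)); last by field; rewrite !gt_eqF.
  by rewrite ler_wpM2l// divr_ge0 ?ltW.
rewrite divfK ?gt_eqF// in H.
rewrite ler_pdivrMr ?mulr_gt0//; apply: le_trans H _.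
rewrite mulrDl mul1r; apply: lerD; last by lra.
rewrite le_eqVlt; apply/orP; left; apply/eqP; field.
by rewrite gt_eqF.
Qed.

(** On the ball of radius [sqrt t] the exponent at time [s >= t] is at most [1/4], and
    [sqrt (4 pi s) <= sqrt (32 pi t)], which is below [32 pi sqrt t]. *)
Lemma heat_kernel_ge_near (t s : R) z : 0 < t -> t <= s -> s <= 8 * t ->
  enorm z ^+ 2 <= t ->
  (Num.sqrt t ^+ n)^-1 <= (32 * pi) ^+ n * expR 1 * heat_kernel s z.
Proof.
move=> t0 ts s8 zt; have s0 : 0 < s by exact: lt_le_trans ts.
have t0' : 0 < Num.sqrt t by rewrite sqrtr_gt0.
have s0' : 0 < Num.sqrt (4 * pi * s) by rewrite sqrtr_gt0 !mulr_gt0// pi_gt0.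
rewrite heat_kernelE// mulrACA -expRD -[leLHS]mulr1; apply: ler_pM => //.
- rewrite ler_pdivlMr ?exprn_gt0// mulrC ler_pdivrMr ?exprn_gt0// -exprMn.
  have p2 := @pi_ge2 R; have p0 := @pi_ge0 R.
  rewrite lerXn2r ?nnegrE ?mulr_ge0 ?sqrtr_ge0//.
  rewrite -(@ler_pXn2r _ 2)// ?nnegrE ?mulr_ge0 ?sqrtr_ge0// exprMn.
  rewrite !sqr_sqrtr ?mulr_ge0 ?(ltW t0) ?(ltW s0)//.
  have h1 : pi * s <= pi * (8 * t) by rewrite ler_wpM2l.
  have h2 : 0 <= pi * t * (pi - 1) by rewrite !mulr_ge0 ?(ltW t0)//; lra.
  nra.
- rewrite -[leLHS]expR0 ler_expR subr_ge0 ler_pdivrMr ?mulr_gt0//; lra.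
Qed.

End kernel_comparison.
Arguments Kcst {R} n.
Arguments Kcst_ge0 {R} n.
Arguments Kcst_gt0 {R} n.

(** * Volume of Euclidean balls, up to dimensional constants *)

Section ball_volume.
Context {R : realType} {n : nat}.
Implicit Types (x y z : 'rV[R]_n) (a b r s t : R).

Lemma eball_indE x r y : \1_(eball x r) y = (enorm (y - x) < r)%R%:R :> R.
Proof.
rewrite indicE; congr (_%:R); congr nat_of_bool; apply/idP/idP.
  by move=> /set_mem.
by move=> h; apply/mem_set.
Qed.

Lemma measurable_eball x r : measurable (eball x r).
Proof.
apply/(@measurable_indicP _ _ R).
rewrite (_ : \1_ _ = fun y => (enorm (y - x) < r)%R%:R); last first.
  by apply/funext => y; exact: eball_indE.
by meas.
Qed.

Lemma integral_cube x r : 0 < r ->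
  (\int[lebesgue_rV n]_y (\prod_(i < n) (`|x 0 i - y 0 i| < r)%R%:R)%:E =
   ((2 * r) ^+ n)%:E)%E.
Proof.
move=> r0.
rewrite (@integral_lebesgue_rV_prod _ n (fun i a => (`|x 0 i - a| < r)%R%:R) (fun=> 2 * r)).
- by rewrite prodr_const card_ord.
- by move=> i; apply: mf_boolR; apply: mf_ltr; [apply: measurableT_comp => //; meas|meas].
- by move=> i a; pos.
move=> i; transitivity (\int[lebesgue_measure]_a (\1_(`]x 0 i - r, x 0 i + r[ : set R) a)%:E)%E.
  apply: eq_integral => a _; congr (_%:E); rewrite indicE; congr (_%:R); congr nat_of_bool.
  by apply/idP/idP; rewrite ?inE /= in_itv/= ltr_distlC.
rewrite integral_indic// setIT.
apply: (etrans (lebesgue_measure_itv `]x 0 i - r, x 0 i + r[)); rewrite /= lte_fin.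
rewrite ifT; last by lra.
by rewrite -EFinB; congr (_%:E); ring.
Qed.

(** The ball contains the cube of half-side [r / n] and is contained in the cube of half-side [r];
    only the order of magnitude [r ^ n] matters later. *)
Lemma lebesgue_eball_lub x r : 0 < r -> (0 < n)%N ->
  exists2 v : R, lebesgue_rV n (eball x r) = v%:E &
    (2 * (r / n%:R)) ^+ n <= v <= (2 * r) ^+ n.
Proof.
move=> r0 n0.
have n0' : 0 < n%:R :> R by rewrite ltr0n.
have rn0 : 0 < r / n%:R by rewrite divr_gt0.
have E : lebesgue_rV n (eball x r) =
    (\int[lebesgue_rV n]_y (enorm (y - x) < r)%R%:R%:E)%E.
  rewrite -[in LHS](setIT (eball x r)) -integral_indic//; last exact: measurable_eball.
  by apply: eq_integral => y _; rewrite eball_indE.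
have up : (lebesgue_rV n (eball x r) <= ((2 * r) ^+ n)%:E)%E.
  rewrite E -(integral_cube x r0); apply: le_integral_ge0 => y _; first by rewrite lee_fin.
  rewrite lee_fin; case: ltP => h; last by rewrite prodr_ge0.
  rewrite big1// => i _; rewrite (le_lt_trans _ h)//.
  rewrite -[leLHS]normr_id -sqrtr_sqr ler_sqrt; last first.
    by apply: sumr_ge0 => j _; exact: sqr_ge0.
  rewrite real_normK ?num_real// (bigD1 i)//= !mxE.
  rewrite -[leLHS]addr0 lerD ?sumr_ge0//; last by move=> j _; exact: sqr_ge0.
  by rewrite -sqrrN opprB.
have lo : (((2 * (r / n%:R)) ^+ n)%:E <= lebesgue_rV n (eball x r))%E.
  rewrite E -(integral_cube x rn0); apply: le_integral_ge0 => y _.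
    by rewrite lee_fin prodr_ge0.
  rewrite lee_fin; case: ltP => h; first by apply: prodr_ile1 => i _; rewrite ler0n lern1 leq_b1.
  suff [i hi] : exists i, ~~ (`|x 0 i - y 0 i| < r / n%:R).
    by rewrite (bigD1 i)//= (negbTE hi) mul0r.
  apply/existsP; rewrite -negb_forall; apply: contraTN h => /forallP h.
  rewrite -ltNge -(ltr_pXn2r (n:=2))// ?nnegrE ?enorm_ge0 ?(ltW r0)//.
  rewrite enorm_sqr; apply: (@lt_le_trans _ _ (\sum_(i < n) (r / n%:R) ^+ 2)).
    apply: ltr_sum => [|i _]; first by apply/hasP; exists (Ordinal n0); rewrite ?mem_index_enum.
    rewrite !mxE -sqrrN opprB -real_normK ?num_real// ltrXn2r//.
  rewrite sumr_const card_ord -[_ *+ n]mulr_natr expr_div_n -mulrA ler_piMr ?sqr_ge0//.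
  by rewrite expr2 invfM -mulrA mulVf ?gt_eqF// mulr1 invf_le1// ler1n.
have : lebesgue_rV n (eball x r) \is a fin_num.
  by rewrite ge0_fin_numE//; exact: le_lt_trans up (ltry _).
move=> /fineK vE; exists (fine (lebesgue_rV n (eball x r))); first by rewrite vE.
by rewrite -!lee_fin vE lo.
Qed.

End ball_volume.

(** * The heat semigroup on nonnegative functions *)

Section heat_nonneg.
Local Open Scope ereal_scope.
Context {R : realType} {n : nat}.
Implicit Types (a b r s t : R) (x y z : 'rV[R]_n) (g w : 'rV[R]_n -> \bar R).
Local Notation la := (lebesgue_rV n).

(** Values are taken in [[0, +oo]], so that Tonelli gives symmetry and the semigroup law with no
    integrability condition. *)
Definition hP t g x : \bar R := \int[la]_y ((heat_kernel t (x - y))%:E * g y).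

Lemma hP_ge0 t g x : (forall y, 0 <= g y) -> 0 <= hP t g x.
Proof. by move=> g0; rewrite /hP; pos. Qed.

Lemma measurable_hP d (T : measurableType d) (h : T -> R) (k : T -> 'rV[R]_n)
  (g : T -> 'rV[R]_n -> \bar R) :
  measurable_fun setT h -> measurable_fun setT k ->
  measurable_fun [set: T * 'rV[R]_n] (fun p => g p.1 p.2) ->
  (forall p y, 0 <= g p y) ->
  measurable_fun [set: T] (fun p => hP (h p) (g p) (k p)).
Proof. by move=> mh mk mg g0; rewrite /hP; mp. Qed.

Lemma hP_le t g w x : (forall y, 0 <= g y) -> (forall y, g y <= w y) ->
  hP t g x <= hP t w x.
Proof.
move=> g0 gw; apply: le_integral_ge0 => y _; first by pos.
by rewrite lee_wpmul2l// lee_fin heat_kernel_ge0.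
Qed.

Lemma hPZ t g x (c : R) : (0 <= c)%R -> measurable_fun setT g ->
  (forall y, 0 <= g y) -> hP t (fun y => c%:E * g y) x = c%:E * hP t g x.
Proof.
move=> c0 mg g0; rewrite /hP -ge0_integralZl_EFin//; [|by pos|by meas].
by apply: eq_integral => y _; rewrite muleCA.
Qed.

Lemma hPD t g w x : measurable_fun setT g -> measurable_fun setT w ->
  (forall y, 0 <= g y) -> (forall y, 0 <= w y) ->
  hP t (fun y => g y + w y) x = hP t g x + hP t w x.
Proof.
move=> mg mw g0 w0; rewrite /hP -ge0_integralD//; [|by mp..].
by apply: eq_integral => y _; rewrite ge0_muleDr.
Qed.

Lemma hP_cst t (c : R) x : (0 < t)%R -> (0 <= c)%R -> hP t (fun=> c%:E) x = c%:E.
Proof.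
move=> t0 c0; rewrite /hP ge0_integralZr//; [|by mp..].
by rewrite integral_heat_kernel// mul1e.
Qed.

Lemma hP_sym t g w : measurable_fun setT g -> measurable_fun setT w ->
  (forall y, 0 <= g y) -> (forall y, 0 <= w y) ->
  \int[la]_x (w x * hP t g x) = \int[la]_x (hP t w x * g x).
Proof.
move=> mg mw g0 w0; rewrite /hP.
transitivity (\int[la]_x \int[la]_y (w x * ((heat_kernel t (x - y))%:E * g y))).
  by apply: eq_integral => x _; rewrite ge0_integralZl//; mp.
rewrite tonelli; [|by mp..].
apply: eq_integral => y _; rewrite -ge0_integralZr//; [|by mp..].
by apply: eq_integral => x _; rewrite muleA (muleC (w x)) heat_kernelB.
Qed.

(** Symmetry tested against the constant [1], which the semigroup preserves. *)
Lemma integral_hP t g : (0 < t)%R -> measurable_fun setT g ->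
  (forall y, 0 <= g y) -> \int[la]_x hP t g x = \int[la]_x g x.
Proof.
move=> t0 mg g0; have := @hP_sym t g (fun=> 1%:E) mg; under eq_integral do rewrite mul1e.
move=> -> //; apply: eq_integral => x _.
by rewrite hP_cst// mul1e.
Qed.

Lemma hP_semigroup s t g x : (0 < s)%R -> (0 < t)%R -> measurable_fun setT g ->
  (forall y, 0 <= g y) -> hP s (hP t g) x = hP (s + t) g x.
Proof.
move=> s0 t0 mg g0; rewrite /hP.
transitivity (\int[la]_z \int[la]_y ((heat_kernel s (x - z))%:E *
    ((heat_kernel t (z - y))%:E * g y))).
  by apply: eq_integral => z _; rewrite ge0_integralZl//; mp.
rewrite tonelli; [|by mp..].
apply: eq_integral => y _.
under eq_integral do rewrite muleA -EFinM.
rewrite ge0_integralZr//; [|by mp..].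
by rewrite heat_kernel_semigroup.
Qed.

Lemma hP_integral d (T : measurableType d) (mu : {sigma_finite_measure set T -> \bar R})
    t (F : T -> 'rV[R]_n -> \bar R) x :
  measurable_fun [set: T * 'rV[R]_n] (fun p => F p.1 p.2) ->
  (forall q y, 0 <= F q y) ->
  hP t (fun y => \int[mu]_q F q y) x = \int[mu]_q hP t (F q) x.
Proof.
move=> mF F0; rewrite /hP.
transitivity (\int[la]_y \int[mu]_q ((heat_kernel t (x - y))%:E * F q y)).
  apply: eq_integral => y _; rewrite ge0_integralZl//; [|by mp..].
  by apply: (mf_app2 mF); meas.
rewrite tonelli//; [|by pos].
by apply: mf_mule; [meas|apply: (mf_app2 mF); meas].
Qed.

End heat_nonneg.

(** * The heat semigroup on signed functions and its second moments *)

Section Rintegral_linear.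
Context d (T : measurableType d) (R : realType) (mu : {measure set T -> \bar R}).
Implicit Types (f g : T -> R) (c : R).

Lemma integrableZr_EFin c f : mu.-integrable setT (fun x => (f x)%:E) ->
  mu.-integrable setT (fun x => (c * f x)%:E).
Proof. by move=> fi; under eq_fun do rewrite EFinM; exact: integrableZl. Qed.

Lemma integrableD_EFin f g : mu.-integrable setT (fun x => (f x)%:E) ->
  mu.-integrable setT (fun x => (g x)%:E) ->
  mu.-integrable setT (fun x => (f x + g x)%:E).
Proof. by move=> fi gi; under eq_fun do rewrite EFinD; exact: integrableD. Qed.

Lemma RintegralZ c f : mu.-integrable setT (fun x => (f x)%:E) ->
  \int[mu]_x (c * f x) = c * \int[mu]_x f x.
Proof. by move=> fi; rewrite RintegralZl. Qed.

Lemma RintegralA f g : mu.-integrable setT (fun x => (f x)%:E) ->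
  mu.-integrable setT (fun x => (g x)%:E) ->
  \int[mu]_x (f x + g x) = \int[mu]_x f x + \int[mu]_x g x.
Proof. by move=> fi gi; rewrite RintegralD. Qed.

End Rintegral_linear.

Section heat_signed.
Context {R : realType} {n : nat}.
Implicit Types (a b c r s t : R) (x y z : 'rV[R]_n) (u v k : 'rV[R]_n -> R).
Local Notation la := (lebesgue_rV n).

Definition heatR t u x : R := \int[la]_y (heat_kernel t (x - y) * u y).

Definition dkernel (i : 'I_n) t z : R := - (z 0 i / (2 * t)) * heat_kernel t z.

Definition dheat (i : 'I_n) t u x : R := \int[la]_y (dkernel i t (x - y) * u y).

(** Finite Gaussian second moments at every scale. Slices of tent space functions have this property
    at almost every time, and it makes the convolutions with the kernel and with its derivatives
    absolutely convergent. *)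
Definition heatable u := measurable_fun setT u /\
  forall t x, 0 < t -> (hP t (fun y => (u y ^+ 2)%:E) x < +oo)%E.

Lemma integrable_dominated k (c t : R) x (w : 'rV[R]_n -> R) :
  measurable_fun setT k -> measurable_fun setT w -> 0 <= c ->
  (hP t (fun y => `|w y|%:E) x < +oo)%E ->
  (forall y, `|k y| <= c * heat_kernel t (x - y)) ->
  la.-integrable setT (fun y => (k y * w y)%:E).
Proof.
move=> mk mw c0 wfin kK; apply/integrableP; split; first by meas.
have mabs : measurable_fun setT (fun y => `|w y|) by exact: measurableT_comp.
have : (c%:E * hP t (fun y => `|w y|%:E) x < +oo)%E.
  by rewrite lte_mul_pinfty// ge0_fin_numE// hP_ge0// => y; rewrite lee_fin.
rewrite -ge0_integralZl_EFin//; last 2 first.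
- by move=> y _; rewrite mule_ge0// lee_fin ?heat_kernel_ge0.
- by meas.
apply: le_lt_trans; apply: le_integral_ge0 => y _; first exact: abse_ge0.
by rewrite abse_EFin lee_fin normrM mulrA ler_wpM2r.
Qed.

Lemma heatable_abs u t x : heatable u -> 0 < t ->
  (hP t (fun y => `|u y|%:E) x < +oo)%E.
Proof.
move=> [mu uf] t0; apply: (@le_lt_trans _ _ (hP t (fun y => 1%:E + (u y ^+ 2)%:E)%E x)).
  apply: hP_le => y; first by rewrite lee_fin.
  rewrite -EFinD lee_fin -(real_normK (num_real (u y))).
  by have := sqr_ge0 (`|u y| - 1); nra.
rewrite hPD; [|by mp..].
by rewrite hP_cst//; rewrite lte_add_pinfty ?ltry ?uf.
Qed.

Lemma integrable_heatable u k c t x : heatable u -> measurable_fun setT k ->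
  0 < t -> 0 <= c -> (forall y, `|k y| <= c * heat_kernel t (x - y)) ->
  la.-integrable setT (fun y => (k y * u y)%:E).
Proof.
move=> gu mk t0 c0 kK; apply: integrable_dominated kK => //; first by case: gu.
exact: heatable_abs.
Qed.

Lemma heatable_cst c : heatable (fun=> c).
Proof.
split=> [|t x t0]; first by meas.
by rewrite hP_cst ?sqr_ge0 ?ltry.
Qed.

Lemma integrable_heatable_sqr u k c t x : heatable u -> measurable_fun setT k ->
  0 < t -> 0 <= c -> (forall y, `|k y| <= c * heat_kernel t (x - y)) ->
  la.-integrable setT (fun y => (k y * u y ^+ 2)%:E).
Proof.
move=> [mu uf] mk t0 c0 kK; apply: integrable_dominated kK => //; first by meas.
under eq_fun do rewrite ger0_norm ?sqr_ge0//.
exact: uf.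
Qed.

(* The Gaussian factor absorbs polynomials at the cost of doubling the time,
   because [a <= expR a]. *)
Lemma heat_kernel_moment t z (i : 'I_n) : 0 < t ->
  z 0 i ^+ 2 * heat_kernel t z <= 8 * t * 2 ^+ n * heat_kernel (2 * t) z.
Proof.
move=> t0; have t20 : 0 < 2 * t by rewrite mulr_gt0.
have zi : z 0 i ^+ 2 <= enorm z ^+ 2.
  by rewrite enorm_sqr (bigD1 i)//= lerDl sumr_ge0// => j _; exact: sqr_ge0.
rewrite !heat_kernelE//.
have s0 : 0 < Num.sqrt (4 * pi * t) by rewrite sqrtr_gt0 !mulr_gt0 ?pi_gt0.
have S0 : 0 < Num.sqrt (4 * pi * (2 * t)) by rewrite sqrtr_gt0 !mulr_gt0 ?pi_gt0.
have h1 : (Num.sqrt (4 * pi * t) ^+ n)^-1 <= 2 ^+ n * (Num.sqrt (4 * pi * (2 * t)) ^+ n)^-1.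
  rewrite ler_pdivlMr ?exprn_gt0// mulrC ler_pdivrMr ?exprn_gt0// -exprMn.
  rewrite lerXn2r ?nnegrE ?mulr_ge0 ?sqrtr_ge0//.
  rewrite -(@ler_pXn2r _ 2)// ?nnegrE ?mulr_ge0 ?sqrtr_ge0// exprMn.
  have p0 := @pi_gt0 R.
  rewrite !sqr_sqrtr ?mulr_ge0 ?(ltW t0) ?(ltW p0)//.
  by have := mulr_gt0 p0 t0; nra.
have h2 : z 0 i ^+ 2 * expR (- (enorm z ^+ 2 / (4 * t))) <=
    8 * t * expR (- (enorm z ^+ 2 / (4 * (2 * t)))).
  rewrite (_ : - (enorm z ^+ 2 / (4 * t)) = - (enorm z ^+ 2 / (4 * (2 * t))) - enorm z ^+ 2 / (8 * t)); last first.
    by field; rewrite gt_eqF.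
  rewrite expRD mulrCA [leRHS]mulrC ler_wpM2l ?expR_ge0// expRN.
  rewrite ler_pdivrMr ?expR_gt0//; apply: (le_trans zi).
  rewrite -ler_pdivrMl ?mulr_gt0// [X in X <= _]mulrC.
  by apply: le_trans (expR_ge1Dx _); rewrite lerDr.
rewrite mulrCA; apply: le_trans (ler_pM _ _ h1 h2) _; [by pos|by pos|].
by rewrite le_eqVlt; apply/orP; left; apply/eqP; ring.
Qed.

Lemma heat_kernel_moment1 t z (i : 'I_n) : 0 < t ->
  `|z 0 i| * heat_kernel t z <= (Kcst n + 8 * t * 2 ^+ n) * heat_kernel (2 * t) z.
Proof.
move=> t0; rewrite mulrDl; apply: le_trans (lerD _ (heat_kernel_moment z i t0)); last first.
  by apply: (@heat_kernel_le_time _ n t); lra.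
rewrite -[X in X + _]mul1r -mulrDl ler_wpM2r ?heat_kernel_ge0//.
rewrite -(real_normK (num_real (z 0 i))).
by have := sqr_ge0 (`|z 0 i| - 1); nra.
Qed.

Lemma dkernel_le t z (i : 'I_n) : 0 < t ->
  `|dkernel i t z| <= ((Kcst n + 8 * t * 2 ^+ n) / (2 * t)) * heat_kernel (2 * t) z.
Proof.
move=> t0; rewrite normrM (ger0_norm (heat_kernel_ge0 _ _)) normrN normf_div.
rewrite [`|2 * t|]ger0_norm ?mulr_ge0 ?(ltW t0)// mulrAC ler_pdivrMr ?mulr_gt0//.
rewrite mulrAC divfK ?gt_eqF ?mulr_gt0//.
exact: heat_kernel_moment1.
Qed.

Lemma heat_kernel_dom t z : `|heat_kernel t z| <= 1 * heat_kernel t z.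
Proof. by rewrite mul1r ger0_norm// heat_kernel_ge0. Qed.

Lemma measurable_dkernel d (T : measurableType d) (i : 'I_n) (h : T -> R)
    (g : T -> 'rV[R]_n) : measurable_fun setT h -> measurable_fun setT g ->
  measurable_fun setT (fun p => dkernel i (h p) (g p)).
Proof. by move=> mh mg; rewrite /dkernel; meas. Qed.

Lemma integrable_heatR u t x : heatable u -> 0 < t ->
  la.-integrable setT (fun y => (heat_kernel t (x - y) * u y)%:E).
Proof.
move=> gu t0; apply: (@integrable_heatable u _ 1 t x) => //; first by meas.
by move=> y; exact: heat_kernel_dom.
Qed.

Lemma dkernel_cst_ge0 t : 0 < t -> 0 <= (Kcst n + 8 * t * 2 ^+ n) / (2 * t) :> R.
Proof.
move=> t0; rewrite divr_ge0 ?addr_ge0 ?mulr_ge0 ?exprn_ge0 ?ltW ?Kcst_gt0//.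
Qed.

Lemma integrable_dheat u t x (i : 'I_n) : heatable u -> 0 < t ->
  la.-integrable setT (fun y => (dkernel i t (x - y) * u y)%:E).
Proof.
move=> gu t0; have t20 : 0 < 2 * t by rewrite mulr_gt0.
apply: (integrable_heatable gu _ t20 (dkernel_cst_ge0 t0)).
  by apply: measurable_dkernel; meas.
by move=> y; exact: dkernel_le.
Qed.

Lemma measurable_heatR d (T : measurableType d) (h : T -> R) (g : T -> 'rV[R]_n)
    (u : T -> 'rV[R]_n -> R) : measurable_fun setT h -> measurable_fun setT g ->
  measurable_fun [set: T * 'rV[R]_n] (fun p => u p.1 p.2) ->
  measurable_fun setT (fun p => heatR (h p) (u p) (g p)).
Proof. by move=> mh mg mu; rewrite /heatR; meas. Qed.

Lemma measurable_dheat d (T : measurableType d) (i : 'I_n) (h : T -> R)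
    (g : T -> 'rV[R]_n) (u : T -> 'rV[R]_n -> R) :
  measurable_fun setT h -> measurable_fun setT g ->
  measurable_fun [set: T * 'rV[R]_n] (fun p => u p.1 p.2) ->
  measurable_fun setT (fun p => dheat i (h p) (u p) (g p)).
Proof. by move=> mh mg mu; rewrite /dheat /dkernel; meas. Qed.

Lemma EFin_heatR u t x : heatable u -> 0 < t ->
  (heatR t u x)%:E = (\int[la]_y (heat_kernel t (x - y) * u y)%:E)%E.
Proof. by move=> gu t0; rewrite /heatR fineK// integrable_fin_num// integrable_heatR. Qed.

Lemma EFin_int_sqr u t x : heatable u -> 0 < t ->
  (\int[la]_y (heat_kernel t (x - y) * u y ^+ 2))%:E = hP t (fun y => (u y ^+ 2)%:E) x.
Proof.
move=> gu t0; have [mu uf] := gu; rewrite fineK; first by apply: eq_integral => y _; rewrite EFinM.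
apply: integrable_fin_num => //; apply: (integrable_heatable_sqr gu _ t0 ler01); first by meas.
by move=> y; exact: heat_kernel_dom.
Qed.

(* The square of the mean plus the square of the component along [xi] is at most
   the second moment: integrate [2 u phi - phi ^ 2 <= u ^ 2] with
   [phi = m + (g / M) xi]. *)
Lemma heat_bessel u t x (xi : 'rV[R]_n -> R) (M : R) : heatable u -> 0 < t -> 0 < M ->
  la.-integrable setT (fun y => (heat_kernel t (x - y) * xi y * u y)%:E) ->
  la.-integrable setT (fun y => (heat_kernel t (x - y) * xi y)%:E) ->
  la.-integrable setT (fun y => (heat_kernel t (x - y) * xi y ^+ 2)%:E) ->
  \int[la]_y (heat_kernel t (x - y) * xi y) = 0 ->
  \int[la]_y (heat_kernel t (x - y) * xi y ^+ 2) <= M ->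
  ((heatR t u x ^+ 2 + (\int[la]_y (heat_kernel t (x - y) * xi y * u y)) ^+ 2 / M)%:E <=
  hP t (fun y => (u y ^+ 2)%:E) x)%E.
Proof.
move=> gu t0 M0 i1 i2 i3 xi0 xiM; rewrite -EFin_int_sqr// lee_fin.
set m := heatR t u x; set g := \int[la]_y (_ * xi y * u y).
pose K y := heat_kernel t (x - y).
have i4 := integrable_heatR x gu t0.
have i5 : la.-integrable setT (fun y => (K y)%:E).
  by have := integrable_heatR x (heatable_cst 1) t0; under eq_fun do rewrite mulr1.
have e5 : \int[la]_y K y = 1 by rewrite /Rintegral integral_heat_kernel.
pose l := g / M.
have step : \int[la]_y (2 * m * (K y * u y) + 2 * l * (K y * xi y * u y) +
   ((- m ^+ 2) * K y + (- (2 * m * l)) * (K y * xi y) + (- l ^+ 2) * (K y * xi y ^+ 2))) <=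
   \int[la]_y (K y * u y ^+ 2).
  apply: le_Rintegral => //.
  - by do ![exact: integrableZr_EFin | apply: integrableD_EFin].
  - apply: (integrable_heatable_sqr gu _ t0 ler01); first by rewrite /K; meas.
    by move=> y; exact: heat_kernel_dom.
  - move=> y _; rewrite -subr_ge0.
    rewrite (_ : _ - _ = K y * (u y - m - l * xi y) ^+ 2); last by ring.
    by rewrite mulr_ge0 ?sqr_ge0// heat_kernel_ge0.
apply: le_trans step.
rewrite !RintegralA; try by do ![exact: integrableZr_EFin | apply: integrableD_EFin].
have -> : \int[la]_y (2 * m * (K y * u y)) = 2 * m * m by exact: RintegralZ _ i4.
have -> : \int[la]_y (2 * l * (K y * xi y * u y)) = 2 * l * g by exact: RintegralZ _ i1.
have -> : \int[la]_y (- m ^+ 2 * K y) = - m ^+ 2 * 1.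
  by rewrite -e5; exact: RintegralZ _ i5.
have -> : \int[la]_y (- (2 * m * l) * (K y * xi y)) = - (2 * m * l) * 0.
  by rewrite -xi0; exact: RintegralZ _ i2.
have -> : \int[la]_y (- l ^+ 2 * (K y * xi y ^+ 2)) = - l ^+ 2 * \int[la]_y (K y * xi y ^+ 2).
  exact: RintegralZ _ i3.
have h : l ^+ 2 * \int[la]_y (K y * xi y ^+ 2) <= l ^+ 2 * M by rewrite ler_wpM2l ?sqr_ge0.
have lM : l ^+ 2 * M = g ^+ 2 / M by rewrite /l; field; rewrite gt_eqF.
have lg : l * g = g ^+ 2 / M by rewrite /l; ring.
rewrite lM in h.
move: h lg; set A := \int[la]_y _; set B := g ^+ 2 / M => h lg.
lra.
Qed.

(** Jensen's inequality, read off from [heat_bessel] with [xi = 0]. *)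
Lemma heatR_sqr_le u t x : heatable u -> 0 < t ->
  ((heatR t u x ^+ 2)%:E <= hP t (fun y => (u y ^+ 2)%:E) x)%E.
Proof.
move=> gu t0; have := @heat_bessel u t x (fun=> 0) 1 gu t0 ltr01.
under eq_fun do rewrite mulr0 mul0r.
under [fun y => (_ * 0)%:E]eq_fun do rewrite mulr0.
under [fun y => (_ * 0 ^+ 2)%:E]eq_fun do rewrite expr0n/= mulr0.
have i0 : la.-integrable setT (fun y => 0%:E : \bar R) by exact: integrable0.
have e (w : 'rV[R]_n -> R) : (forall y, w y = 0) -> \int[la]_y w y = 0.
  by move=> wE; rewrite /Rintegral (eq_integral (cst 0%E)) ?integral0// => y _; rewrite wE.
do 3 move=> /(_ i0); rewrite !e; [|by move=> y; ring..].
by move=> /(_ erefl ler01); rewrite expr0n/= mul0r addr0.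
Qed.

Lemma heatable_heatR u t : heatable u -> 0 < t -> heatable (heatR t u).
Proof.
move=> gu t0; have mu : measurable_fun setT u by case: gu.
split; first by apply: measurable_heatR; [meas|meas|apply: mf_app; meas].
move=> s x s0; apply: (@le_lt_trans _ _ (hP s (hP t (fun y => (u y ^+ 2)%:E)) x)).
  by apply: hP_le => y; [rewrite lee_fin sqr_ge0|exact: heatR_sqr_le].
by rewrite hP_semigroup//; [case: gu => _; apply; rewrite addr_gt0|mp..].
Qed.

(** Fubini is licensed by [hP_semigroup] applied to the absolute value of [u]. *)
Lemma heatR_semigroup s t u x : heatable u -> 0 < s -> 0 < t ->
  heatR s (heatR t u) x = heatR (s + t) u x.
Proof.
move=> gu s0 t0; have st0 : 0 < s + t by rewrite addr_gt0.
have mu : measurable_fun setT u by case: gu.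
apply: EFin_inj; rewrite [RHS]EFin_heatR//.
pose f (p : 'rV[R]_n * 'rV[R]_n) :=
  (heat_kernel s (x - p.1) * (heat_kernel t (p.1 - p.2) * u p.2))%:E.
have mf : measurable_fun setT f by rewrite /f; meas.
have mabs : measurable_fun setT (fun y => `|u y|) by exact: measurableT_comp.
have intf : (la \x la)%E.-integrable setT f.
  apply/integrable12ltyP => //.
  rewrite (_ : (\int[_]_x0 _)%E = hP s (hP t (fun y => `|u y|%:E)) x).
    by rewrite hP_semigroup//; [exact: heatable_abs|meas].
  apply: eq_integral => z _; rewrite /hP -ge0_integralZl//; [|by mp..].
  apply: eq_integral => y _; rewrite /f/= -!EFinM; congr EFin.
  rewrite (normrM (heat_kernel s _)) (normrM (heat_kernel t _)).
  by rewrite (ger0_norm (heat_kernel_ge0 s _)) (ger0_norm (heat_kernel_ge0 t _)).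
transitivity (\int[la]_z \int[la]_y f (z, y))%E; last first.
  rewrite Fubini//; apply: eq_integral => y _; rewrite /f/=.
  under eq_integral do rewrite mulrA mulrC EFinM.
  rewrite integralZl//; last first.
    apply: (@integrable_dominated _ 1 s x) => //; [by meas|by meas| |]; last first.
      by move=> z; exact: heat_kernel_dom.
    under eq_fun do rewrite ger0_norm ?heat_kernel_ge0//.
    rewrite (_ : hP _ _ _ = (heat_kernel (s + t) (x - y))%:E) ?ltry//.
    by rewrite -heat_kernel_semigroup//; apply: eq_integral => z _; rewrite EFinM.
  by rewrite heat_kernel_semigroup// -EFinM mulrC.
rewrite EFin_heatR//; last exact: heatable_heatR.
apply: eq_integral => z _; rewrite /f/=.
under [RHS]eq_integral do rewrite EFinM.
rewrite [RHS]integralZl//; last exact: integrable_heatR.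
by rewrite -EFin_heatR.
Qed.

End heat_signed.

(** * Spatial derivatives of the heat extension *)

Section heat_gradient.
Context {R : realType} {n : nat}.
Implicit Types (a b c h r s t : R) (x y z : 'rV[R]_n) (u v k : 'rV[R]_n -> R).
Local Notation la := (lebesgue_rV n).

Lemma enorm_line h z (i : 'I_n) :
  enorm (h *: delta_mx 0 i + z) ^+ 2 = enorm z ^+ 2 + (2 * h * z 0 i + h ^+ 2).
Proof.
rewrite !enorm_sqr (bigD1 i)//= [in RHS](bigD1 i)//= !mxE !eqxx mulr1.
rewrite (eq_bigr (fun j => z 0 j ^+ 2)); last first.
  by move=> j ji; rewrite !mxE (negbTE ji) andbF mulr0 add0r.
by ring.
Qed.

Lemma heat_kernel_line t h z (i : 'I_n) : 0 < t ->
  heat_kernel t (h *: delta_mx 0 i + z) =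
  heat_kernel t z * expR (- (2 * h * z 0 i + h ^+ 2) / (4 * t)).
Proof.
move=> t0; rewrite /heat_kernel -[RHS]mulrA -expRD enorm_line; congr (_ * expR _).
by field; rewrite gt_eqF.
Qed.

Lemma is_derive_heat_kernel t z (i : 'I_n) c h : 0 < t ->
  is_derive h 1 (fun h => heat_kernel t (h *: delta_mx 0 i + z) * c)
    (dkernel i t (h *: delta_mx 0 i + z) * c).
Proof.
move=> t0.
rewrite (_ : (fun h => _) = fun h => (heat_kernel t z * c) *
    expR (- (2 * h * z 0 i + h ^+ 2) / (4 * t))); last first.
  by apply/funext => r; rewrite heat_kernel_line// mulrAC.
pose q h := - (2 * h * z 0 i + h ^+ 2) / (4 * t).
have dq : is_derive h 1 q (- (z 0 i + h) / (2 * t)).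
  rewrite /q; apply: is_derive_eq.
  by rewrite /GRing.scale/= ; field; rewrite gt_eqF.
have de : is_derive h 1 (fun r => expR (q r)) (- (z 0 i + h) / (2 * t) * expR (q h)).
  by have := @is_derive1_comp R expR q h _ _ (is_derive_expR (q h)) dq; rewrite mulrC.
apply: (is_derive_eq (@is_deriveZ _ _ _ _ (heat_kernel t z * c) h 1 _ de)).
rewrite /dkernel heat_kernel_line// !mxE !eqxx mulr1 -/(q h) /GRing.scale/=.
by ring.
Qed.

Lemma dheat_line_integrable u t x (i : 'I_n) h : heatable u -> 0 < t ->
  la.-integrable setT (fun y => (heat_kernel t (h *: delta_mx 0 i + (x - y)) * u y)%:E).
Proof.
move=> gu t0; have := integrable_heatR (h *: delta_mx 0 i + x) gu t0.
by under eq_fun do rewrite -addrA.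
Qed.

(** Differentiation under the integral. For [|h| < sqrt t] the derivative of the kernel is dominated
    by the kernel at time [2t] evaluated at the shifted point, and then, by [heat_kernel_le_near],
    by the kernel at time [4t] at the original point. *)
Lemma cvg_derive_heatR u t x (i : 'I_n) : heatable u -> 0 < t ->
  h^-1 *: (heatR t u (h *: delta_mx 0 i + x) - heatR t u x) @[h --> 0^'] -->
  dheat i t u x.
Proof.
move=> gu t0; have t20 : 0 < 2 * t by rewrite mulr_gt0.
have mu : measurable_fun setT u by case: gu.
pose f h y := heat_kernel t (h *: delta_mx 0 i + (x - y)) * u y.
pose C := (Kcst n + 8 * t * 2 ^+ n) / (2 * t) * Kcst n.
have C0 : 0 <= C by rewrite mulr_ge0 ?dkernel_cst_ge0 ?Kcst_ge0.
pose G y := C * heat_kernel (2 * (2 * t)) (x - y) * `|u y|.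
have mabs : measurable_fun setT (fun y => `|u y|) by exact: measurableT_comp.
have df h y : is_derive h 1 (f ^~ y) (dkernel i t (h *: delta_mx 0 i + (x - y)) * u y).
  exact: is_derive_heat_kernel.
have t40 : 0 < 2 * (2 * t) by rewrite mulr_gt0.
have st0 : 0 < Num.sqrt t by rewrite sqrtr_gt0.
have d1E h y : partial1of2 f h y = dkernel i t (h *: delta_mx 0 i + (x - y)) * u y.
  by rewrite partial1of2E; case: (df h y).
have Ia : (`](- Num.sqrt t), Num.sqrt t[%classic : set R) 0.
  by rewrite /= in_itv/= oppr_lt0 st0.
have intf h : (`](- Num.sqrt t), Num.sqrt t[%classic : set R) h ->
    la.-integrable setT (EFin \o f h).
  by move=> _; exact: dheat_line_integrable.
have derf h y : (`](- Num.sqrt t), Num.sqrt t[%classic : set R) h -> [set: 'rV[R]_n] y ->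
    derivable (f ^~ y) h 1.
  by move=> _ _; case: (df h y).
have G0 y : 0 <= G y by rewrite /G mulr_ge0// mulr_ge0// heat_kernel_ge0.
have intG : la.-integrable setT (EFin \o G).
  have := @integrable_dominated R n (fun y => C * heat_kernel (2 * (2 * t)) (x - y)) C
    (2 * (2 * t)) x (fun y => `|u y|).
  apply => //; first by meas.
    by under eq_fun do rewrite normr_id; exact: heatable_abs.
  by move=> y; rewrite ger0_norm// mulr_ge0// heat_kernel_ge0.
have Gub h y : (`](- Num.sqrt t), Num.sqrt t[%classic : set R) h -> [set: 'rV[R]_n] y ->
    `|partial1of2 f h y| <= G y.
  rewrite /= in_itv/= -ltr_norml => ht _; rewrite d1E normrM /G ler_wpM2r//.
  apply: le_trans (dkernel_le _ _ t0) _.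
  rewrite /C -[leRHS]mulrA ler_wpM2l ?dkernel_cst_ge0//.
  rewrite (_ : h *: delta_mx 0 i + (x - y) = x - (y - h *: delta_mx 0 i)); last first.
    by rewrite opprB addrCA.
  apply: heat_kernel_le_near; [by []|by lra|by lra|].
  rewrite addrAC subrr add0r enormN -[h *: _]addr0 enorm_line mxE.
  rewrite /enorm big1 => [|j _]; last by rewrite mxE expr0n.
  rewrite sqrtr0 expr0n/= mulr0 !add0r -(real_normK (num_real h)).
  have h2 : `|h| ^+ 2 <= Num.sqrt t ^+ 2 by rewrite lerXn2r ?nnegrE ?(ltW ht) ?(ltW st0).
  by rewrite sqr_sqrtr ?(ltW t0)// in h2; lra.
have := cvg_differentiation_under_integral measurableT Ia intf derf G0 intG Gub.
have -> : \int[la]_y partial1of2 f 0 y = dheat i t u x.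
  by apply: eq_Rintegral => y _; rewrite d1E scale0r add0r.
move=> H.
have E : (fun h => h^-1 *: (heatR t u (h *: delta_mx 0 i + x) - heatR t u x)) =
    (fun h => h^-1 *: (\int[la]_y f (h + 0) y - \int[la]_y f 0 y)).
  have e0 : heatR t u x = \int[la]_y f 0 y.
    by apply: eq_Rintegral => y _; rewrite /f scale0r add0r.
  have e1 h : heatR t u (h *: delta_mx 0 i + x) = \int[la]_y f (h + 0) y.
    by rewrite addr0; apply: eq_Rintegral => y _; rewrite /f addrA.
  by apply/funext => h; rewrite e0 e1.
rewrite E; exact: H.
Qed.

Lemma derive_heatR u t x (i : 'I_n) : heatable u -> 0 < t ->
  'D_(delta_mx 0 i) (heatR t u) x = dheat i t u x.
Proof. by move=> gu t0; apply: cvg_lim => //; exact: cvg_derive_heatR. Qed.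

Lemma dheat_semigroup s t u x (i : 'I_n) : heatable u -> 0 < s -> 0 < t ->
  dheat i (s + t) u x = dheat i s (heatR t u) x.
Proof.
move=> gu s0 t0; have st0 : 0 < s + t by exact: addr_gt0.
rewrite -(derive_heatR x i gu st0) -(derive_heatR x i (heatable_heatR gu t0) s0).
have -> : heatR (s + t) u = heatR s (heatR t u) by apply/funext => y; rewrite heatR_semigroup.
by [].
Qed.

(** The heat extension of a constant is that constant. This is the mean-zero property of the
    logarithmic derivative needed in [dheat_bessel]. *)
Lemma dheat_cst t c x (i : 'I_n) : 0 < t -> dheat i t (fun=> c) x = 0.
Proof.
move=> t0; rewrite -(derive_heatR x i (heatable_cst c) t0).
suff E : heatR t (fun=> c) = fun _ : 'rV[R]_n => c by rewrite E derive_cst.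
apply/funext => y; apply: EFin_inj; rewrite EFin_heatR//; last exact: heatable_cst.
under eq_integral do rewrite EFinM muleC.
rewrite integralZl//; first by rewrite integral_heat_kernel// mule1.
by have := integrable_heatR y (heatable_cst 1) t0; under eq_fun do rewrite mulr1.
Qed.

(** Each coordinate contributes with the factor [1 / 2 ^ n.+1] of [dheat_bessel]; averaging over the
    coordinates divides it by [n]. *)
Definition grad_cst : R := (n%:R * 2 ^+ n.+1)^-1.

Lemma grad_cst_gt0 : (0 < n)%N -> 0 < grad_cst.
Proof. by move=> n0; rewrite invr_gt0 mulr_gt0 ?exprn_gt0 ?ltr0n. Qed.

(** [heat_bessel] along the logarithmic derivative [xi] of the kernel in direction [i]: the
    component of [u] along [xi] is [dheat i t u x], and [heat_kernel_moment] bounds the second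
    moment of [xi] by [2 ^ n.+1 / t]. *)
Lemma dheat_bessel u t x (i : 'I_n) : heatable u -> 0 < t ->
  ((heatR t u x ^+ 2 + t / 2 ^+ n.+1 * dheat i t u x ^+ 2)%:E <=
   hP t (fun y => (u y ^+ 2)%:E) x)%E.
Proof.
move=> gu t0; have t20 : 0 < 2 * t by rewrite mulr_gt0.
pose xi y : R := - ((x - y) 0 i / (2 * t)).
have dE y : dkernel i t (x - y) = heat_kernel t (x - y) * xi y by rewrite /dkernel mulrC.
have M0 : 0 < 2 ^+ n.+1 / t :> R by rewrite divr_gt0// exprn_gt0.
have xi2 y : heat_kernel t (x - y) * xi y ^+ 2 <= 2 ^+ n.+1 / t * heat_kernel (2 * t) (x - y).
  rewrite /xi sqrrN expr_div_n mulrA ler_pdivrMr ?exprn_gt0// mulrC.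
  apply: le_trans (heat_kernel_moment _ i t0) _; rewrite le_eqVlt; apply/orP; left; apply/eqP.
  by rewrite exprS; field; rewrite gt_eqF.
have mxi2 : measurable_fun setT (fun y => heat_kernel t (x - y) * xi y ^+ 2).
  by rewrite /xi; meas.
have ixi2 : la.-integrable setT (fun y => (heat_kernel t (x - y) * xi y ^+ 2)%:E).
  have := integrable_heatable (heatable_cst 1) mxi2 t20 (ltW M0) (x := x).
  under eq_fun do rewrite mulr1.
  by apply=> y; rewrite ger0_norm ?xi2// mulr_ge0 ?sqr_ge0// heat_kernel_ge0.
have i1 : la.-integrable setT (fun y => (heat_kernel t (x - y) * xi y * u y)%:E).
  rewrite (_ : (fun y => _) = fun y => (dkernel i t (x - y) * u y)%:E).
    exact: integrable_dheat.
  by apply/funext => y; rewrite dE.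
have E1 : (fun y => heat_kernel t (x - y) * xi y) = (fun y => dkernel i t (x - y) * 1).
  by apply/funext => y; rewrite mulr1 dE.
have i2 : la.-integrable setT (fun y => (heat_kernel t (x - y) * xi y)%:E).
  rewrite (_ : (fun y => _) = fun y => (dkernel i t (x - y) * 1)%:E).
    by apply: integrable_dheat => //; exact: heatable_cst.
  by apply/funext => y; rewrite mulr1 dE.
have e2 : \int[la]_y (heat_kernel t (x - y) * xi y) = 0.
  by rewrite E1; exact: dheat_cst.
have e1 : \int[la]_y (heat_kernel t (x - y) * xi y * u y) = dheat i t u x.
  by apply: eq_Rintegral => y _; rewrite dE.
have e3 : \int[la]_y (heat_kernel t (x - y) * xi y ^+ 2) <= 2 ^+ n.+1 / t.
  have iK := integrable_heatR x (heatable_cst 1) t20.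
  have -> : 2 ^+ n.+1 / t = \int[la]_y (2 ^+ n.+1 / t * (heat_kernel (2 * t) (x - y) * 1)).
    rewrite RintegralZ// -[LHS]mulr1; congr (_ * _); apply: EFin_inj.
    rewrite -/(heatR (2 * t) (fun=> 1) x) EFin_heatR//; last exact: heatable_cst.
    by under eq_integral do rewrite mulr1; rewrite integral_heat_kernel.
  apply: le_Rintegral => //; first exact: integrableZr_EFin.
  by move=> y _; rewrite mulr1 xi2.
have := heat_bessel gu t0 M0 i1 i2 ixi2 e2 e3; rewrite e1.
by rewrite invf_div mulrC [X in (X + _)%:E]mulrC mulrC.
Qed.

End heat_gradient.

(** * The integrated energy inequality *)

Section dissipation.
Local Open Scope ereal_scope.
Context {R : realType}.
Implicit Types (a b c s t : R).
Local Notation mu := (@lebesgue_measure R).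

Lemma integral_ind_oc a b : (a <= b)%R ->
  \int[mu]_t ((a < t <= b)%R%:R%:E) = (b - a)%:E.
Proof.
move=> ab; transitivity (\int[mu]_t (\1_(`]a, b] : set R) t)%:E).
  apply: eq_integral => t _; congr (_%:E); rewrite indicE; congr (_%:R)%R; congr nat_of_bool.
  by apply/idP/idP; rewrite ?inE /= in_itv/=.
rewrite integral_indic// setIT; apply: (etrans (lebesgue_measure_itv `]a, b])).
rewrite /= lte_fin; case: ltP => // ba.
by rewrite (_ : (b - a = 0)%R)//; apply/eqP; rewrite subr_eq0 eq_le ab ba.
Qed.

Lemma integral_ind_oo a b : (a <= b)%R ->
  \int[mu]_t ((a < t < b)%R%:R%:E) = (b - a)%:E.
Proof.
move=> ab; transitivity (\int[mu]_t (\1_(`]a, b[ : set R) t)%:E).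
  apply: eq_integral => t _; congr (_%:E); rewrite indicE; congr (_%:R)%R; congr nat_of_bool.
  by apply/idP/idP; rewrite ?inE /= in_itv/=.
rewrite integral_indic// setIT; apply: (etrans (lebesgue_measure_itv `]a, b[)).
rewrite /= lte_fin; case: ltP => // ba.
by rewrite (_ : (b - a = 0)%R)//; apply/eqP; rewrite subr_eq0 eq_le ab ba.
Qed.

Lemma integral_limit_le d (T : measurableType d) (m : {measure set T -> \bar R})
    (g : T -> \bar R) (gk : nat -> T -> \bar R) (M : \bar R) :
  (forall k, measurable_fun setT (gk k)) -> (forall k x, 0 <= gk k x) ->
  (forall x, nondecreasing_seq (gk ^~ x)) ->
  (forall x, gk k x @[k --> \oo] --> g x) ->
  (forall k, \int[m]_x gk k x <= M) -> \int[m]_x g x <= M.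
Proof.
move=> mg g0 nd cv gM.
have <- : \int[m]_x (limn (gk ^~ x)) = \int[m]_x g x.
  by apply: eq_integral => x _; exact: cvg_lim (cv x).
have h := @cvg_monotone_convergence _ _ _ m setT measurableT gk mg
  (fun k x _ => g0 k x) (fun x _ => nd x).
by apply: (cvg_lee_le h) || (rewrite -(cvg_lim _ h)//; apply: lime_le; [apply/cvg_ex; eexists; exact: h|exact: nearW]).
Qed.

Lemma integral_limit_le_eventually d (T : measurableType d) (m : {measure set T -> \bar R})
    (g : T -> \bar R) (gk : nat -> T -> \bar R) (M : \bar R) :
  (forall k, measurable_fun setT (gk k)) -> (forall k x, 0 <= gk k x) ->
  (forall x, nondecreasing_seq (gk ^~ x)) ->
  (forall x, exists N, forall k, (N <= k)%N -> gk k x = g x) ->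
  (forall k, \int[m]_x gk k x <= M) -> \int[m]_x g x <= M.
Proof.
move=> mg g0 nd ev; apply: integral_limit_le => // x.
by have [N NE] := ev x; apply: cvg_near_cst; exists N => // k /= /NE ->.
Qed.

Lemma lee_ind (p q : bool) (x y : \bar R) : 0 <= y -> (p -> q /\ x <= y) ->
  p%:R%:E * x <= q%:R%:E * y.
Proof.
move=> y0; case: p => [/(_ isT)[-> xy]|_]; first by rewrite !mul1e.
by rewrite mul0e mule_ge0// lee_fin.
Qed.

(* Averaging [Psi (t - d) - Psi t >= d f t] over [t] makes the left-hand side
   telescope exactly. *)
Lemma dissipation_integral a b (Psi f : R -> \bar R) (A L : \bar R) :
  (a < b)%R -> measurable_fun setT Psi -> measurable_fun setT f ->
  (forall t, 0 <= Psi t) -> (forall t, 0 <= f t) -> 0 <= L -> A < +oo ->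
  (forall t, (a <= t < b)%R -> L <= Psi t) ->
  (forall t, (a <= t < b)%R -> Psi t <= A) ->
  (forall s t, (a <= s)%R -> (s < t)%R -> (t < b)%R ->
    Psi t + (t - s)%:E * f t <= Psi s) ->
  \int[mu]_t ((a < t < b)%R%:R%:E * f t) + L <= A.
Proof.
move=> ab mPsi mf Psi0 f0 L0 Afin LPsi PsiA step.
have A0 : 0 <= A by apply: le_trans (PsiA a _); rewrite ?lexx.
(* For a fixed lag [d], the step inequality between [t - d] and [t] is integrated over [t]. The
   integral [I] of [Psi] then occurs on both sides and cancels because it is finite; its first piece
   of length [d] is bounded through [A], and its last one supplies [L]. *)
have key (d : R) : (0 < d)%R -> (d < b - a)%R ->
    \int[mu]_t ((a + d < t < b)%R%:R%:E * f t) + L <= A.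
  move=> d0 dba.
  set I := \int[mu]_t ((a < t < b)%R%:R%:E * Psi t).
  have Ifin : I \is a fin_num.
    rewrite ge0_fin_numE; last by rewrite /I; pos.
    apply: (@le_lt_trans _ _ (\int[mu]_t ((a < t <= b)%R%:R%:E * A))).
      apply: le_integral_ge0 => t _; first by pos.
      by apply: lee_ind => // /andP[at_ tb]; rewrite at_ (ltW tb) PsiA// tb ltW.
    rewrite ge0_integralZr//; [|by mp..].
    rewrite integral_ind_oc ?ltW//.
    by rewrite lte_mul_pinfty// ?lee_fin ?subr_ge0 ?ltW.
  set X := \int[mu]_t _.
  set U := \int[mu]_t ((a < t <= a + d)%R%:R%:E * Psi t).
  set V := \int[mu]_t ((a + d < t < b)%R%:R%:E * Psi t).
  set W := \int[mu]_t ((a < t < b - d)%R%:R%:E * Psi t).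
  set Z := \int[mu]_t ((b - d < t < b)%R%:R%:E * Psi t).
  have mPd : measurable_fun setT (fun t => Psi (t - d)%R) by apply: (mf_app mPsi); meas.
  have IUV : I = U + V.
    rewrite /U /V -ge0_integralD//; [|by mp..].
    apply: eq_integral => t _; rewrite -ge0_muleDl ?lee_fin//; congr (_ * _).
    rewrite -EFinD; congr EFin.
    by case: (ltP a t); case: (ltP t b); case: (lerP t (a + d)%R) => /= *; lra.
  have IWZ : W + Z <= I.
    rewrite /W /Z -ge0_integralD//; [|by mp..].
    apply: le_integral_ge0 => t _; first by pos.
    rewrite -ge0_muleDl ?lee_fin// lee_wpmul2r// -EFinD lee_fin.
    by case: (ltP a t); case: (ltP t b); case: (ltP t (b - d)%R); case: (ltP (b - d)%R t) => /= *; lra.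
  have WE : W = \int[mu]_t ((a + d < t < b)%R%:R%:E * Psi (t - d)%R).
    rewrite /W -(ge0_integral_shift (- d)); [|by mp..].
    by apply: eq_integral => t _; rewrite ltrBrDr ltrD2r.
  have XV : d%:E * X + V <= W.
    rewrite /X /V WE -ge0_integralZl_EFin//; [|by mp..].
    rewrite -ge0_integralD//; [|by mp..].
    apply: le_integral_ge0 => t _; first by pos.
    rewrite muleCA -ge0_muleDr//; last by pos.
    apply: lee_ind => // /andP[adt tb]; rewrite adt tb; split => //.
    rewrite addeC; have := step (t - d)%R t; rewrite subKr.
    by apply; lra.
  have UA : U <= d%:E * A.
    apply: (@le_trans _ _ (\int[mu]_t ((a < t <= a + d)%R%:R%:E * A))).
      apply: le_integral_ge0 => t _; first by pos.
      by apply: lee_ind => // /andP[at_ tb]; rewrite at_ tb PsiA//; lra.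
    by rewrite ge0_integralZr//; [rewrite integral_ind_oc; [rewrite addrC addKr|lra]|mp..].
  have LZ : d%:E * L <= Z.
    rewrite -{1}(subKr b d) -integral_ind_oo; last by lra.
    rewrite -ge0_integralZr//; [|by mp..].
    apply: le_integral_ge0 => t _; first by pos.
    by apply: lee_ind => // /andP[bt tb]; rewrite bt tb; split=> //; apply: LPsi; lra.
  have : d%:E * X + d%:E * L + I <= d%:E * A + I.
    apply: (@le_trans _ _ (W + (Z + d%:E * A))).
      by rewrite {1}IUV [U + V]addeC addeACA leeD// leeD.
    by rewrite addeA addeC leeD2l.
  rewrite leeD2rE// -ge0_muleDr//; last by rewrite /X; pos.
  by rewrite lee_pmul2l// lte_fin.
have Lfin : L \is a fin_num.
  rewrite ge0_fin_numE//; apply: le_lt_trans Afin.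
  by apply: le_trans (LPsi a _) (PsiA a _); rewrite lexx.
rewrite -leeBrDr//.
(* The shift by [2] in the denominator keeps the lag strictly below [b - a] already at [k = 0]. *)
pose d (k : nat) : R := ((b - a) / k.+2%:R)%R.
have d0 k : (0 < d k)%R by rewrite divr_gt0 ?subr_gt0.
have dba k : (d k < b - a)%R.
  by rewrite /d ltr_pdivrMr// ltr_pMr ?subr_gt0// ltr1n.
have dd k l : (k <= l)%N -> (d l <= d k)%R.
  by move=> kl; rewrite ler_wpM2l ?lef_pV2 ?posrE ?ler_nat// subr_ge0 ltW.
apply: (@integral_limit_le_eventually _ _ mu _ (fun k t => (a + d k < t < b)%R%:R%:E * f t)).
- by move=> k; meas.
- by pos.
- move=> t k l kl; apply: lee_ind => // /andP[akt tb]; split => //.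
  by rewrite tb andbT; apply: le_lt_trans akt; rewrite lerD2l dd.
- move=> t; have [at_|ta] := ltP a t; last first.
    exists 0%N => k _; have tak : (t <= a + d k)%R by rewrite (le_trans ta)// lerDl ltW.
    by have -> : (a + d k < t)%R = false by exact: le_gtF.
  have ta0 : (0 < t - a)%R by rewrite subr_gt0.
  exists (Num.truncn ((b - a) / (t - a))) => k kl; congr (_%:R%:E * _).
  suff -> : (a + d k < t)%R by [].
  rewrite -ltrBrDl /d ltr_pdivrMr// mulrC -ltr_pdivrMr//.
  apply: lt_le_trans (truncnS_gt _) _; rewrite ler_nat.
  exact: (leq_trans (n := k.+1)).
- by move=> k; rewrite leeBrDr// key.
Qed.

End dissipation.

Section energy.
Local Open Scope ereal_scope.
Context {R : realType} {n : nat}.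
Implicit Types (a b c s t : R) (x y z : 'rV[R]_n).
Local Notation mu := (@lebesgue_measure R).
Variables (F G : R -> 'rV[R]_n -> \bar R).

(* [F] is the rate at which the caloric quantity [G] is lost. *)
Record dissipative : Prop := {
  diss_mF : measurable_fun [set: R * 'rV[R]_n] (fun p => F p.1 p.2);
  diss_mG : measurable_fun [set: R * 'rV[R]_n] (fun p => G p.1 p.2);
  diss_F0 : forall t y, 0 <= F t y;
  diss_G0 : forall t y, 0 <= G t y;
  diss_fin : forall t y, (0 < t)%R -> hP t (G 0%R) y < +oo;
  diss_step : forall s t y, (0 <= s)%R -> (s < t)%R ->
    G t y + (t - s)%:E * F t y <= hP (t - s) (G s) y }.

(** Applying [P_(b-t)] to the step inequality shows that [t |-> P_(b-t) G(t)] decreases at a rate at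
    least [P_(b-t) F(t)]; [dissipation_integral] integrates this. *)
Lemma energy a b x : dissipative -> (0 <= a)%R -> (a < b)%R ->
  \int[mu]_t ((a <= t < b)%R%:R%:E * hP (b - t) (F t) x) + G b x <= hP (b - a) (G a) x.
Proof.
move=> [mF mG F0 G0 fin step] a0 ab.
(* [dissipation_integral] works on the open interval; the endpoint [a] is a null set. *)
have -> : \int[mu]_t ((a <= t < b)%R%:R%:E * hP (b - t) (F t) x) =
    \int[mu]_t ((a < t < b)%R%:R%:E * hP (b - t) (F t) x).
  apply: (@eq_integral_null _ _ _ mu setT [set a : measurableTypeR R]) => //.
  - exact: lebesgue_measure_set1.
  - by move=> t _; rewrite mule_ge0 ?hP_ge0// lee_fin.
  - by move=> t _; rewrite mule_ge0 ?hP_ge0// lee_fin.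
  - by move=> t _ /eqP ta; rewrite (lt_neqAle a) eq_sym ta.
have mGt t : measurable_fun setT (G t) by apply: (mf_app2 mG); meas.
have mFt t : measurable_fun setT (F t) by apply: (mf_app2 mF); meas.
have stepG s t y : (0 <= s)%R -> (s < t)%R -> G t y <= hP (t - s) (G s) y.
  by move=> s0 st; apply: le_trans (step s t y s0 st); rewrite leeDl// mule_ge0// lee_fin subr_ge0 ltW.
have mono s t : (a <= s)%R -> (s < t)%R -> (t < b)%R ->
    hP (b - t) (G t) x + (t - s)%:E * hP (b - t) (F t) x <= hP (b - s) (G s) x.
  move=> as_ st tb; have s0 : (0 <= s)%R by exact: le_trans as_.
  rewrite -hPZ ?subr_ge0 ?(ltW st)// -hPD//; last 2 first.
  - by meas.
  - by move=> y; rewrite mule_ge0// lee_fin subr_ge0 ltW.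
  rewrite (_ : (b - s = (b - t) + (t - s))%R); last by ring.
  have bt0 : (0 < b - t)%R by rewrite subr_gt0.
  have ts0 : (0 < t - s)%R by rewrite subr_gt0.
  rewrite -(@hP_semigroup _ _ (b - t) (t - s) (G s) x bt0 ts0)//.
  apply: hP_le => y; last exact: step.
  by rewrite adde_ge0// mule_ge0// lee_fin ltW.
have mPG : measurable_fun setT (fun t => hP (b - t) (G t) x).
  by apply: measurable_hP; [meas|meas|meas|pos].
have mPF : measurable_fun setT (fun t => hP (b - t) (F t) x).
  by apply: measurable_hP; [meas|meas|meas|pos].
have PG0 t : 0 <= hP (b - t) (G t) x by exact: hP_ge0.
have PF0 t : 0 <= hP (b - t) (F t) x by exact: hP_ge0.
(* Finiteness is assumed only for the initial datum; at a later time [a] it follows from decay of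
   the energy between [0] and [a] and the semigroup law. *)
have Afin : hP (b - a) (G a) x < +oo.
  have [->|a0'] := eqVneq a 0%R; first by rewrite subr0; apply: fin; exact: le_lt_trans ab.
  have a00 : (0 < a)%R by rewrite lt_neqAle eq_sym a0'.
  have ba0 : (0 < b - a)%R by rewrite subr_gt0.
  apply: (@le_lt_trans _ _ (hP (b - a) (hP a (G 0%R)) x)).
    by apply: hP_le => // y; have := stepG 0%R a y; rewrite subr0; apply.
  rewrite (@hP_semigroup _ _ (b - a) a)// subrK; apply: fin; exact: lt_trans ab.
have LG t : (a <= t < b)%R -> G b x <= hP (b - t) (G t) x.
  move=> /andP[at_ tb]; apply: stepG => //; exact: le_trans at_.
have GA t : (a <= t < b)%R -> hP (b - t) (G t) x <= hP (b - a) (G a) x.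
  move=> /andP[at_ tb]; have [->|ant] := eqVneq t a; first exact: lexx.
  have {}at_ : (a < t)%R by rewrite lt_neqAle eq_sym ant.
  apply: le_trans (mono a t (lexx _) at_ tb).
  by rewrite leeDl// mule_ge0// lee_fin subr_ge0 ltW.
exact: (dissipation_integral ab mPG mPF PG0 PF0 (G0 b x) Afin LG GA mono).
Qed.

End energy.

(** * Ball averages against the heat semigroup *)

Section averages.
Local Open Scope ereal_scope.
Context {R : realType} {n : nat}.
Implicit Types (a b c r s t rho : R) (x y z : 'rV[R]_n) (g w h phi : 'rV[R]_n -> \bar R).
Local Notation mu := (@lebesgue_measure R).
Local Notation la := (lebesgue_rV n).

(** Normalised by [rho ^ n] instead of the volume of the ball. The two are comparable up to
    dimensional factors, and this form makes [Av] symmetric without any formula for the volume. *)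
Definition Av rho g z : \bar R :=
  ((rho ^+ n)^-1)%:E * \int[la]_y ((enorm (y - z) < rho)%R%:R%:E * g y).

Lemma Av_ge0 rho g z : (0 <= rho)%R -> (forall y, 0 <= g y) -> 0 <= Av rho g z.
Proof. by move=> rho0 g0; rewrite /Av; pos. Qed.

Lemma measurable_Av d (T : measurableType d) (h : T -> R) (k : T -> 'rV[R]_n)
    (g : T -> 'rV[R]_n -> \bar R) :
  measurable_fun setT h -> measurable_fun setT k ->
  measurable_fun [set: T * 'rV[R]_n] (fun p => g p.1 p.2) ->
  (forall p y, 0 <= g p y) ->
  measurable_fun [set: T] (fun p => Av (h p) (g p) (k p)).
Proof. by move=> mh mk mg g0; rewrite /Av; mp. Qed.

Lemma Av_le rho g w z : (0 <= rho)%R -> (forall y, 0 <= g y) ->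
  (forall y, (enorm (y - z) < rho)%R -> g y <= w y) -> Av rho g z <= Av rho w z.
Proof.
move=> rho0 g0 gw; rewrite /Av lee_wpmul2l//; first by pos.
apply: le_integral_ge0 => y _; first by pos.
by case: (boolP (enorm (y - z) < rho)%R) => h; rewrite ?mul0e// !mul1e gw.
Qed.

Lemma Av_sym rho g w : (0 <= rho)%R -> measurable_fun setT g -> measurable_fun setT w ->
  (forall y, 0 <= g y) -> (forall y, 0 <= w y) ->
  \int[la]_x (w x * Av rho g x) = \int[la]_x (Av rho w x * g x).
Proof.
move=> rho0 mg mw g0 w0; rewrite /Av.
transitivity (\int[la]_x \int[la]_y (w x * (((rho ^+ n)^-1)%:E *
    ((enorm (y - x) < rho)%R%:R%:E * g y)))).
  apply: eq_integral => x _; rewrite ge0_integralZl//; [|by mp..].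
  by rewrite ge0_integralZl_EFin//; mp.
rewrite tonelli; [|by mp..].
apply: eq_integral => y _; rewrite -ge0_integralZl_EFin//; [|by mp..].
rewrite -ge0_integralZr//; [|by mp..].
by apply: eq_integral => x _; rewrite enormB muleCA -!muleA; congr (_ * _); rewrite muleCA.
Qed.

(** The inverse of the lower bound [(2 / n) ^ n] for the volume of the unit ball. *)
Definition ball_cst : R := (n%:R / 2) ^+ n.

Lemma ball_cst_ge0 : (0 <= ball_cst)%R.
Proof. by rewrite exprn_ge0// divr_ge0. Qed.

Lemma Av1_ge rho y : (0 < n)%N -> (0 < rho)%R -> 1 <= ball_cst%:E * Av rho (fun=> 1) y.
Proof.
move=> n0 rho0; rewrite /Av.
have [v vE /andP[vlo vup]] := lebesgue_eball_lub y rho0 n0.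
have -> : \int[la]_y0 ((enorm (y0 - y) < rho)%R%:R%:E * 1) = v%:E.
  rewrite -vE -[in RHS](setIT (eball y rho)) -integral_indic//; last exact: measurable_eball.
  by apply: eq_integral => z _; rewrite mule1 eball_indE.
rewrite -!EFinM lee_fin mulrCA -ler_pdivrMl ?invr_gt0 ?exprn_gt0// invrK mulr1.
apply: le_trans (_ : (ball_cst * (2 * (rho / n%:R)) ^+ n <= _)%R).
  rewrite /ball_cst -exprMn le_eqVlt; apply/orP; left; apply/eqP; congr (_ ^+ _)%R.
  by field; rewrite pnatr_eq0 -lt0n.
by rewrite ler_wpM2l// ball_cst_ge0.
Qed.

Definition spread_cst : R := ball_cst * Kcst n.

Lemma spread_cst_ge0 : (0 <= spread_cst)%R.
Proof. by rewrite mulr_ge0 ?ball_cst_ge0 ?Kcst_ge0. Qed.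

Lemma AvZ rho g z (c : \bar R) : 0 <= c -> measurable_fun setT g -> (forall y, 0 <= g y) ->
  Av rho (fun y => c * g y) z = c * Av rho g z.
Proof.
move=> c0 mg g0; rewrite /Av [RHS]muleCA; congr (_ * _).
by rewrite -ge0_integralZl//; [apply: eq_integral => y _; rewrite muleCA|mp..].
Qed.

Lemma hP_le_near a b w y z : (0 < a)%R -> (a < b)%R -> (b <= 2 * a)%R ->
  (enorm (y - z) ^+ 2 <= b - a)%R -> measurable_fun setT w -> (forall y, 0 <= w y) ->
  hP a w y <= (Kcst n)%:E * hP b w z.
Proof.
move=> a0 ab b2 yz mw w0.
have C0 := @Kcst_ge0 R n; rewrite /hP -ge0_integralZl_EFin//; [|by mp..].
apply: le_integral_ge0 => x _; first by pos.
rewrite muleA -EFinM lee_wpmul2r// lee_fin heat_kernelB (heat_kernelB _ z).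
exact: heat_kernel_le_near.
Qed.

(** By [heat_kernel_le_near] the evaluation point may move within radius [rho] at the price of
    passing from time [a] to time [b]; averaging over these points produces [Av]. *)
Lemma hP_le_Av a b rho w y : (0 < n)%N -> (0 < rho)%R -> (0 < a)%R -> (a < b)%R ->
  (b <= 2 * a)%R -> (rho ^+ 2 <= b - a)%R -> measurable_fun setT w -> (forall y, 0 <= w y) ->
  hP a w y <= spread_cst%:E * Av rho (hP b w) y.
Proof.
move=> n0 rho0 a0 ab b2 rab mw w0.
have P0 : 0 <= hP a w y by exact: hP_ge0.
apply: (@le_trans _ _ (hP a w y * (ball_cst%:E * Av rho (fun=> 1) y))).
  by rewrite -[leLHS]mule1 lee_wpmul2l// Av1_ge.
rewrite muleCA (EFinM ball_cst) -muleA lee_wpmul2l ?lee_fin ?ball_cst_ge0//.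
have mPb : measurable_fun setT (hP b w) by apply: measurable_hP => //; meas.
rewrite -AvZ//.
rewrite -AvZ ?lee_fin ?Kcst_ge0//; last by move=> z; exact: hP_ge0.
apply: Av_le => [||z yz]; [exact: ltW|by move=> z; rewrite mule1|].
rewrite mule1 hP_le_near// enormB; apply: le_trans rab.
by rewrite lerXn2r ?nnegrE ?enorm_ge0 ?ltW.
Qed.

(** The dual form of [hP_le_Av]: symmetry of [Av] moves the average from the kernel to the datum. *)
Lemma hP_le_hP_Av a b rho phi x : (0 < n)%N -> (0 < rho)%R -> (0 < a)%R -> (a < b)%R ->
  (b <= 2 * a)%R -> (rho ^+ 2 <= b - a)%R -> measurable_fun setT phi -> (forall y, 0 <= phi y) ->
  hP a phi x <= spread_cst%:E * hP b (Av rho phi) x.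
Proof.
move=> n0 rho0 a0 ab b2 rab mw w0.
pose Kb y : \bar R := (heat_kernel b (x - y))%:E.
have mKb : measurable_fun setT Kb by rewrite /Kb; meas.
have Kb0 y : 0 <= Kb y by rewrite lee_fin heat_kernel_ge0.
have mAv : measurable_fun setT (Av rho Kb) by apply: measurable_Av => //; meas.
have Av0 y : 0 <= Av rho Kb y by apply: Av_ge0 => //; exact: ltW.
rewrite [X in _ * X](_ : _ = \int[la]_y (Av rho Kb y * phi y)); last first.
  by rewrite -Av_sym ?ltW.
have C0 := spread_cst_ge0; rewrite -ge0_integralZl_EFin//; [|by mp..].
apply: le_integral_ge0 => y _; first by pos.
rewrite muleA lee_wpmul2r//.
apply: (@le_trans _ _ ((heat_kernel a (x - y))%:E * (ball_cst%:E * Av rho (fun=> 1) y))).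
  by rewrite -[leLHS]mule1 lee_wpmul2l ?lee_fin ?heat_kernel_ge0// Av1_ge.
rewrite muleCA (EFinM ball_cst) -muleA lee_wpmul2l ?lee_fin ?ball_cst_ge0//.
rewrite -AvZ ?lee_fin ?heat_kernel_ge0//.
have K0 : 0 <= (@Kcst R n)%:E by rewrite lee_fin Kcst_ge0.
rewrite -(AvZ _ _ K0 mKb Kb0).
apply: Av_le => [||z yz]; [exact: ltW|by move=> z; rewrite mule1 lee_fin heat_kernel_ge0|].
rewrite mule1 -EFinM lee_fin; apply: heat_kernel_le_near => //.
by rewrite enormB; apply: le_trans rab; rewrite lerXn2r ?nnegrE ?enorm_ge0 ?ltW.
Qed.

Definition near_cst : R := (32 * pi) ^+ n * expR 1.

Lemma near_cst_ge0 : (0 <= near_cst)%R.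
Proof. by rewrite mulr_ge0 ?exprn_ge0 ?mulr_ge0 ?pi_ge0 ?expR_ge0. Qed.

Lemma Av_le_hP t s w y : (0 < t)%R -> (t <= s)%R -> (s <= 8 * t)%R ->
  measurable_fun setT w -> (forall y, 0 <= w y) ->
  Av (Num.sqrt t) w y <= near_cst%:E * hP s w y.
Proof.
move=> t0 ts s8 mw w0; have C0 := near_cst_ge0.
rewrite /Av /hP -!ge0_integralZl_EFin//; [|by mp..].
apply: le_integral_ge0 => x _; first by pos.
rewrite !muleA lee_wpmul2r// -!EFinM lee_fin.
have [xy|_] := boolP (enorm (x - y) < Num.sqrt t)%R; last first.
  by rewrite mulr0 mulr_ge0 ?near_cst_ge0 ?heat_kernel_ge0.
rewrite mulr1; apply: heat_kernel_ge_near => //.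
by rewrite -[leRHS](sqr_sqrtr (ltW t0)) enormB lerXn2r ?nnegrE ?enorm_ge0 ?sqrtr_ge0 ?ltW.
Qed.

End averages.
Arguments ball_cst {R} n.
Arguments spread_cst {R} n.
Arguments near_cst {R} n.
Arguments ball_cst_ge0 {R} n.
Arguments spread_cst_ge0 {R} n.
Arguments near_cst_ge0 {R} n.

Ltac meas_op := lazymatch goal with
  | |- measurable_fun _ (fun _ => hP _ _ _) => apply: measurable_hP
  | |- measurable_fun _ (hP _ _) => apply: measurable_hP
  | |- measurable_fun _ (fun _ => Av _ _ _) => apply: measurable_Av
  | |- measurable_fun _ (Av _ _) => apply: measurable_Av
  end.
Ltac meas_part := match goal with
  | mh : measurable_fun _ (fun z => ?h z.1 z.2) |- measurable_fun _ (?h ?a) =>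
      exact: (mf_app2 mh (mf_cst a) (@mf_id _ _))
  | mh : measurable_fun _ (fun z => ?h z.1.1 z.1.2 z.2) |- measurable_fun _ (?h ?a ?b) =>
      exact: (mf_app3 mh (mf_cst a) (mf_cst b) (@mf_id _ _))
  end.
Ltac meas ::= repeat first [meas_op | meas1 | meas_part |
  lazymatch goal with
  | |- measurable _ => exact: measurableT
  | |- measurable_fun ?D (@Num.sqrt ?T) =>
      change (measurable_fun D (fun x => @Num.sqrt T x))
  end].
Ltac pos_op := lazymatch goal with
  | |- is_true (@Order.le _ _ _ (hP _ _ _)) => apply: hP_ge0
  | |- is_true (@Order.le _ _ _ (Av _ _ _)) => apply: Av_ge0
  end.
Ltac pos ::= repeat first [pos_op | pos1].

(** * Square functions: Carleson and weighted estimates *)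

Section indicators.
Local Open Scope ereal_scope.
Context {R : realType}.

Lemma ind_mul (p q : bool) (x : \bar R) :
  p%:R%:E * (q%:R%:E * x) = (p && q)%:R%:E * x.
Proof. by rewrite muleA -EFinM -natrM mulnb. Qed.

Lemma lee_ind2 (p q1 q2 : bool) (x : \bar R) : 0 <= x -> (p -> q1 || q2) ->
  p%:R%:E * x <= q1%:R%:E * x + q2%:R%:E * x.
Proof.
move=> x0; rewrite -ge0_muleDl ?lee_fin// => pq; rewrite lee_wpmul2r// -EFinD lee_fin.
by rewrite -natrD ler_nat; case: p q1 q2 pq => [] [] [] // /(_ isT).
Qed.

Lemma integral_ind_split d (T : measurableType d) (m : {measure set T -> \bar R})
    (k : T -> \bar R) (p q1 q2 : T -> bool) : measurable_fun setT k ->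
  measurable_fun setT q1 -> measurable_fun setT q2 -> (forall t, 0 <= k t) ->
  (forall t, p t -> q1 t || q2 t) ->
  \int[m]_t ((p t)%:R%:E * k t) <=
  \int[m]_t ((q1 t)%:R%:E * k t) + \int[m]_t ((q2 t)%:R%:E * k t).
Proof.
move=> mk mq1 mq2 k0 pq; rewrite -ge0_integralD; [|by mp..].
by apply: le_integral_ge0 => t _; [pos|apply: lee_ind2; [exact: k0|exact: pq]].
Qed.

End indicators.

Section area.
Local Open Scope ereal_scope.
Context {R : realType} {n : nat}.

(* The square of the conical square function, up to the volume of the unit ball. *)
Definition Asq (psi : R -> 'rV[R]_n -> \bar R) (x : 'rV[R]_n) : \bar R :=
  \int[lebesgue_measure]_s ((0 < s)%R%:R%:E * Av (Num.sqrt s) (psi s) x).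

End area.

Section square_function.
Local Open Scope ereal_scope.
Context {R : realType} {n : nat}.
Implicit Types (a b c r s t d : R) (x y z : 'rV[R]_n) (g w h : 'rV[R]_n -> \bar R).
Local Notation mu := (@lebesgue_measure R).
Local Notation la := (lebesgue_rV n).
Variables (FF GG : R -> R -> 'rV[R]_n -> \bar R) (phi : R -> 'rV[R]_n -> \bar R).
Variable C0 : R.
Hypothesis n0 : (0 < n)%N.
Hypothesis C00 : (0 <= C0)%R.
Hypothesis mFF : measurable_fun [set: R * R * 'rV[R]_n] (fun p => FF p.1.1 p.1.2 p.2).
Hypothesis mphi : measurable_fun [set: R * 'rV[R]_n] (fun p => phi p.1 p.2).
Hypothesis FF0 : forall s t y, 0 <= FF s t y.
Hypothesis phi0 : forall s y, 0 <= phi s y.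
Hypothesis diss : forall s, dissipative (FF s) (GG s).
Hypothesis GGphi : forall s y, GG s 0%R y <= C0%:E * phi s y.

Let GG0 s t y : 0 <= GG s t y. Proof. exact: (diss_G0 (diss s) t y). Qed.
Let mGG s t : measurable_fun setT (GG s t).
Proof. by have mG := diss_mG (diss s); apply: (mf_app2 mG); meas. Qed.
Let mphis s : measurable_fun setT (phi s). Proof. by meas. Qed.

(** [FF s (t - s)] is the loss at absolute time [t] of the flow started at time [s]; up to a
    constant this is the square of the operator under study. *)
Definition sqfun t y : \bar R := \int[mu]_s ((0 < s < t)%R%:R%:E * FF s (t - s) y).

Lemma measurable_sqfun : measurable_fun [set: R * 'rV[R]_n] (fun p => sqfun p.1 p.2).
Proof. by rewrite /sqfun; mp. Qed.

Lemma sqfun_ge0 t y : 0 <= sqfun t y. Proof. by rewrite /sqfun; pos. Qed.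

Lemma energy_shift s a b x : (0 <= s)%R -> (s <= a)%R -> (a < b)%R ->
  \int[mu]_t ((a <= t < b)%R%:R%:E * hP (b - t) (FF s (t - s)) x) + GG s (b - s) x <=
  hP (b - a) (GG s (a - s)) x.
Proof.
move=> s0 sa ab.
have sa0 : (0 <= a - s)%R by rewrite subr_ge0.
have sab : (a - s < b - s)%R by rewrite ltrD2r.
have E : \int[mu]_t ((a <= t < b)%R%:R%:E * hP (b - t) (FF s (t - s)) x) =
    \int[mu]_t ((a - s <= t < b - s)%R%:R%:E * hP (b - s - t) (FF s t) x).
  transitivity (\int[mu]_t ((a <= t + s < b)%R%:R%:E *
      hP (b - (t + s)) (FF s (t + s - s)) x)).
    by apply/esym; apply: (@ge0_integral_shift _ s (fun t => (a <= t < b)%R%:R%:E *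
      hP (b - t) (FF s (t - s)) x)); mp.
  apply: eq_integral => t _.
  rewrite addrK (_ : (b - (t + s) = b - s - t)%R); last by ring.
  by rewrite lerBlDr ltrBrDr.
rewrite E (_ : (b - a = b - s - (a - s))%R); last by ring.
exact: (energy x (diss s) sa0 sab).
Qed.

(** The mechanism of the endpoint [p = +oo]. The average over radius [r] is dominated by the
    semigroup at time [2r^2 - t], which lies between [r^2] and [2r^2]; exchanging [s] and [t] makes
    the inner integral an energy, bounded by its value at the starting time [s]. *)
Lemma sqfun_local r x : (0 < r)%R ->
  \int[mu]_t ((0 < t < r ^+ 2)%R%:R%:E * Av r (sqfun t) x) <=
  (near_cst n * C0 * Kcst n)%:E *
  \int[mu]_s ((0 < s < r ^+ 2)%R%:R%:E * hP (2 * r ^+ 2) (phi s) x).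
Proof.
move=> r0; have r20 : (0 < r ^+ 2)%R by rewrite exprn_gt0.
have N0 := @near_cst_ge0 R n; have K0 := @Kcst_ge0 R n; have msq := measurable_sqfun.
have sq0 := sqfun_ge0.
pose X s t := hP (2 * r ^+ 2 - t) (FF s (t - s)) x.
have X0 s t : 0 <= X s t by rewrite /X; pos.
have mX : measurable_fun [set: R * R] (fun p => X p.1 p.2) by rewrite /X; mp.
apply: (@le_trans _ _ (\int[mu]_t ((near_cst n)%:E *
    \int[mu]_s ((0 < t < r ^+ 2)%R%:R%:E * ((0 < s < t)%R%:R%:E * X s t))))).
  apply: le_integral_ge0 => t _; first by pos.
  rewrite ge0_integralZl_EFin; [|by mp..]. 
  rewrite [leRHS]muleCA; apply: lee_ind => [|/andP[t0 tr]]; first by pos.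
  rewrite t0 tr; split => //.
  have -> : \int[mu]_s ((0 < s < t)%R%:R%:E * X s t) = hP (2 * r ^+ 2 - t) (sqfun t) x.
    rewrite /sqfun hP_integral; [|by mp..].
    by apply: eq_integral => s _; rewrite hPZ; [|by mp..].
  rewrite -[X in Av X _ _](ger0_norm (ltW r0)) -sqrtr_sqr.
  by apply: Av_le_hP; [by []|lra|lra|by meas|exact: sqfun_ge0].
rewrite ge0_integralZl_EFin; [|by mp..].
rewrite -(mulrA (near_cst n)) (EFinM (near_cst n)) -muleA lee_wpmul2l//.
have -> : \int[mu]_t \int[mu]_s ((0 < t < r ^+ 2)%R%:R%:E * ((0 < s < t)%R%:R%:E * X s t)) =
    \int[mu]_s \int[mu]_t ((0 < t < r ^+ 2)%R%:R%:E * ((0 < s < t)%R%:R%:E * X s t)).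
  by apply: tonelli; mp.
have CK0 : (0 <= C0 * Kcst n)%R by rewrite mulr_ge0.
rewrite -ge0_integralZl_EFin; [|by mp..].
apply: le_integral_ge0 => s _; first by pos.
have [/andP[s0 sr]|nsr] := boolP (0 < s < r ^+ 2)%R; last first.
  rewrite integral0_eq => [|t _]; first by pos.
  case: (boolP (0 < t < r ^+ 2)%R) => [/andP[t0 tr]|]; last by rewrite mul0e.
  case: (boolP (0 < s < t)%R) => [/andP[s0 st]|]; last by rewrite mul0e mule0.
  by move: nsr; rewrite s0 (lt_trans st).
rewrite mul1e.
have b0 : (s < 2 * r ^+ 2)%R by lra.
(* Enlarging the range of [t] to [[s, 2r^2)] gives the energy inequality for the flow started at
   time [s]. *)
apply: (@le_trans _ _ (hP (2 * r ^+ 2 - s) (GG s (s - s)) x)).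
  apply: le_trans (energy_shift x (ltW s0) (lexx s) b0).
  rewrite -[leLHS]adde0 leeD//; apply: le_integral_ge0 => t _; first by pos.
  rewrite muleA -EFinM -natrM mulnb; apply: lee_ind => [|/andP[/andP[t0 tr] /andP[_ st]]].
    by pos.
  by rewrite (ltW st) /= ; split => //; lra.
rewrite subrr; apply: (@le_trans _ _ (hP (2 * r ^+ 2 - s) (fun y => C0%:E * phi s y) x)).
  exact: hP_le.
rewrite (hPZ _ _ C00 (mphis s) (phi0 s)) (EFinM C0) -muleA lee_wpmul2l ?lee_fin//.
rewrite /hP -ge0_integralZl_EFin; [|by mp..].
apply: le_integral_ge0 => y _; first by pos.
rewrite muleA lee_wpmul2r// -EFinM lee_fin; apply: heat_kernel_le_time; lra.
Qed.

(** One time block. Self-adjointness moves [P_(b-t)] from the weight onto the loss, and the energy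
    inequality on [[a, b)] applies. The terminal energy is kept on the left, so that it can feed the
    next block. *)
Lemma sqfun_block s a b w h (p : R -> bool) : (0 <= s)%R -> (s <= a)%R -> (a < b)%R ->
  measurable_fun setT p -> measurable_fun setT w -> measurable_fun setT h ->
  (forall y, 0 <= w y) -> (forall y, 0 <= h y) -> (forall y, hP b h y <= w y) ->
  (forall t, (a <= t < b)%R -> p t -> (0 < t)%R && (b <= 4 * t)%R) ->
  \int[mu]_t ((a <= t < b)%R%:R%:E * ((p t)%:R%:E *
    \int[la]_y (FF s (t - s) y * Av (Num.sqrt t) h y))) +
  (near_cst n)%:E * \int[la]_y (w y * GG s (b - s) y) <=
  (near_cst n)%:E * \int[la]_y (hP (b - a) w y * GG s (a - s) y).
Proof.
move=> s0 sa ab mpp mw mh w0 h0 hw pb; have N0 := @near_cst_ge0 R n.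
have b0 : (0 < b)%R by apply: le_lt_trans ab; exact: le_trans sa.
pose X t y := hP (b - t) (FF s (t - s)) y.
have X0 t y : 0 <= X t y by rewrite /X; pos.
have mX : measurable_fun [set: R * 'rV[R]_n] (fun p => X p.1 p.2) by rewrite /X; mp.
set I1 := \int[mu]_t _; set I2 := \int[la]_y (w y * _).
pose I3 := \int[mu]_t ((a <= t < b)%R%:R%:E * \int[la]_y (w y * X t y)).
have I20 : 0 <= I2 by rewrite /I2; pos.
have I30 : 0 <= I3 by rewrite /I3; pos.
have I13 : I1 <= (near_cst n)%:E * I3.
  rewrite /I1 /I3 -ge0_integralZl_EFin; [|by mp..].
  apply: le_integral_ge0 => t _; first by pos.
  rewrite [leRHS]muleCA; apply: lee_ind => [|/[dup] atb /andP[at_ tb]]; first by pos.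
  rewrite at_ tb; split => //.
  have [pt|_] := boolP (p t); last by rewrite mul0e; pos.
  have /andP[t0 bt] := pb t atb pt.
  rewrite mul1e /X hP_sym; [|by mp..].
  rewrite -ge0_integralZl_EFin; [|by mp..].
  apply: le_integral_ge0 => y _; first by pos.
  rewrite [leRHS]muleA [leRHS]muleC lee_wpmul2l//.
  (* Since [t < b <= 4t], the time [2b - t] lies between [t] and [8t]; it splits as [(b - t) + b],
     where [P_b h] is dominated by [w]. *)
  apply: (@le_trans _ _ ((near_cst n)%:E * hP (2 * b - t) h y)).
    by apply: Av_le_hP => //; lra.
  rewrite lee_wpmul2l ?lee_fin// (_ : (2 * b - t = (b - t) + b)%R); last by ring.
  have bt0 : (0 < b - t)%R by rewrite subr_gt0.
  by rewrite -(@hP_semigroup _ _ (b - t) b)//; apply: hP_le => // z; pos.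
apply: (@le_trans _ _ ((near_cst n)%:E * (I3 + I2))).
  by rewrite (ge0_muleDr _ I30 I20) leeD2r.
rewrite lee_wpmul2l ?lee_fin//.
have -> : I3 = \int[la]_y (w y * \int[mu]_t ((a <= t < b)%R%:R%:E * X t y)).
  transitivity (\int[mu]_t \int[la]_y (w y * ((a <= t < b)%R%:R%:E * X t y))).
    apply: eq_integral => t _; rewrite -ge0_integralZl_EFin; [|by mp..].
    by apply: eq_integral => y _; rewrite muleCA.
  rewrite tonelli; [|by mp..].
  by apply: eq_integral => y _; rewrite ge0_integralZl//; mp.
rewrite /I2 -ge0_integralD; [|by mp..].
rewrite -hP_sym//.
apply: le_integral_ge0 => y _; first by pos.
rewrite -ge0_muleDr; [|by pos|by pos].
by apply: lee_wpmul2l; [exact: w0|exact: energy_shift].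
Qed.

Section chain.
Variables (d : R) (M : nat) (h winit : 'rV[R]_n -> \bar R) (w : nat -> 'rV[R]_n -> \bar R).
Hypothesis d0 : (0 < d)%R.
Hypothesis mh : measurable_fun setT h.
Hypothesis mwinit : measurable_fun setT winit.
Hypothesis mw : forall k, measurable_fun setT (w k).
Hypothesis h0 : forall y, 0 <= h y.
Hypothesis winit0 : forall y, 0 <= winit y.
Hypothesis w0 : forall k y, 0 <= w k y.

Let T (k : nat) : R := (d * 2 ^+ k)%R.

Hypothesis hw : forall k y, (k <= M)%N -> hP (T k) h y <= w k y.
Hypothesis wdecr : forall k y, (k < M)%N -> hP (T k.+1 - T k) (w k.+1) y <= w k y.
Hypothesis w0init : forall y, hP (T 0) (w 0%N) y <= winit y.

Let T0 k : (0 < T k)%R. Proof. by rewrite mulr_gt0 ?exprn_gt0. Qed.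
Let TS k : T k.+1 = (2 * T k)%R. Proof. by rewrite /T exprS; ring. Qed.
Let Tlt k : (T k < T k.+1)%R. Proof. by rewrite TS; have := T0 k; lra. Qed.

Let wk_init k y : (k <= M)%N -> hP (T k) (w k) y <= winit y.
Proof.
elim: k y => [|k IH] y kM; first exact: w0init.
have Tk0 : (0 < T k.+1 - T k)%R by rewrite subr_gt0.
have -> : hP (T k.+1) (w k.+1) y = hP (T k) (hP (T k.+1 - T k) (w k.+1)) y.
  rewrite (@hP_semigroup _ _ (T k) (T k.+1 - T k) (w k.+1) y (T0 k) Tk0 (mw k.+1) (w0 k.+1)).
  by rewrite addrC subrK.
apply: le_trans (IH y (ltnW kM)); apply: hP_le => z; last exact: wdecr.
exact: hP_ge0.
Qed.

Let K s t := \int[la]_y (FF s (t - s) y * Av (Num.sqrt t) h y).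

Let K0 s t : 0 <= K s t. Proof. by rewrite /K; pos. Qed.

Let mK : measurable_fun [set: R * R] (fun p => K p.1 p.2).
Proof. by rewrite /K; mp. Qed.

(** Induction on the number [j] of remaining dyadic blocks. The terminal energy of the block
    [[T_k, T_(k+1))], weighted by [w_(k+1)], bounds all later blocks, and [wdecr] replaces the
    weight at time [T_k] by [w_k]. *)
Let tail j k s : (k + j)%N = M -> (0 <= s)%R -> (s <= T k)%R ->
  \int[mu]_t ((T k <= t < T M)%R%:R%:E * K s t) <=
  (near_cst n)%:E * \int[la]_y (w k y * GG s (T k - s) y).
Proof.
have N0 := @near_cst_ge0 R n.
elim: j k => [|j IH] k kM s0 sk.
  rewrite addn0 in kM; rewrite kM integral0_eq; first by pos.
  move=> t _; rewrite (_ : (T M <= t < T M)%R = false) ?mul0e//.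
  by apply/negP => /andP[h1 h2]; have := le_lt_trans h1 h2; rewrite ltxx.
have kM' : (k.+1 + j)%N = M by rewrite addSn -kM addnS.
have kltM : (k < M)%N by rewrite -kM -addSnnS leq_addr.
have sk1 : (s <= T k.+1)%R by apply: le_trans sk _; exact: ltW.
have mtrue : measurable_fun [set: R] (fun=> true) by meas.
have hyp t : (T k <= t < T k.+1)%R -> true -> (0 < t)%R && (T k.+1 <= 4 * t)%R.
  by rewrite TS => /andP[kt _] _; have := T0 k; lra.
have := @sqfun_block s (T k) (T k.+1) (w k.+1) h (fun=> true) s0 sk (Tlt k) mtrue
  (mw k.+1) mh (w0 k.+1) h0 (fun y => hw y kltM) hyp.
move=> block.
apply: (@le_trans _ _ ((near_cst n)%:E *
    \int[la]_y (hP (T k.+1 - T k) (w k.+1) y * GG s (T k - s) y))); last first.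
  rewrite lee_wpmul2l// ?lee_fin//; apply: le_integral_ge0 => y _; first by pos.
  by rewrite lee_wpmul2r// wdecr.
apply: le_trans block.
have mKs : measurable_fun setT (K s) by exact: (mf_app2 mK (mf_cst s) (@mf_id _ _)).
have split := @integral_ind_split R _ _ mu (K s) (fun t => T k <= t < T M)%R
  (fun t => T k <= t < T k.+1)%R (fun t => T k.+1 <= t < T M)%R mKs.
apply: le_trans (split _ _ (K0 s) _) _; [by meas|by meas| |].
  by move=> t /andP[-> ->]; rewrite andbT; case: ltP.
have -> : \int[mu]_t ((T k <= t < T k.+1)%R%:R%:E * K s t) =
   \int[mu]_t ((T k <= t < T k.+1)%R%:R%:E * (true%:R%:E * K s t)).
  by apply: eq_integral => t _; rewrite mul1e.
by rewrite leeD2l// IH.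
Qed.

(** The flow started at [s] sees one incomplete block [[s, T_k)] followed by complete dyadic ones.
    After telescoping only the initial energy remains, with weight [P_(T_k - s) w_k], and this
    weight is at most a multiple of the average of [winit] at scale [sqrt s]. *)
Let J s : (0 < s)%R ->
  \int[mu]_t ((s < t)%R%:R%:E * ((d <= t < T M / 2)%R%:R%:E * K s t)) <=
  (near_cst n * spread_cst n * C0)%:E *
  \int[la]_y (Av (Num.sqrt s) winit y * phi s y).
Proof.
move=> s0; have N0 := @near_cst_ge0 R n; have S0 := @spread_cst_ge0 R n.
(* If [T_M < 2s], the window [t < T_M / 2] ends before [s]. *)
have [s2|s2] := ltP (T M) (2 * s)%R.
  rewrite integral0_eq; first by pos.
  move=> t _; have [st|_] := boolP (s < t)%R; last by rewrite mul0e.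
  rewrite (_ : (d <= t < T M / 2)%R = false) ?mul0e ?mule0//.
  by apply/negP => /andP[_ tM]; lra.
have ex : exists k, (2 * s <= T k)%R by exists M.
(* [2s <= T_k] gives [T_k <= 2 (T_k - s)], as [hP_le_Av] requires; minimality of [k] gives
   [T_k <= 4t] on the first block. *)
have [k k2 kmin] := ex_minnP ex.
have kM : (k <= M)%N by exact: kmin.
have sT : (s < T k)%R by lra.
have mdt : measurable_fun [set: R] (fun t => d <= t)%R by meas.
have hyp t : (s <= t < T k)%R -> (d <= t)%R -> (0 < t)%R && (T k <= 4 * t)%R.
  move=> /andP[st tk] dt; have -> /= : (0 < t)%R by lra.
  (* For [k = 0] there is no earlier dyadic time, and the lower bound [d <= t] of the window
     replaces minimality. *)
  case: k k2 kmin {kM sT} tk => [|k] k2 kmin tk.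
    by rewrite /T expr0 mulr1; lra.
  rewrite TS leNgt; apply/negP => h1.
  by have := kmin k; rewrite ltnn => /implyP; rewrite implybF -ltNge; lra.
have block := @sqfun_block s s (T k) (w k) h (fun t => d <= t)%R (ltW s0) (lexx s) sT mdt
  (mw k) mh (w0 k) h0 (fun y => hw y kM) hyp.
clear mdt; have tl := @tail (M - k) k s (subnKC kM) (ltW s0) (ltW sT).
have mKs : measurable_fun setT (K s) by exact: (mf_app2 mK (mf_cst s) (@mf_id _ _)).
have split := @integral_ind_split R _ _ mu (K s)
  (fun t => [&& (s < t)%R, (d <= t)%R & (t < T M / 2)%R])
  (fun t => (s <= t < T k)%R && (d <= t)%R) (fun t => T k <= t < T M)%R mKs.
have -> : \int[mu]_t ((s < t)%R%:R%:E * ((d <= t < T M / 2)%R%:R%:E * K s t)) =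
    \int[mu]_t ([&& (s < t)%R, (d <= t)%R & (t < T M / 2)%R]%:R%:E * K s t).
  by apply: eq_integral => t _; exact: ind_mul.
apply: le_trans (split _ _ (K0 s) _) _; [by meas|by meas| |].
  move=> t /and3P[/ltW -> -> tM] /=.
  rewrite andbT; have tM' : (t < T M)%R by have := T0 M; lra.
  by rewrite tM' andbT; case: ltP.
have -> : \int[mu]_t (((s <= t < T k)%R && (d <= t)%R)%:R%:E * K s t) =
    \int[mu]_t ((s <= t < T k)%R%:R%:E * ((d <= t)%R%:R%:E * K s t)).
  by apply: eq_integral => t _; rewrite (ind_mul (s <= t < T k)%R).
apply: le_trans (leeD2l _ tl) _; apply: le_trans block _.
rewrite subrr -mulrA (EFinM (near_cst n)) -muleA lee_wpmul2l ?lee_fin//.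
have SC0 : (0 <= spread_cst n * C0)%R by rewrite mulr_ge0.
rewrite -ge0_integralZl_EFin; [|by mp..].
apply: le_integral_ge0 => y _; first by pos.
rewrite (EFinM (spread_cst n)) -muleA [C0%:E * _]muleCA muleA.
apply: lee_pmul; [by pos|by pos| |exact: GGphi].
apply: (@le_trans _ _ ((spread_cst n)%:E * Av (Num.sqrt s) (hP (T k) (w k)) y)).
  apply: hP_le_Av => //; [by rewrite sqrtr_gt0|lra|lra|lra|].
  by rewrite sqr_sqrtr ?(ltW s0)//; lra.
rewrite lee_wpmul2l ?lee_fin//; apply: Av_le => [||z _]; [exact: sqrtr_ge0| |exact: wk_init].
by move=> z; exact: hP_ge0.
Qed.

Definition weighted_cst : R := near_cst n * spread_cst n * C0.

(** Tonelli and symmetry of [Av] turn both sides into integrals over the starting time [s], where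
    they are compared by [J]. *)
Lemma sqfun_weighted :
  \int[la]_x (h x * \int[mu]_t ((d <= t < T M / 2)%R%:R%:E * Av (Num.sqrt t) (sqfun t) x)) <=
  weighted_cst%:E * \int[la]_x (winit x * Asq phi x).
Proof.
have N0 := @near_cst_ge0 R n; have S0 := @spread_cst_ge0 R n.
have W0 : (0 <= weighted_cst)%R by exact: (mulr_ge0 (mulr_ge0 N0 S0) C00).
have msq := measurable_sqfun; have sq0 := sqfun_ge0.
pose q t := (d <= t < T M / 2)%R.
have mq : measurable_fun [set: R] q by rewrite /q; meas.
have e1 : \int[la]_x (h x * \int[mu]_t ((q t)%:R%:E * Av (Num.sqrt t) (sqfun t) x)) =
    \int[mu]_t \int[la]_x ((q t)%:R%:E * (h x * Av (Num.sqrt t) (sqfun t) x)).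
  transitivity (\int[la]_x \int[mu]_t ((q t)%:R%:E * (h x * Av (Num.sqrt t) (sqfun t) x))).
    apply: eq_integral => x _; rewrite -ge0_integralZl; [|by mp..].
    by apply: eq_integral => t _; rewrite muleCA.
  by apply: tonelli; mp.
have e2 t : \int[la]_x ((q t)%:R%:E * (h x * Av (Num.sqrt t) (sqfun t) x)) =
    (q t)%:R%:E * \int[mu]_s ((0 < s < t)%R%:R%:E * K s t).
  rewrite ge0_integralZl_EFin; [|by mp..]; congr (_ * _).
  rewrite Av_sym; [|by mp..].
  transitivity (\int[la]_y \int[mu]_s ((0 < s < t)%R%:R%:E *
      (FF s (t - s) y * Av (Num.sqrt t) h y))).
    apply: eq_integral => y _; rewrite /sqfun -ge0_integralZl; [|by mp..].
    by apply: eq_integral => s _; rewrite muleCA [Av _ _ _ * _]muleC.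
  transitivity (\int[mu]_s \int[la]_y ((0 < s < t)%R%:R%:E *
      (FF s (t - s) y * Av (Num.sqrt t) h y))); first by apply: tonelli; mp.
  by apply: eq_integral => s _; rewrite /K ge0_integralZl_EFin; [|by mp..].
have e3 : \int[mu]_t ((q t)%:R%:E * \int[mu]_s ((0 < s < t)%R%:R%:E * K s t)) =
    \int[mu]_s ((0 < s)%R%:R%:E * \int[mu]_t ((s < t)%R%:R%:E * ((q t)%:R%:E * K s t))).
  transitivity (\int[mu]_t \int[mu]_s ((0 < s)%R%:R%:E * ((s < t)%R%:R%:E * ((q t)%:R%:E * K s t)))).
    apply: eq_integral => t _; rewrite -ge0_integralZl_EFin; [|by mp..].
    by apply: eq_integral => s _; rewrite (ind_mul (0 < s)%R) muleCA.
  transitivity (\int[mu]_s \int[mu]_t ((0 < s)%R%:R%:E * ((s < t)%R%:R%:E * ((q t)%:R%:E * K s t)))).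
    by apply: tonelli; mp.
  by apply: eq_integral => s _; rewrite ge0_integralZl_EFin; [|by mp..].
have e4 : \int[mu]_s ((0 < s)%R%:R%:E * \int[la]_y (Av (Num.sqrt s) winit y * phi s y)) =
    \int[la]_x (winit x * Asq phi x).
  transitivity (\int[mu]_s \int[la]_x (winit x * ((0 < s)%R%:R%:E * Av (Num.sqrt s) (phi s) x))).
    apply: eq_integral => s _; rewrite -Av_sym; [|by mp..].
    rewrite -ge0_integralZl_EFin; [|by mp..].
    by apply: eq_integral => x _; rewrite muleCA.
  transitivity (\int[la]_x \int[mu]_s (winit x * ((0 < s)%R%:R%:E * Av (Num.sqrt s) (phi s) x))).
    by apply: tonelli; mp.
  by apply: eq_integral => x _; rewrite /Asq ge0_integralZl; [|by mp..].
have -> : \int[la]_x (h x * \int[mu]_t ((d <= t < T M / 2)%R%:R%:E *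
    Av (Num.sqrt t) (sqfun t) x)) =
    \int[mu]_s ((0 < s)%R%:R%:E * \int[mu]_t ((s < t)%R%:R%:E * ((q t)%:R%:E * K s t))).
  by rewrite -e3; apply: etrans e1 _; apply: eq_integral => t _; exact: e2.
rewrite -e4 -ge0_integralZl_EFin; [|by mp..].
apply: le_integral_ge0 => s _; first by pos.
rewrite muleCA; have [s0|_] := boolP (0 < s)%R; last by rewrite !mul0e.
by rewrite !mul1e; exact: J.
Qed.

End chain.

End square_function.

(** * Construction of the weights: a maximal inequality of Doob type *)

Section power_inequalities.
Context {R : realType}.
Implicit Types (a b c r x y : R).

(** The concave power lies below its tangent line at [c]: Young's inequality for [(x / c)^a] and
    [1]. *)
Lemma powR_tangent x c a : 0 <= x -> 0 < c -> 0 < a -> a < 1 ->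
  x `^ a <= c `^ a * (a * (x / c) + (1 - a)).
Proof.
move=> x0 c0 a0 a1; have xc0 : 0 <= x / c by rewrite divr_ge0// ltW.
rewrite -{1}[x](divfK (lt0r_neq0 c0)) powRM ?(ltW c0)// mulrC ler_wpM2l ?powR_ge0//.
have h := @conjugate_powR R ((x / c) `^ a) 1 a^-1 (1 - a)^-1 (powR_ge0 _ _) ler01.
have := h _ _ _; rewrite !invr_gt0 !invrK subr_gt0 -powRrM mulfV ?gt_eqF// powRr1//.
rewrite powR1 mulr1 mul1r (mulrC _ a); apply=> //; ring.
Qed.

(** Only [v < g] needs an argument, and there it is Young's inequality for [g * v^(r-1)]. It is the
    pointwise core of the maximal inequality. *)
Lemma young_max r g v : 1 < r -> 0 <= g -> 0 <= v ->
  Num.max g v `^ r + r / (r - 1) * (g * v `^ (r - 1)) <=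
  v `^ r + r / (r - 1) * (g * Num.max g v `^ (r - 1)).
Proof.
move=> r1 g0 v0; have [vg|gv] := leP g v; first by [].
have r0 : 0 < r by lra.
have r10 : 0 < r - 1 by lra.
rewrite mulr_powRB1//.
have h := @conjugate_powR R g (v `^ (r - 1)) r (r / (r - 1)) g0 (powR_ge0 _ _) r0.
have := h _ _; rewrite divr_gt0// => /(_ isT).
have -> : r^-1 + (r / (r - 1))^-1 = 1 by field; rewrite !gt_eqF.
move=> /(_ erefl); rewrite -powRrM (_ : (r - 1) * (r / (r - 1)) = r); last first.
  by field; rewrite gt_eqF.
set a := g `^ r; set b := v `^ r; set c := g * _ => H.
have : r / (r - 1) * c <= r / (r - 1) * (a / r + b / (r / (r - 1))).
  by rewrite ler_wpM2l// divr_ge0 ?ltW.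
have -> : r / (r - 1) * (a / r + b / (r / (r - 1))) = (r / (r - 1) - 1) * a + b.
  by field; rewrite !gt_eqF.
lra.
Qed.

Lemma young_scaled r x y : 1 < r -> 0 <= x -> 0 <= y ->
  x * y `^ (r - 1) <= x `^ r / r + (1 - r^-1) * y `^ r.
Proof.
move=> r1 x0 y0; have r0 : 0 < r by lra.
have r10 : 0 < r - 1 by lra.
have h := @conjugate_powR R x (y `^ (r - 1)) r (r / (r - 1)) x0 (powR_ge0 _ _) r0.
have := h _ _; rewrite divr_gt0// => /(_ isT).
have -> : r^-1 + (r / (r - 1))^-1 = 1 by field; rewrite !gt_eqF.
move=> /(_ erefl); rewrite -powRrM (_ : (r - 1) * (r / (r - 1)) = r); last first.
  by field; rewrite gt_eqF.
move=> /le_trans; apply; rewrite lerD2l le_eqVlt; apply/orP; left; apply/eqP.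
by field; rewrite !gt_eqF.
Qed.

End power_inequalities.

Section heat_bounded.
Context {R : realType} {n : nat}.
Implicit Types (a b c r s t B : R) (x y z : 'rV[R]_n) (g w : 'rV[R]_n -> R).
Local Notation la := (lebesgue_rV n).

(** Bounded weights have finite heat averages, so real powers and cancellation of integrals are
    available. *)
Definition bounded_weight B g : Prop :=
  measurable_fun setT g /\ forall x, 0 <= g x <= B.

Definition Pr t g x : R := fine (hP t (fun y => (g y)%:E) x).

Lemma EFin_Pr B t g x : 0 < t -> bounded_weight B g ->
  (Pr t g x)%:E = hP t (fun y => (g y)%:E) x.
Proof.
move=> t0 [mg gB]; have B0 : 0 <= B by have /andP[] := gB 0; exact: le_trans.
have g0 y : 0 <= g y by have /andP[] := gB y.
rewrite /Pr fineK// ge0_fin_numE; last by apply: hP_ge0 => y; rewrite lee_fin.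
apply: (@le_lt_trans _ _ (hP t (fun=> B%:E) x)); last by rewrite hP_cst ?ltry.
by apply: hP_le => y; rewrite lee_fin//; have /andP[] := gB y.
Qed.

Lemma bounded_Pr B t g : 0 < t -> bounded_weight B g -> bounded_weight B (Pr t g).
Proof.
move=> t0 bg; have [mg gB] := bg; have B0 : 0 <= B by have /andP[] := gB 0; exact: le_trans.
have g0 y : 0 <= g y by have /andP[] := gB y.
split; first by rewrite /Pr; meas; pos.
move=> x; rewrite -!lee_fin (EFin_Pr _ t0 bg) hP_ge0/=; last by move=> y; rewrite lee_fin.
rewrite -[leRHS](hP_cst x t0 B0).
by apply: hP_le => y; rewrite lee_fin//; have /andP[] := gB y.
Qed.

Lemma bounded_powR B g a : 0 <= a -> bounded_weight B g ->
  bounded_weight (B `^ a) (fun x => g x `^ a).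
Proof.
move=> a0 [mg gB]; split; first by meas.
move=> x; have /andP[gx gBx] := gB x; rewrite powR_ge0/= ge0_ler_powR// nnegrE//.
exact: le_trans gBx.
Qed.

(** The tangent inequality is averaged, with [c] equal to the mean of [g]. *)
Lemma Pr_jensen B t g a x : 0 < t -> 0 < a -> a < 1 -> bounded_weight B g ->
  Pr t (fun y => g y `^ a) x <= Pr t g x `^ a.
Proof.
move=> t0 a0 a1 bg; have [mg gB] := bg.
have g0 y : 0 <= g y by have /andP[] := gB y.
have key c : 0 < c -> Pr t (fun y => g y `^ a) x <= c `^ a * (a * (Pr t g x / c) + (1 - a)).
  move=> c0; rewrite -lee_fin (EFin_Pr x t0 (bounded_powR (ltW a0) bg)).
  apply: (@le_trans _ _ (hP t (fun y => (c `^ a * (a / c))%:E * (g y)%:E +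
     (c `^ a * (1 - a))%:E)%E x)).
    apply: hP_le => y; first by rewrite lee_fin powR_ge0.
    rewrite -EFinM -EFinD lee_fin; apply: le_trans (powR_tangent (g0 y) c0 a0 a1) _.
    by rewrite le_eqVlt; apply/orP; left; apply/eqP; ring.
  have k1 : 0 <= c `^ a * (a / c) by rewrite mulr_ge0 ?powR_ge0// divr_ge0 ?ltW.
  have k2 : 0 <= c `^ a * (1 - a) by rewrite mulr_ge0 ?powR_ge0// subr_ge0 ltW.
  rewrite hPD; [|by meas|by meas|by move=> y; rewrite mule_ge0 ?lee_fin|by move=> y; rewrite lee_fin].
  rewrite hPZ; [|by []|by meas|by move=> y; rewrite lee_fin].
  rewrite hP_cst// -(EFin_Pr x t0 bg) -EFinM -EFinD lee_fin.
  by rewrite le_eqVlt; apply/orP; left; apply/eqP; ring.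
have [m0|m0] := ltP 0 (Pr t g x).
  apply: le_trans (key _ m0) _; rewrite divff ?gt_eqF// mulr1 addrC subrK mulr1//.
have -> : Pr t g x = 0.
  apply/eqP; rewrite eq_le m0/= -lee_fin (EFin_Pr x t0 bg).
  by apply: hP_ge0 => y; rewrite lee_fin.
(* When the mean vanishes it cannot serve as the point of tangency; taking [c = e^(1/a)] makes the
   bound at most [e], for every [e > 0]. *)
rewrite powR0 ?gt_eqF//; apply/ler_addgt0Pr => e e0; rewrite add0r.
have c0 : 0 < e `^ a^-1 by exact: powR_gt0.
have m0' : Pr t g x = 0.
  apply/eqP; rewrite eq_le m0/= -lee_fin (EFin_Pr x t0 bg).
  by apply: hP_ge0 => y; rewrite lee_fin.
apply: le_trans (key _ c0) _; rewrite m0' mul0r mulr0 add0r -powRrM mulVf ?gt_eqF//.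
by rewrite powRr1 ?(ltW e0)// ler_piMr ?(ltW e0)// lerBlDr lerDl ltW.
Qed.

End heat_bounded.

Section bell.
Local Open Scope ereal_scope.
Context {R : realType} {n : nat}.
Implicit Types (a b c r s t d B : R) (x y z : 'rV[R]_n) (g w h : 'rV[R]_n -> R).
Local Notation la := (lebesgue_rV n).

(** One backward step of the recursion for the weights. The heat average of order [r] replaces the
    plain average of [w]: it dominates the latter by Jensen, and the integral of its [r]-th power
    equals that of [w]. *)
Definition bell r d g w x : R := Num.max (g x) (Pr d (fun y => w y `^ r)%R x `^ r^-1)%R.

Variables (B r : R).
Hypothesis r1 : (1 < r)%R.
Let r0 : (0 < r)%R. Proof. exact: lt_trans r1. Qed.
Let ri0 : (0 < r^-1)%R. Proof. by rewrite invr_gt0. Qed.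
Let ri1 : (r^-1 < 1)%R. Proof. by rewrite invf_lt1. Qed.
Let r10 : (0 < r - 1)%R. Proof. by rewrite subr_gt0. Qed.
Let rr0 : (0 < r / (r - 1))%R. Proof. by rewrite divr_gt0. Qed.
Let q0 : (0 < (r - 1) / r)%R. Proof. by rewrite divr_gt0. Qed.
Let q1 : ((r - 1) / r < 1)%R. Proof. by rewrite ltr_pdivrMr// mul1r; lra. Qed.

Lemma bounded_bell d g w : (0 < d)%R -> bounded_weight B g -> bounded_weight B w ->
  bounded_weight B (bell r d g w).
Proof.
move=> d0 bg bw; have B0 : (0 <= B)%R.
  by have /andP[] := bg.2 (0%R : 'rV[R]_n); exact: le_trans.
have b1 := bounded_Pr d0 (bounded_powR (ltW r0) bw).
have b2 := bounded_powR (ltW ri0) b1.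
rewrite -powRrM mulfV ?gt_eqF// powRr1// in b2.
split; first exact: (mf_maxr bg.1 b2.1).
by move=> x; have /andP[h1 h2] := bg.2 x; have /andP[h3 h4] := b2.2 x;
   rewrite /bell le_max h1/= ge_max h2.
Qed.

Lemma bell_ge d g w x : (g x <= bell r d g w x)%R.
Proof. by rewrite /bell le_max lexx. Qed.

Lemma bell_Pr d g w x : (0 < d)%R -> bounded_weight B w -> (Pr d w x <= bell r d g w x)%R.
Proof.
move=> d0 bw; rewrite /bell le_max; apply/orP; right.
have := Pr_jensen x d0 ri0 ri1 (bounded_powR (ltW r0) bw).
rewrite (_ : (fun y => (w y `^ r) `^ r^-1)%R = w)//; apply/funext => y.
by rewrite -powRrM mulfV ?gt_eqF// powRr1//; have /andP[] := bw.2 y.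
Qed.

(** The form of Doob's inequality before the factor [w] is absorbed; unlike the final [L^r] bound,
    it passes through the recursion without loss in the constant. *)
Definition weight_energy g w := \int[la]_x (w x `^ r)%:E <=
  (r / (r - 1))%:E * \int[la]_x (g x * w x `^ (r - 1))%:E.

(** Let [v] be the average of order [r] of [w]. Integrating [young_max] bounds the energy of
    [max g v] by the integral of [v^r] plus a difference of two mixed terms. The integral of [v^r]
    equals that of [w^r], which the hypothesis, self-adjointness and Jensen bound by the mixed term
    in [g] and [v], and this one cancels. *)
Lemma weight_energy_bell d g w : (0 < d)%R -> bounded_weight B g -> bounded_weight B w ->
  \int[la]_x (g x)%:E < +oo -> weight_energy (Pr d g) w ->
  weight_energy g (bell r d g w).
Proof.
move=> d0 bg bw gfin en; rewrite /weight_energy.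
have B0 : (0 <= B)%R by have /andP[] := bg.2 (0%R : 'rV[R]_n); exact: le_trans.
have g0 x : (0 <= g x)%R by have /andP[] := bg.2 x.
have w0 x : (0 <= w x)%R by have /andP[] := bw.2 x.
have bb := bounded_bell d0 bg bw.
have bp := bounded_Pr d0 (bounded_powR (ltW r0) bw).
have EP x : (Pr d (fun y => w y `^ r)%R x)%:E = hP d (fun y => (w y `^ r)%:E) x.
  exact: (EFin_Pr x d0 (bounded_powR (ltW r0) bw)).
pose v x := (Pr d (fun y => w y `^ r) x `^ r^-1)%R.
have bv : bounded_weight B v.
  have := bounded_powR (ltW ri0) bp.
  by rewrite -powRrM mulfV ?gt_eqF// powRr1.
have v0 x : (0 <= v x)%R by have /andP[] := bv.2 x.
have mg := bg.1; have mw := bw.1; have mv := bv.1; have mb := bb.1.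
set k := (r / (r - 1))%R; have k0 : (0 <= k)%R := ltW rr0.
set X := \int[la]_x (g x * v x `^ (r - 1))%:E.
have X0 : 0 <= X by apply: integral_ge0 => x _; rewrite lee_fin mulr_ge0 ?powR_ge0.
have Xfin : X < +oo.
  apply: (@le_lt_trans _ _ ((B `^ (r - 1))%:E * \int[la]_x (g x)%:E)).
    rewrite -ge0_integralZl_EFin; [|by []|by move=> x _; rewrite lee_fin|by meas|by rewrite powR_ge0].
    apply: le_integral_ge0 => x _; rewrite ?lee_fin ?mulr_ge0 ?powR_ge0//.
    rewrite mulrC ler_wpM2r//.
    by have /andP[] := (bounded_powR (ltW r10) bv).2 x.
  by rewrite lte_mul_pinfty ?lee_fin ?powR_ge0.
set I := \int[la]_x (bell r d g w x `^ r)%:E.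
set J := \int[la]_x (g x * bell r d g w x `^ (r - 1))%:E.
have b0 x : (0 <= bell r d g w x)%R by have /andP[] := bb.2 x.
have J0 : 0 <= J by apply: integral_ge0 => x _; rewrite lee_fin mulr_ge0 ?powR_ge0.
have main : I + k%:E * X <= \int[la]_x (v x `^ r)%:E + k%:E * J.
  have kp x (y : R) : (0 <= k * (g x * y `^ (r - 1)))%R.
    by rewrite mulr_ge0// mulr_ge0// powR_ge0.
  have Z (u : 'rV[R]_n -> R) : measurable_fun setT u ->
    k%:E * \int[la]_x (g x * u x `^ (r - 1))%:E = \int[la]_x (k * (g x * u x `^ (r - 1)))%:E.
    move=> mu; rewrite -ge0_integralZl_EFin //; try by meas.
    by move=> x _; rewrite lee_fin mulr_ge0// powR_ge0.
  have D (u u' : 'rV[R]_n -> R) : measurable_fun setT u -> measurable_fun setT u' ->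
    \int[la]_x (u' x `^ r)%:E + \int[la]_x (k * (g x * u x `^ (r - 1)))%:E =
    \int[la]_x (u' x `^ r + k * (g x * u x `^ (r - 1)))%:E.
    move=> mu mu'; rewrite -ge0_integralD //; try by meas.
      by move=> x _; rewrite lee_fin powR_ge0.
    by move=> x _; rewrite lee_fin.
  rewrite (Z v mv) (Z (bell r d g w) mb) (D v (bell r d g w) mv mb) (D (bell r d g w) v mb mv).
  apply: le_integral_ge0 => x _; first by rewrite lee_fin addr_ge0// powR_ge0.
  by rewrite lee_fin; exact: (young_max r1 (g0 x) (v0 x)). 
have Ev : \int[la]_x (v x `^ r)%:E = \int[la]_x (w x `^ r)%:E.
  rewrite -[RHS](integral_hP d0); [|by meas|by move=> *; rewrite lee_fin powR_ge0].
  apply: eq_integral => x _; rewrite -EP /v.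
  by rewrite -powRrM mulVf ?gt_eqF// powRr1//; have /andP[] := bp.2 x.
have sym : \int[la]_x (Pr d g x * w x `^ (r - 1))%:E <= X.
  have -> : \int[la]_x (Pr d g x * w x `^ (r - 1))%:E =
      \int[la]_x ((g x)%:E * hP d (fun y => (w y `^ (r - 1))%:E) x).
    rewrite (@hP_sym R n d (fun y => (w y `^ (r - 1))%:E) (fun x => (g x)%:E)); [|by meas|by meas| |]; last first.
    - by move=> y; rewrite lee_fin; exact: g0.
    - by move=> y; rewrite lee_fin powR_ge0.
    
    by apply: eq_integral => x _; rewrite EFinM (EFin_Pr x d0 bg).
  have EQ x : (Pr d (fun y => w y `^ (r - 1))%R x)%:E = hP d (fun y => (w y `^ (r - 1))%:E) x.
    exact: (EFin_Pr x d0 (bounded_powR (ltW r10) bw)).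
  apply: le_integral_ge0 => x _.
    apply: mule_ge0; first by rewrite lee_fin; exact: g0.
    by apply: hP_ge0 => y; rewrite lee_fin powR_ge0.
  rewrite EFinM lee_wpmul2l ?lee_fin// -EQ lee_fin.
  have := Pr_jensen x d0 q0 q1 (bounded_powR (ltW r0) bw).
  rewrite (_ : (fun y => _) = fun y => (w y `^ (r - 1))%R); last first.
    by apply/funext => y; rewrite -powRrM mulrCA mulfV ?gt_eqF// mulr1.
  by rewrite /v -powRrM (mulrC r^-1%R).
(* The cancellation needs a finite mixed term; boundedness of the weights and integrability of [g]
   serve this purpose. *)
have fin2 : k%:E * X \is a fin_num.
  have Xf : X \is a fin_num by rewrite (ge0_fin_numE X0).
  exact: (fin_numM _ Xf).
rewrite -(leeD2lE _ _ fin2) addeC; apply: le_trans main _; rewrite Ev.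
apply: leeD; last exact: lexx.
by apply: le_trans en _; apply: lee_wpmul2l; [rewrite lee_fin; exact: k0|exact: sym].
Qed.

End bell.

Section weights.
Local Open Scope ereal_scope.
Context {R : realType} {n : nat}.
Implicit Types (a b c s t d : R) (x y z : 'rV[R]_n) (g w : 'rV[R]_n -> R).
Local Notation la := (lebesgue_rV n).
Variables (B r d : R) (M : nat) (h : 'rV[R]_n -> R).
Hypothesis r1 : (1 < r)%R.
Hypothesis d0 : (0 < d)%R.
Hypothesis bh : bounded_weight B h.
Hypothesis hfin : \int[la]_x (h x)%:E < +oo.

Let T k : R := (d * 2 ^+ k)%R.
Let T0 k : (0 < T k)%R. Proof. by rewrite mulr_gt0 ?exprn_gt0. Qed.
Let TS k : (0 < T k.+1 - T k)%R.
Proof. by rewrite /T exprS; have := T0 k; rewrite /T; lra. Qed.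

(** The recursion runs backward from the last dyadic time, hence the reversed index: [rev_weight j]
    is the weight attached to [T (M - j)]. *)
Fixpoint rev_weight j : 'rV[R]_n -> R := match j with
  | 0%N => Pr (T M) h
  | i.+1 => bell r (T (M - i.+1).+1 - T (M - i.+1)) (Pr (T (M - i.+1)) h) (rev_weight i)
  end.

Let brev j : bounded_weight B (rev_weight j).
Proof.
elim: j => [|j IH] /=; first exact: bounded_Pr.
by apply: bounded_bell => //; exact: bounded_Pr.
Qed.

Let Pr_rev k j : (k + j)%N = M -> forall x, (Pr (T k) h x <= rev_weight j x)%R.
Proof.
case: j => [|j] kM x; first by rewrite addn0 in kM; rewrite kM.
have Ek : (M - j.+1)%N = k by rewrite -kM addnK.
by rewrite /= Ek; exact: bell_ge.
Qed.

Let fin_Pr k : \int[la]_x (Pr (T k) h x)%:E < +oo.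
Proof.
rewrite (_ : \int[la]_x _ = \int[la]_x (h x)%:E)//.
rewrite -[RHS](integral_hP (T0 k)); [|by have mh := bh.1; meas|].
  by apply: eq_integral => x _; exact: (EFin_Pr x (T0 k) bh).
by move=> x; rewrite lee_fin; have /andP[] := bh.2 x.
Qed.

(** At the last time the weight is [P_(T_M) h] itself and [1 <= r / (r - 1)] suffices. The recursion
    step matches because [P_(T_(k+1)) h] is [P_(T_(k+1)-T_k)] applied to [P_(T_k) h]. *)
Let energy_rev k j : (k + j)%N = M -> weight_energy r (Pr (T k) h) (rev_weight j).
Proof.
have r0 : (0 < r - 1)%R by rewrite subr_gt0.
elim: j k => [|j IH] k kM.
  rewrite addn0 in kM; rewrite kM /= /weight_energy.
  have b1 := bounded_Pr (T0 M) bh.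
  have I0 : 0 <= \int[la]_x (Pr (T M) h x `^ r)%:E.
    by apply: integral_ge0 => x _; rewrite lee_fin powR_ge0.
  rewrite (_ : \int[la]_x (Pr (T M) h x * Pr (T M) h x `^ (r - 1))%:E =
     \int[la]_x (Pr (T M) h x `^ r)%:E).
    by rewrite -[leLHS]mul1e lee_wpmul2r// lee_fin ler_pdivlMr// mul1r; lra.
  apply: eq_integral => x _; rewrite mulr_powRB1//; first by have /andP[] := b1.2 x.
  exact: lt_trans r1.
have kM' : (k.+1 + j)%N = M by rewrite addSn -kM addnS.
have Ek : (M - j.+1)%N = k by rewrite -kM addnK.
rewrite /= Ek; apply: (weight_energy_bell (B := B)) => //; first exact: bounded_Pr.
have := IH k.+1 kM'; congr (weight_energy r _ _); apply/funext => x.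
rewrite /(Pr (T k.+1) h) /Pr; congr (fine _).
rewrite (_ : (fun y => (fine (hP (T k) (fun z => (h z)%:E) y))%:E) = hP (T k) (fun z => (h z)%:E)).
  rewrite hP_semigroup//; [|by have mh := bh.1; meas|].
    by rewrite subrK.
  by move=> y; rewrite lee_fin; have /andP[] := bh.2 y.
by apply/funext => y; exact: EFin_Pr bh.
Qed.

(** Young's inequality applied to [(k h) * w^(r-1)] leaves the fraction [1 - 1/r] of the finite
    left-hand side, which is absorbed. *)
Let energy_total w : bounded_weight B w -> weight_energy r h w ->
  \int[la]_x (w x `^ r)%:E <= ((r / (r - 1)) `^ r)%:E * \int[la]_x (h x `^ r)%:E.
Proof.
have r10 : (0 < r - 1)%R by rewrite subr_gt0.
have r0 : (0 < r)%R by exact: lt_trans r1.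
move=> bw; rewrite /weight_energy; set k := (r / (r - 1))%R.
have k0 : (0 <= k)%R by rewrite divr_ge0 ?ltW.
have h0 x : (0 <= h x)%R by have /andP[] := bh.2 x.
have w0 x : (0 <= w x)%R by have /andP[] := bw.2 x.
have B0 : (0 <= B)%R by have /andP[] := bh.2 (0%R : 'rV[R]_n); exact: le_trans.
have mh := bh.1; have mw := bw.1.
set I := \int[la]_x (w x `^ r)%:E; set J := \int[la]_x (h x `^ r)%:E.
set X := \int[la]_x (h x * w x `^ (r - 1))%:E => IX.
have I0 : 0 <= I by apply: integral_ge0 => x _; rewrite lee_fin powR_ge0.
have J0 : 0 <= J by apply: integral_ge0 => x _; rewrite lee_fin powR_ge0.
have Xfin : X < +oo.
  apply: (@le_lt_trans _ _ ((B `^ (r - 1))%:E * \int[la]_x (h x)%:E)).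
    rewrite -ge0_integralZl_EFin; [|by []|by move=> x _; rewrite lee_fin|by meas|by rewrite powR_ge0].
    apply: le_integral_ge0 => x _; rewrite ?lee_fin ?mulr_ge0 ?powR_ge0//.
    rewrite mulrC ler_wpM2r//.
    by have /andP[] := (bounded_powR (ltW r10) bw).2 x.
  by rewrite lte_mul_pinfty ?lee_fin ?powR_ge0.
have Ifin : I < +oo by apply: le_lt_trans IX _; rewrite lte_mul_pinfty ?lee_fin.
have : k%:E * X <= (k `^ r / r)%:E * J + (1 - r^-1)%:E * I.
  have c1 : (0 <= k `^ r / r)%R by rewrite divr_ge0 ?powR_ge0 ?ltW.
  have c2 : (0 <= 1 - r^-1)%R by rewrite subr_ge0 invf_le1 ?ltW.
  have p1 x : 0 <= (k `^ r / r * h x `^ r)%:E by rewrite lee_fin mulr_ge0 ?powR_ge0.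
  have p2 x : 0 <= ((1 - r^-1) * w x `^ r)%:E by rewrite lee_fin mulr_ge0 ?powR_ge0.
  have -> : k%:E * X = \int[la]_x (k * (h x * w x `^ (r - 1)))%:E.
    rewrite -ge0_integralZl_EFin //; try by meas.
    by move=> x _; rewrite lee_fin mulr_ge0// powR_ge0.
  have -> : (k `^ r / r)%:E * J = \int[la]_x (k `^ r / r * h x `^ r)%:E.
    by rewrite -ge0_integralZl_EFin //; [move=> x _; rewrite lee_fin powR_ge0|meas].
  have -> : (1 - r^-1)%:E * I = \int[la]_x ((1 - r^-1) * w x `^ r)%:E.
    by rewrite -ge0_integralZl_EFin //; [move=> x _; rewrite lee_fin powR_ge0|meas].
  rewrite -ge0_integralD //; try by meas.
  apply: le_integral_ge0 => x _; first by rewrite lee_fin mulr_ge0// mulr_ge0// powR_ge0.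
  rewrite lee_fin mulrA; apply: le_trans (young_scaled r1 _ (w0 x)) _.
    by rewrite mulr_ge0.
  by rewrite powRM// mulrAC.
move=> /(le_trans IX).
have : I \is a fin_num by rewrite ge0_fin_numE.
have Jc : J = +oo \/ exists j, J = j%:E.
  by move: J0; case: J => [j| |] // _; [right; exists j|left].
case: Jc => [->|[j ->]].
  by move=> _ _; rewrite gt0_muley ?leey// lte_fin powR_gt0// divr_gt0.
case: I I0 {IX Ifin} => // i _ _; rewrite -!EFinM -EFinD !lee_fin => H.
have : (r * i <= r * (k `^ r / r * j + (1 - r^-1) * i))%R by rewrite ler_wpM2l// ltW.
rewrite (_ : r * (k `^ r / r * j + (1 - r^-1) * i) = k `^ r * j + (r * i - i))%R; last first.
  by field; rewrite gt_eqF.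
lra.
Qed.

(** [winit] plays the role of a maximal function of [h] along the dyadic times; the constant depends
    neither on [M] nor on [d], which later allows the time window to grow. *)
Lemma weights_exist : exists (winit : 'rV[R]_n -> R) (w : nat -> 'rV[R]_n -> R),
  [/\ bounded_weight B winit, forall k, bounded_weight B (w k),
      forall k y, (k <= M)%N -> hP (d * 2 ^+ k) (fun x => (h x)%:E) y <= (w k y)%:E,
      (forall k y, (k < M)%N ->
        hP (d * 2 ^+ k.+1 - d * 2 ^+ k) (fun x => (w k.+1 x)%:E) y <= (w k y)%:E) /\
      (forall y, hP (d * 2 ^+ 0) (fun x => (w 0%N x)%:E) y <= (winit y)%:E) &
      \int[la]_x (winit x `^ r)%:E <= ((r / (r - 1)) `^ r)%:E * \int[la]_x (h x `^ r)%:E].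
Proof.
exists (bell r (T 0) h (rev_weight M)), (fun k => rev_weight (M - k)).
split.
- exact: bounded_bell.
- by move=> k; exact: brev.
- move=> k y kM; have := Pr_rev (subnKC kM) y.
  by rewrite -lee_fin (EFin_Pr y (T0 k) bh).
- split=> [k y kM|y].
    rewrite -(EFin_Pr y (TS k) (brev _)) lee_fin.
    have -> : (M - k)%N = (M - k.+1).+1 by rewrite subnSK.
    rewrite /= (_ : (M - (M - k.+1).+1)%N = k); last by rewrite subnSK// subKn// ltnW.
    exact: bell_Pr (TS k) (brev _).
  rewrite subn0 -(EFin_Pr y (T0 0) (brev _)) lee_fin.
  exact: bell_Pr (T0 0) (brev _).
- apply: energy_total; first exact: bounded_bell.
  by apply: (weight_energy_bell (B := B)) => //; exact: energy_rev.
Qed.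

End weights.

(** * From the weighted estimate to bounds for finite exponents *)

Section truncation.
Local Open Scope ereal_scope.
Context {R : realType}.
Implicit Types (a b : \bar R) (q : R).

(** Cutting at height [N] makes the quantities of the duality argument finite, as the absorption of
    the left-hand side requires. *)
Definition trunc (N : nat) a : R := fine (mine a N%:R%:E).

Lemma EFin_trunc N a : 0 <= a -> (trunc N a)%:E = mine a N%:R%:E.
Proof.
move=> a0; rewrite /trunc fineK// ge0_fin_numE; first by rewrite gt_min ltry orbT.
by rewrite le_min a0 lee_fin/=.
Qed.

Lemma trunc_ge0 N a : 0 <= a -> (0 <= trunc N a)%R.
Proof. by move=> a0; rewrite -lee_fin EFin_trunc// le_min a0 lee_fin/=. Qed.

Lemma trunc_le N a : 0 <= a -> (trunc N a <= N%:R)%R.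
Proof. by move=> a0; rewrite -lee_fin EFin_trunc// ge_min lexx orbT. Qed.

Lemma trunc_lee N a : 0 <= a -> (trunc N a)%:E <= a.
Proof. by move=> a0; rewrite EFin_trunc// ge_min lexx. Qed.

Lemma trunc_mono N K a b : (N <= K)%N -> 0 <= a -> a <= b -> (trunc N a <= trunc K b)%R.
Proof.
move=> NK a0 ab; rewrite -lee_fin !EFin_trunc//; last exact: le_trans ab.
rewrite le_min !ge_min ab /=; apply/orP; right.
by rewrite lee_fin ler_nat.
Qed.

Lemma trunc_small N a (c : R) : 0 <= a -> (trunc N a <= c)%R -> (c < N%:R)%R -> a <= c%:E.
Proof.
move=> a0; rewrite -lee_fin EFin_trunc// ge_min => /orP[//|]; rewrite lee_fin => Nc cN.
by have := le_lt_trans Nc cN; rewrite ltxx.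
Qed.

End truncation.

Section area_limit.
Local Open Scope ereal_scope.
Context {R : realType} {n : nat}.
Local Notation la := (@lebesgue_rV R n).

(** Monotone convergence for the doubly truncated integrands. The limit [A] enters only through its
    minimality among upper bounds of the [AN], so neither its measurability nor a pointwise limit is
    needed. *)
Lemma area_limit (q : R) (A : 'rV[R]_n -> \bar R) (AN : nat -> 'rV[R]_n -> \bar R)
    (M : \bar R) : (0 < q)%R ->
  (forall N, measurable_fun setT (AN N)) -> (forall N x, 0 <= AN N x) ->
  (forall x, nondecreasing_seq (AN ^~ x)) ->
  (forall x, 0 <= A x) ->
  (forall x l, (forall N, AN N x <= l) -> A x <= l) ->
  (forall N, \int[la]_x ((enorm x < N%:R)%R%:R%:E * (trunc N (AN N x) `^ q)%:E) <= M) ->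
  \int[la]_x (A x `^ q) <= M.
Proof.
move=> q0 mA A0 ndA Ap Al AM.
pose g N x := (enorm x < N%:R)%R%:R%:E * (trunc N (AN N x) `^ q)%:E.
have mg N : measurable_fun setT (g N).
  rewrite /g /trunc; meas; first exact: (mf_enorm (@mf_id _ _)).
  exact: (measurable_mine (mA N) (mf_cst _)).
have g0 N x : 0 <= g N x by rewrite /g; pos.
have ndg x : nondecreasing_seq (g ^~ x).
  move=> N K NK; apply: lee_ind => [|xN]; first by pos.
  split; first by apply: lt_le_trans xN _; rewrite ler_nat.
  rewrite lee_fin ge0_ler_powR ?(ltW q0)//; [exact: trunc_ge0|exact: trunc_ge0|].
  by apply: trunc_mono => //; exact: ndA.
have h := @cvg_monotone_convergence _ _ _ la setT measurableT g mg
  (fun k x _ => g0 k x) (fun x _ => ndg x).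
have gM : \int[la]_x limn (g ^~ x) <= M.
  by rewrite -(cvg_lim _ h)//; apply: lime_le; [apply/cvg_ex; eexists; exact: h|exact: nearW].
apply: le_trans gM; apply: le_integral_ge0 => x _; first exact: poweR_ge0.
set l := limn _.
have gl N : g N x <= l.
  rewrite /l (cvg_lim _ (ereal_nondecreasing_cvgn (ndg x)))//.
  by apply: ereal_sup_ubound; exists N.
have l0 : 0 <= l by exact: le_trans (g0 0%N x) (gl 0%N).
rewrite (_ : l = (l `^ q^-1) `^ q); last first.
  by rewrite -poweRrM mulVf ?gt_eqF// poweRe1.
apply: gt0_ler_poweR; [exact: ltW|by rewrite in_itv/= Ap leey|by rewrite in_itv/= poweR_ge0 leey|].
apply: Al => N; case: l l0 gl => [l| |] // l0 gl; last first.
  by rewrite poweRyr ?leey// gt_eqF// invr_gt0.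
rewrite lee_fin in l0.
(* At this index [x] lies in the ball of radius [K], and the cut at height [K] is inactive because
   [K > l^(1/q)]. *)
pose K := (N + Num.truncn (enorm x + l `^ q^-1)).+1.
have NK : (N <= K)%N by rewrite /K leqW// leq_addr.
have xl : (enorm x + l `^ q^-1 < K%:R)%R.
  apply: lt_le_trans (Num.Theory.truncnS_gt _) _.
  by rewrite ler_nat ltnS leq_addl.
have e0 := enorm_ge0 x; have p0 := powR_ge0 l q^-1%R.
apply: (le_trans (ndA x N K NK)).
apply: (@trunc_small _ K) => //; last by lra.
have := gl K; rewrite /g (_ : (enorm x < K%:R)%R = true); last by apply/idP; lra.
rewrite mul1e lee_fin => H.
rewrite -[leLHS](@powRr1 _ _ (trunc_ge0 K (A0 K x))) -(@mulfV _ q) ?gt_eqF//.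
by rewrite powRrM; apply: ge0_ler_powR; rewrite ?nnegrE ?powR_ge0 ?invr_ge0 ?(ltW q0).
Qed.

End area_limit.

Section finite_exponent.
Local Open Scope ereal_scope.
Context {R : realType} {n : nat}.
Implicit Types (a b c r s t d q : R) (x y z : 'rV[R]_n).
Local Notation mu := (@lebesgue_measure R).
Local Notation la := (@lebesgue_rV R n).
Variables (FF GG : R -> R -> 'rV[R]_n -> \bar R) (phi : R -> 'rV[R]_n -> \bar R).
Variable C0 : R.
Hypothesis n0 : (0 < n)%N.
Hypothesis C00 : (0 <= C0)%R.
Hypothesis mFF : measurable_fun [set: R * R * 'rV[R]_n] (fun p => FF p.1.1 p.1.2 p.2).
Hypothesis mphi : measurable_fun [set: R * 'rV[R]_n] (fun p => phi p.1 p.2).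
Hypothesis FF0 : forall s t y, 0 <= FF s t y.
Hypothesis phi0 : forall s y, 0 <= phi s y.
Hypothesis diss : forall s, dissipative (FF s) (GG s).
Hypothesis GGphi : forall s y, GG s 0%R y <= C0%:E * phi s y.

Let S := sqfun FF.
Let msq : measurable_fun [set: R * 'rV[R]_n] (fun p => S p.1 p.2).
Proof. exact: measurable_sqfun. Qed.
Let S0 t y : 0 <= S t y. Proof. exact: sqfun_ge0. Qed.
Let W : R := @weighted_cst R n C0.
Let W0 : (0 <= W)%R.
Proof. exact: (mulr_ge0 (mulr_ge0 (@near_cst_ge0 R n) (@spread_cst_ge0 R n)) C00). Qed.

Let d N : R := ((2 ^+ N)^-1)%R.
Let d0 N : (0 < d N)%R. Proof. by rewrite invr_gt0 exprn_gt0. Qed.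

(** With [d = 2^-N] and [M = 2N + 1] the window of [sqfun_weighted] is [[2^-N, 2^N)]. *)
Definition area_block (N : nat) x : \bar R :=
  \int[mu]_t ((d N <= t < d N * 2 ^+ (N + N).+1 / 2)%R%:R%:E * Av (Num.sqrt t) (S t) x).

Let dE N : (d N * 2 ^+ (N + N).+1 / 2 = 2 ^+ N)%R.
Proof.
rewrite /d exprS exprD; field.
by rewrite expf_neq0.
Qed.

Let m_block N : measurable_fun setT (area_block N).
Proof. by rewrite /area_block; mp. Qed.
Let block0 N x : 0 <= area_block N x. Proof. by rewrite /area_block; pos. Qed.

Let window_mono N K t : (N <= K)%N -> (d N <= t < d N * 2 ^+ (N + N).+1 / 2)%R ->
  (d K <= t < d K * 2 ^+ (K + K).+1 / 2)%R.
Proof.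
rewrite !dE => NK /andP[h1 h2]; apply/andP; split.
  by apply: le_trans h1; rewrite /d lef_pV2 ?posrE ?exprn_gt0// ler_weXn2l// ler1n.
by apply: lt_le_trans h2 _; rewrite ler_weXn2l// ler1n.
Qed.

Let block_nd x : nondecreasing_seq (area_block ^~ x).
Proof.
move=> N K NK; apply: le_integral_ge0 => t _; first by pos.
by apply: lee_ind => [|h]; [pos|rewrite (window_mono NK h)].
Qed.

Let window_all t : (0 < t)%R -> exists N, forall K, (N <= K)%N ->
  (d K <= t < d K * 2 ^+ (K + K).+1 / 2)%R.
Proof.
move=> t0; pose N := Num.truncn (t + t^-1)%R; exists N => K NK.
have ti0 : (0 < t^-1)%R by rewrite invr_gt0.
have h : (t + t^-1 < 2 ^+ K)%R.
  apply: lt_le_trans (Num.Theory.truncnS_gt _) _.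
  by rewrite -natrX ler_nat; apply: leq_trans (ltn_expl K _); rewrite // ltnS.
rewrite dE; apply/andP; split; last by lra.
by rewrite /d -[leRHS]invrK lef_pV2 ?posrE ?exprn_gt0//; lra.
Qed.

Let area_le x l : (forall N, area_block N x <= l) -> Asq S x <= l.
Proof.
move=> h; rewrite /Asq.
apply: (@integral_limit_le_eventually _ _ _ mu _ (fun N t =>
  (d N <= t < d N * 2 ^+ (N + N).+1 / 2)%R%:R%:E * Av (Num.sqrt t) (S t) x)) => //.
- by move=> k; mp.
- by move=> k t; pos.
- by move=> t N K NK; apply: lee_ind => [|w]; [pos|rewrite (window_mono NK w)].
- move=> t; have [t0|t0] := ltP 0%R t.
    by have [N NE] := window_all t0; exists N => k /NE ->.
  exists 0%N => k _; rewrite (_ : (_ <= t < _)%R = false) ?mul0e//.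
  by apply/negP => /andP[]; have := d0 k; lra.
Qed.

Let Asq0 x : 0 <= Asq S x. Proof. by rewrite /Asq; pos. Qed.
Let Asqphi0 x : 0 <= Asq phi x. Proof. by rewrite /Asq; pos. Qed.
Let mAsqphi : measurable_fun setT (Asq phi). Proof. by rewrite /Asq; mp. Qed.

(** The constant weights [1] form an admissible chain, since the semigroup preserves constants. *)
Let block_L1 N : \int[la]_x (area_block N x) <= W%:E * \int[la]_x (Asq phi x).
Proof.
have m1 : measurable_fun [set: 'rV[R]_n] (fun=> 1 : \bar R) by exact: mf_cst.
have h1 : forall y : 'rV[R]_n, 0 <= (1 : \bar R) by [].
have K t y : (0 < t)%R -> hP t (fun=> 1) y <= 1 by move=> t0; rewrite hP_cst.
have T0 k : (0 < d N * 2 ^+ k)%R by rewrite mulr_gt0 ?exprn_gt0 ?d0.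
have TS k : (0 < d N * 2 ^+ k.+1 - d N * 2 ^+ k)%R.
  by rewrite exprS mulrCA mulr_natl mulr2n addrK; exact: T0.
have := @sqfun_weighted R n FF GG phi C0 n0 C00 mFF mphi FF0 phi0 diss GGphi (d N) (N + N).+1
  (fun=> 1) (fun=> 1) (fun _ _ => 1) (d0 N) m1 m1 (fun=> m1) h1 h1 (fun=> h1).
set P := (forall k y, _ -> _); move=> H.
have -> : \int[la]_x (area_block N x) = \int[la]_x (1 * area_block N x).
  by apply: eq_integral => x _; rewrite mul1e.
have -> : \int[la]_x (Asq phi x) = \int[la]_x (1 * Asq phi x).
  by apply: eq_integral => x _; rewrite mul1e.
by apply: H => [k y _|k y _|y]; apply: K; [exact: T0|exact: TS|exact: T0].
Qed.

(** Young for the factors [w / q] and [W q a]. The division by [q] compensates the factor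
    [q^(q/(q-1))] of [weights_exist], so that the coefficient left in front of the absorbed term is
    [(q - 1) / q < 1]. *)
Let young_e q (w : R) (a : \bar R) : (1 < q)%R -> (0 <= w)%R -> 0 <= a ->
  w%:E * (W%:E * a) <=
  ((q - 1) / q * (w `^ (q / (q - 1)) / q `^ (q / (q - 1))))%:E + ((W * q) `^ q / q)%:E * a `^ q.
Proof.
move=> q1 w0; have q0 : (0 < q)%R by lra.
have q10 : (0 < q - 1)%R by lra.
case: a => [a| |] //.
  rewrite lee_fin => a0; rewrite poweR_EFin -!EFinM -EFinD lee_fin.
  have wq0 : (0 <= w / q)%R by rewrite divr_ge0// ltW.
  have Wqa : (0 <= W * q * a)%R by exact: (mulr_ge0 (mulr_ge0 W0 (ltW q0)) a0).
  have r0 : (0 < q / (q - 1))%R by rewrite divr_gt0.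
  have e1 : ((q / (q - 1))^-1 + q^-1 = 1)%R by field; rewrite !gt_eqF.
  have := @conjugate_powR R (w / q)%R (W * q * a)%R (q / (q - 1))%R q wq0 Wqa r0 q0 e1.
  rewrite (_ : (w / q * (W * q * a) = w * (W * a))%R); last by field; rewrite gt_eqF.
  move=> /le_trans; apply.
  have -> : ((w / q) `^ (q / (q - 1)) = w `^ (q / (q - 1)) / q `^ (q / (q - 1)))%R.
    rewrite powRM ?invr_ge0 ?(ltW q0)//; congr (_ * _)%R.
    by rewrite -[in LHS]powR_inv1 ?(ltW q0)// -powRrM mulN1r powRN.
  have Wq : (0 <= W * q)%R by exact: (mulr_ge0 W0 (ltW q0)).
  rewrite (powRM _ Wq a0) le_eqVlt; apply/orP; left; apply/eqP.
  set A := (w `^ _)%R; set B := (q `^ _)%R; set C := ((W * q) `^ _)%R; set D := (a `^ _)%R.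
  have B0 : B != 0%R by rewrite gt_eqF// powR_gt0.
  by field; rewrite B0 !gt_eqF.
have c0 : 0 <= ((q - 1) / q * (w `^ (q / (q - 1)) / q `^ (q / (q - 1))))%:E.
  by rewrite lee_fin !(mulr_ge0, powR_ge0, invr_ge0)// ltW.
have [->|Wn0] := eqVneq W 0%R.
  rewrite mul0e mule0 => _; rewrite adde_ge0// mule_ge0 ?poweR_ge0//.
  by rewrite lee_fin divr_ge0 ?powR_ge0// ltW.
rewrite poweRyr ?gt_eqF// => _.
have -> : ((W * q) `^ q / q)%:E * +oo = +oo.
  rewrite gt0_muley// lte_fin divr_gt0// powR_gt0// mulr_gt0// lt_neqAle eq_sym Wn0.
  exact: W0.
by rewrite addey ?leey.
Qed.

Definition sqfun_cst q : R := ((W * q) `^ q)%R.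

(** Duality with the extremal weight: [h] is the power [q - 1] of the truncated square function,
    restricted to a ball, so that [h^r] with [r = q / (q - 1)] is the integrand on the left. The
    weighted estimate, Young and the [L^r] bound of [winit] then allow absorption. *)
Let block_Lq q N : (1 < q)%R ->
  \int[la]_x ((enorm x < N%:R)%R%:R%:E * (trunc N (area_block N x) `^ q)%:E) <=
  (sqfun_cst q)%:E * \int[la]_x (Asq phi x `^ q).
Proof.
move=> q1; have q0 : (0 < q)%R by lra.
have q10 : (0 < q - 1)%R by lra.
pose r := (q / (q - 1))%R.
have r1 : (1 < r)%R by rewrite /r ltr_pdivlMr// mul1r; lra.
have r0 : (0 < r)%R by lra.
have rq : (r / (r - 1) = q)%R.
  have e : (r - 1 = (q - 1)^-1)%R by rewrite /r; field; rewrite gt_eqF.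
  by rewrite e invrK /r divfK ?gt_eqF.
pose m x := trunc N (area_block N x).
pose h x : R := ((enorm x < N%:R)%R%:R * m x `^ (q - 1))%R.
have mm : measurable_fun setT m.
  by rewrite /m /trunc; meas; exact: (measurable_mine (m_block N) (mf_cst _)).
have men : measurable_fun [set: 'rV[R]_n] enorm by exact: (mf_enorm (@mf_id _ _)).
have m0 x : (0 <= m x)%R by exact: trunc_ge0.
have bh : bounded_weight (N%:R `^ (q - 1)) h.
  split; first by rewrite /h; meas.
  move=> x; rewrite /h; case: (enorm x < N%:R)%R; last by rewrite mul0r lexx powR_ge0.
  rewrite mul1r powR_ge0/= ge0_ler_powR ?(ltW q10) ?nnegrE ?ler0n//.
  exact: trunc_le.
have h0 x : (0 <= h x)%R by have /andP[] := bh.2 x.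
have mh := bh.1.
have ind0 : 0 <= \int[la]_x ((enorm x < N%:R)%R%:R%:E).
  by apply: integral_ge0 => x _; rewrite lee_fin.
have indfin : \int[la]_x ((enorm x < N%:R)%R%:R%:E) < +oo.
  have [N00|Npos] := posnP N.
    rewrite integral0_eq ?ltry// => x _; rewrite N00 (_ : (enorm x < 0%:R)%R = false)//.
    by apply/negbTE; rewrite -leNgt enorm_ge0.
  have N0 : (0 < N%:R :> R)%R by rewrite ltr0n.
  have [v ve _] := @lebesgue_eball_lub R n 0%R N%:R N0 n0.
  rewrite (_ : \int[la]_x _ = v%:E) ?ltry// -ve.
  transitivity (\int[la]_x (\1_(eball 0 N%:R) x)%:E).
    by apply: eq_integral => x _; rewrite eball_indE subr0.
  by rewrite integral_indic ?setIT//; exact: measurable_eball.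
have hfin : \int[la]_x (h x)%:E < +oo.
  apply: (@le_lt_trans _ _ ((N%:R `^ (q - 1))%:E * \int[la]_x ((enorm x < N%:R)%R%:R%:E))).
    rewrite -ge0_integralZl_EFin; [|by []|by move=> x _; rewrite lee_fin|by meas|by rewrite powR_ge0].
    apply: le_integral_ge0 => x _; first by rewrite lee_fin.
    rewrite -EFinM lee_fin /h mulrC; case: (enorm x < N%:R)%R; last by rewrite !mulr0.
    by rewrite !mulr1 ge0_ler_powR ?(ltW q10) ?nnegrE ?ler0n// trunc_le.
  by rewrite lte_mul_pinfty// lee_fin powR_ge0.
have [winit [w [bi bw hw [wdecr w0init] en]]] :=
  @weights_exist R n _ r (d N) (N + N).+1 h r1 (d0 N) bh hfin.
have wi0 x : (0 <= winit x)%R by have /andP[] := bi.2 x.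
have wk0 k x : (0 <= w k x)%R by have /andP[] := (bw k).2 x.
have mwi := bi.1; have mw k := (bw k).1.
have := @sqfun_weighted R n FF GG phi C0 n0 C00 mFF mphi FF0 phi0 diss GGphi (d N) (N + N).+1
  (fun x => (h x)%:E) (fun x => (winit x)%:E) (fun k x => (w k x)%:E) (d0 N)
  (mf_EFin mh) (mf_EFin mwi) (fun k => mf_EFin (mw k)).
move=> /(_ (fun x => h0 x) (fun x => wi0 x) (fun k x => wk0 k x) hw wdecr w0init).
set X := \int[la]_x ((enorm x < _)%R%:R%:E * _).
have hr x : (h x `^ r = (enorm x < N%:R)%R%:R * m x `^ q)%R.
  rewrite /h; case: (enorm x < N%:R)%R; last by rewrite !mul0r powR0// gt_eqF.
  by rewrite !mul1r -powRrM /r mulrCA mulfV ?gt_eqF// mulr1.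
have hX : \int[la]_x (h x `^ r)%:E = X.
  by apply: eq_integral => x _; rewrite hr EFinM.
rewrite hX in en.
have X0 : 0 <= X by rewrite -hX; apply: integral_ge0 => x _; rewrite lee_fin powR_ge0.
have Xfin : X < +oo.
  rewrite -hX; apply: (@le_lt_trans _ _ ((N%:R `^ q)%:E * \int[la]_x ((enorm x < N%:R)%R%:R%:E))).
    rewrite -ge0_integralZl_EFin; [|by []|by move=> x _; rewrite lee_fin|by meas|by rewrite powR_ge0].
    apply: le_integral_ge0 => x _; first by rewrite lee_fin powR_ge0.
    rewrite hr -EFinM lee_fin mulrC; case: (enorm x < N%:R)%R; last by rewrite !mulr0.
    by rewrite !mulr1 ge0_ler_powR ?(ltW q0) ?nnegrE ?ler0n// trunc_le.
  by rewrite lte_mul_pinfty// lee_fin powR_ge0.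
set J := \int[la]_x (Asq phi x `^ q).
have J0 : 0 <= J by apply: integral_ge0 => x _; exact: poweR_ge0.
set I := \int[la]_x (winit x `^ r)%:E in en *.
have I0 : 0 <= I by apply: integral_ge0 => x _; rewrite lee_fin powR_ge0.
have k1 : (0 <= (q - 1) / q / q `^ r)%R by rewrite !(mulr_ge0, powR_ge0, invr_ge0)// ltW.
have k2 : (0 <= sqfun_cst q / q)%R by rewrite divr_ge0 ?powR_ge0// ltW.
have low : X <= \int[la]_x ((h x)%:E * area_block N x).
  rewrite -hX; apply: le_integral_ge0 => x _; first by rewrite lee_fin powR_ge0.
  rewrite hr; apply: (@le_trans _ _ ((h x)%:E * (m x)%:E)).
    rewrite -EFinM lee_fin /h -mulrA; apply: ler_wpM2l => //.
    by rewrite mulrC mulr_powRB1// ltW.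
  by rewrite lee_wpmul2l ?lee_fin// trunc_lee.
have up : W%:E * \int[la]_x ((winit x)%:E * Asq phi x) <=
    ((q - 1) / q / q `^ r)%:E * I + (sqfun_cst q / q)%:E * J.
  rewrite -!ge0_integralZl_EFin //; try by [meas|move=> x _; rewrite ?lee_fin ?powR_ge0 ?poweR_ge0];
    last by move=> x _; rewrite mule_ge0// lee_fin.
  rewrite -ge0_integralD //; try by [meas|move=> x _; rewrite mule_ge0 ?lee_fin ?powR_ge0 ?poweR_ge0].
  apply: le_integral_ge0 => x _; first by rewrite !mule_ge0 ?lee_fin.
  rewrite muleCA; apply: le_trans (young_e q1 (wi0 x) (Asqphi0 x)) _.
  rewrite leeD2r// -EFinM lee_fin -/r le_eqVlt; apply/orP; left; apply/eqP.
  by set A := (winit x `^ r)%R; set B := (q `^ r)%R; ring.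
move=> /(le_trans low) /le_trans /(_ up).
(* Here [r / (r - 1) = q], so the constant [q^r] of the weights cancels the one built into
   [young_e]. *)
move=> H; have {H} : X <= ((q - 1) / q)%:E * X + (sqfun_cst q / q)%:E * J.
  apply: le_trans H _; rewrite leeD2r//.
  apply: (@le_trans _ _ (((q - 1) / q / q `^ r)%:E * (((r / (r - 1)) `^ r)%:E * X))).
    by rewrite lee_wpmul2l// lee_fin.
  by rewrite muleA -EFinM rq divfK// gt_eqF// powR_gt0.
have Jc : J = +oo \/ exists j, J = j%:E.
  by case: {+}J {up} J0 => [j| |] // _; [right; exists j|left].
(* By convention [0 * +oo = 0], so a zero constant is not covered by the trivial case of an infinite
   right-hand side: [X = 0] has to be derived. *)
have [->|cn0] := eqVneq (sqfun_cst q) 0%R.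
  case: X X0 Xfin {hX en low up} => // i; rewrite lee_fin => i0 _.
  rewrite mul0r !mul0e adde0 -EFinM !lee_fin => H.
  have : (q * i <= q * ((q - 1) / q * i))%R by rewrite ler_wpM2l// ltW.
  rewrite mulrA mulrCA mulfV ?gt_eqF// mulr1; lra.
have c0 : (0 < sqfun_cst q)%R by rewrite lt_neqAle eq_sym cn0 powR_ge0.
case: Jc => [->|[j ->]]; first by move=> _; rewrite gt0_muley ?leey// lte_fin.
case: X X0 Xfin {hX en low up} => // i _ _.
rewrite -!EFinM -EFinD !lee_fin => H.
have : (q * i <= q * ((q - 1) / q * i + sqfun_cst q / q * j))%R by rewrite ler_wpM2l// ltW.
rewrite (_ : q * ((q - 1) / q * i + sqfun_cst q / q * j) = q * i - i + sqfun_cst q * j)%R; last first.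
  by field; rewrite gt_eqF.
lra.
Qed.

Lemma sqfun_Asq q : (1 <= q)%R ->
  \int[la]_x (Asq S x `^ q) <= (sqfun_cst q)%:E * \int[la]_x (Asq phi x `^ q).
Proof.
move=> q1; apply: (@area_limit R n q (Asq S) area_block) => //; first exact: lt_le_trans q1.
move=> N; move: q1; rewrite le_eqVlt => /orP[/eqP <-|q1]; last exact: block_Lq.
apply: (@le_trans _ _ (\int[la]_x (area_block N x))).
  apply: le_integral_ge0 => x _; first by rewrite mule_ge0// lee_fin// powR_ge0.
  rewrite powRr1 ?trunc_ge0//; apply: (@le_trans _ _ (trunc N (area_block N x))%:E).
    rewrite -[leRHS]mul1e; apply: lee_wpmul2r; first by rewrite lee_fin trunc_ge0.
    by rewrite lee_fin; case: (_ < _)%R.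
  exact: trunc_lee.
apply: le_trans (block_L1 N) _; rewrite /sqfun_cst mulr1 powRr1//.
rewrite le_eqVlt; apply/orP; left; apply/eqP; congr (_ * _); apply: eq_integral => x _.
by rewrite poweRe1.
Qed.

End finite_exponent.

(** * Local Gaussian mass and the regularity of almost every slice *)

Section local_mass.
Local Open Scope ereal_scope.
Context {R : realType} {n : nat}.
Implicit Types (a b c r s t d q : R) (x y z : 'rV[R]_n).
Local Notation mu := (@lebesgue_measure R).
Local Notation la := (@lebesgue_rV R n).

Lemma heat_kernel_le_far (a b : R) x y z : (0 < a)%R -> (2 * a <= b)%R ->
  (enorm (z - x) ^+ 2 <= b)%R ->
  (heat_kernel a (x - y) <= (b / a) ^+ n * expR 1 * heat_kernel b (z - y))%R.
Proof.
move=> a0 ab zx; have b0 : (0 < b)%R by lra.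
have ba : (1 <= b / a)%R by rewrite ler_pdivlMr// mul1r; lra.
apply: heat_kernel_le_of => //.
- by lra.
- by rewrite expr2 -mulrA divfK ?gt_eqF// ler_peMl// ltW.
- by lra.
have := enorm_young (x - y) (z - x) (@ltr01 R).
rewrite addrC addrA subrK invr1 => H.
apply: (@le_trans _ _ ((2 * enorm (x - y) ^+ 2 + 2 * b) / (4 * b))%R).
  rewrite ler_wpM2r// ?invr_ge0 ?mulr_ge0// ?(ltW b0)//; lra.
rewrite (_ : ((2 * enorm (x - y) ^+ 2 + 2 * b) / (4 * b) = enorm (x - y) ^+ 2 / (2 * b) + 2^-1)%R); last first.
  by field; rewrite gt_eqF.
apply: lerD; last by lra.
rewrite ler_wpM2l ?sqr_ge0// lef_pV2 ?posrE ?mulr_gt0//; lra.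
Qed.

Lemma heat_kernel_le_max t z : (0 < t)%R ->
  (heat_kernel t z <= (4 * pi * t) `^ (- (n%:R / 2)))%R.
Proof.
move=> t0; rewrite /heat_kernel -[leRHS]mulr1 ler_wpM2l ?powR_ge0// -expR0 ler_expR oppr_le0.
by rewrite divr_ge0 ?sqr_ge0// mulr_ge0// ltW.
Qed.

Variable phi : R -> 'rV[R]_n -> \bar R.
Hypothesis n0 : (0 < n)%N.
Hypothesis mphi : measurable_fun [set: R * 'rV[R]_n] (fun p => phi p.1 p.2).
Hypothesis phi0 : forall s y, 0 <= phi s y.

Let mphis s : measurable_fun setT (phi s). Proof. by meas. Qed.

(** The right-hand side of [sqfun_local], up to its constant. *)
Definition local_mass r x : \bar R :=
  \int[mu]_s ((0 < s < r ^+ 2)%R%:R%:E * hP (2 * r ^+ 2) (phi s) x).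

(** [hP_le_hP_Av] with radius [sqrt s] turns the local mass into a heat average of [Asq phi], which
    is finite because the kernel is bounded and has unit mass. *)
Lemma local_mass_Asq q r x : (1 <= q)%R -> (0 < r)%R ->
  \int[la]_x (Asq phi x `^ q) < +oo -> local_mass r x < +oo.
Proof.
move=> q1 r0 fin; have r20 : (0 < r ^+ 2)%R by rewrite exprn_gt0.
have S0 := @spread_cst_ge0 R n; have q0 : (0 < q)%R by lra.
have A0 z : 0 <= Asq phi z by rewrite /Asq; pos.
have mA : measurable_fun setT (Asq phi) by rewrite /Asq; mp.
apply: (@le_lt_trans _ _ ((@spread_cst R n)%:E * hP (4 * r ^+ 2) (Asq phi) x)).
  rewrite /Asq hP_integral; [|by mp..].
  rewrite -ge0_integralZl_EFin; [|by mp..].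
  apply: le_integral_ge0 => s _; first by pos.
  have [/andP[s0 sr]|_] := boolP (0 < s < r ^+ 2)%R; last by rewrite mul0e; pos.
  rewrite s0 mul1e.
  have -> : hP (4 * r ^+ 2) (fun y => true%:R%:E * Av (Num.sqrt s) (phi s) y) x =
      hP (4 * r ^+ 2) (Av (Num.sqrt s) (phi s)) x.
    by rewrite hPZ ?mul1e//; mp.
  apply: hP_le_hP_Av => //; [by rewrite sqrtr_gt0|lra|lra|lra|].
  by rewrite sqr_sqrtr ?(ltW s0)//; lra.
rewrite lte_mul_pinfty ?lee_fin//.
have r4 : (0 < 4 * r ^+ 2)%R by rewrite mulr_gt0.
have Kb z := @heat_kernel_le_max (4 * r ^+ 2) z r4; set c := (_ `^ _)%R in Kb.
have c0 : (0 <= c)%R by exact: powR_ge0.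
apply: (@le_lt_trans _ _ (\int[la]_y (heat_kernel (4 * r ^+ 2) (x - y))%:E +
    c%:E * \int[la]_y (Asq phi y `^ q))).
  rewrite -ge0_integralZl_EFin; [|by mp..].
  rewrite -ge0_integralD; [|by mp..].
  apply: le_integral_ge0 => y _; first by pos.
  set K := heat_kernel _ _; have K0 : (0 <= K)%R by exact: heat_kernel_ge0.
  (* For [1 <= q], a nonnegative [a] is at most [1 + a^q]. *)
  apply: (@le_trans _ _ (K%:E * (1 + Asq phi y `^ q))).
    rewrite lee_wpmul2l ?lee_fin//.
    case: (Asq phi y) (A0 y) => [a| |] //; last by rewrite poweRyr ?gt_eqF.
    rewrite lee_fin poweR_EFin -EFinD lee_fin => a0.
    have [a1|a1] := leP a 1%R; first by rewrite (le_trans a1)// lerDl powR_ge0.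
    by rewrite -[leLHS]powRr1// (le_trans (ler_powR (ltW a1) q1))// lerDr.
  rewrite ge0_muleDr ?poweR_ge0// mule1 leeD2l// lee_wpmul2r ?poweR_ge0//.
  by rewrite lee_fin; exact: Kb.
rewrite lte_add_pinfty//; last by rewrite lte_mul_pinfty// lee_fin.
have := @hP_cst R n (4 * r ^+ 2) 1%R x; rewrite /hP => h.
apply: (@le_lt_trans _ _ 1); last exact: ltry.
rewrite -h ?mulr_gt0//.
by apply: le_integral_ge0 => y _; [pos|rewrite mule1].
Qed.

(** The same device with the fixed radius [r]: the local mass becomes a heat average of Carleson
    averages, each at most [M]. *)
Lemma local_mass_carleson r x (M : R) : (0 < r)%R -> (0 <= M)%R ->
  (forall z, \int[mu]_s ((0 < s < r ^+ 2)%R%:R%:E * Av r (phi s) z) <= M%:E) ->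
  local_mass r x <= (@spread_cst R n * M)%:E.
Proof.
move=> r0 M0 hM; have r20 : (0 < r ^+ 2)%R by rewrite exprn_gt0.
have S0 := @spread_cst_ge0 R n.
rewrite EFinM -[M%:E](@hP_cst R n (4 * r ^+ 2) M x) ?mulr_gt0//.
apply: (@le_trans _ _ ((@spread_cst R n)%:E * hP (4 * r ^+ 2) (fun z =>
    \int[mu]_s ((0 < s < r ^+ 2)%R%:R%:E * Av r (phi s) z)) x)); last first.
  by rewrite lee_wpmul2l ?lee_fin//; apply: hP_le => // y; pos.
rewrite hP_integral; [|by mp..].
rewrite -ge0_integralZl_EFin; [|by mp..].
apply: le_integral_ge0 => s _; first by pos.
have [/andP[s0 sr]|_] := boolP (0 < s < r ^+ 2)%R; last by rewrite mul0e; pos.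
rewrite mul1e.
have -> : hP (4 * r ^+ 2) (fun y => true%:R%:E * Av r (phi s) y) x =
    hP (4 * r ^+ 2) (Av r (phi s)) x.
  by rewrite hPZ ?mul1e//; mp.
by apply: hP_le_hP_Av => //; lra.
Qed.

(** Finite integrals in [s] for countably many radii give finite heat averages at the origin for
    almost every [s]. A kernel at any time and centre is dominated by one at a much larger time
    centred at [0]. *)
Lemma local_mass_good : (forall r, (0 < r)%R -> local_mass r 0%R < +oo) ->
  exists B : set R, [/\ measurable B, mu B = 0 &
    forall s, (0 < s)%R -> ~ B s -> forall t x, (0 < t)%R -> hP t (phi s) x < +oo].
Proof.
move=> lf.
have ae : {ae mu, forall s, forall N : nat,
    (0 < s < N.+1%:R ^+ 2)%R%:R%:E * hP (2 * N.+1%:R ^+ 2) (phi s) 0%R < +oo}.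
  apply/ae_foralln => N.
  have hN : (0 < N.+1%:R :> R)%R by rewrite ltr0n.
  have p0 s : 0 <= (0 < s < N.+1%:R ^+ 2)%R%:R%:E * hP (2 * N.+1%:R ^+ 2) (phi s) 0%R by pos.
  have mP : measurable_fun setT (fun s => (0 < s < N.+1%:R ^+ 2)%R%:R%:E *
      hP (2 * N.+1%:R ^+ 2) (phi s) 0%R) by mp.
  have int : mu.-integrable setT (fun s => (0 < s < N.+1%:R ^+ 2)%R%:R%:E *
      hP (2 * N.+1%:R ^+ 2) (phi s) 0%R).
    apply/integrableP; split => //.
    by under eq_integral do rewrite gee0_abs//; exact: lf.
  have := integrable_ae measurableT int.
  by apply: filterS => s /(_ Logic.I) sf; rewrite -ge0_fin_numE.
have [B [mB B0 sB]] := ae; exists B; split => // s s0 nBs t x t0.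
have {nBs}good N : (0 < s < N.+1%:R ^+ 2)%R%:R%:E * hP (2 * N.+1%:R ^+ 2) (phi s) 0%R < +oo.
  by apply: contrapT => bad; apply: nBs; apply: sB => /(_ N).
(* [N] is chosen so that [s < N.+1 ^ 2], and so that the time [2 * N.+1 ^ 2] exceeds [2t] and the
   square of the norm of [x]. *)
pose b := (s + t + enorm x ^+ 2 + 1)%R.
have bp : (0 < b)%R by rewrite /b; have := sqr_ge0 (enorm x); lra.
pose N := Num.truncn b.
have bN : (b < N.+1%:R)%R by exact: Num.Theory.truncnS_gt.
have N1 : (1 <= N.+1%:R :> R)%R by rewrite ler1n.
have bN2 : (b <= N.+1%:R ^+ 2)%R by rewrite expr2; nra.
have e0 := sqr_ge0 (enorm x); rewrite /b in bN2.
have := good N; rewrite (_ : (0 < s < N.+1%:R ^+ 2)%R); last by rewrite s0/=; lra.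
rewrite mul1e; set T := (2 * _)%R => gN.
have T0 : (0 < T)%R by rewrite /T; lra.
apply: (@le_lt_trans _ _ (((T / t) ^+ n * expR 1)%:E * hP T (phi s) 0%R)); last first.
  by rewrite lte_mul_pinfty ?lee_fin// mulr_ge0 ?expR_ge0// exprn_ge0// divr_ge0 ?ltW.
rewrite /hP -ge0_integralZl_EFin; [|by mp..]; last first.
apply: le_integral_ge0 => y _; first by pos.
rewrite muleA lee_wpmul2r// -EFinM lee_fin.
by apply: heat_kernel_le_far => //; [rewrite /T; lra|rewrite sub0r enormN /T; lra].
Qed.

End local_mass.

(** * Tent norms in terms of ball averages of the density *)

Section density.
Context {R : realType} {n : nat}.
Implicit Types (f g : spacetime R n -> R[i]) (h : spacetime R n -> R).
Local Notation mu := (@lebesgue_measure R).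
Local Notation la := (@lebesgue_rV R n).

Lemma normc_sqr (z : R[i]) : normc z ^+ 2 = complex.Re z ^+ 2 + complex.Im z ^+ 2.
Proof. by case: z => a b /=; rewrite sqr_sqrtr// addr_ge0// sqr_ge0. Qed.

Lemma measurable_half_space : measurable (@half_space R n).
Proof. by apply: measurableX => //; exact: measurable_itv. Qed.

Lemma measurable_extend h : measurable_fun half_space h ->
  measurable_fun [set: R * 'rV[R]_n] (fun p => (0 < p.1)%R%:R * h p).
Proof.
move=> mh; have /(measurable_restrictT _ measurable_half_space) := mh.
congr (measurable_fun _ _); apply/funext => -[t y]; rewrite /patch /=.
case: ifPn => [/set_mem[/=]|]; first by rewrite in_itv/= andbT => -> _; rewrite mul1r.
move=> /negP nt; case: (boolP (0 < t)) => [t0|]; last by rewrite mul0r.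
by exfalso; apply: nt; apply/mem_set; split => //=; rewrite in_itv/= t0.
Qed.

(** Vanishing for [s <= 0], where [h] is arbitrary, yields a function measurable on the whole
    product. *)
Definition half_ext h (s : R) (y : 'rV[R]_n) : R := (0 < s)%R%:R * h (s, y).

Lemma measurable_half_ext h : measurable_fun half_space h ->
  measurable_fun [set: R * 'rV[R]_n] (fun p => half_ext h p.1 p.2).
Proof.
move=> /measurable_extend; congr (measurable_fun _ _).
by apply/funext => -[].
Qed.

Definition dens f s y : \bar R :=
  (half_ext (@complex.Re R \o f) s y ^+ 2 + half_ext (@complex.Im R \o f) s y ^+ 2)%:E.

Lemma dens_ge0 f s y : (0 <= dens f s y)%E.
Proof. by rewrite lee_fin addr_ge0// sqr_ge0. Qed.

Lemma dens_normc f s y : 0 < s -> dens f s y = (normc (f (s, y)) ^+ 2)%:E.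
Proof. by move=> s0; rewrite normc_sqr /dens /half_ext s0 !mul1r. Qed.

Lemma measurable_dens f : measurable_fun half_space (@complex.Re R \o f) ->
  measurable_fun half_space (@complex.Im R \o f) ->
  measurable_fun [set: R * 'rV[R]_n] (fun p => dens f p.1 p.2).
Proof.
by move=> /measurable_half_ext m1 /measurable_half_ext m2; rewrite /dens; meas.
Qed.

End density.

Section tent_links.
Local Open Scope ereal_scope.
Context {R : realType} {n : nat}.
Implicit Types (f g : spacetime R n -> R[i]) (x y z : 'rV[R]_n) (r t c q P : R).
Local Notation mu := (@lebesgue_measure R).
Local Notation la := (@lebesgue_rV R n).
Hypothesis n0 : (0 < n)%N.

Lemma integral_itv_infty (F : R -> \bar R) :
  \int[mu]_(t in `]0%R, +oo[) F t = \int[mu]_t ((0 < t)%R%:R%:E * F t).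
Proof.
rewrite integral_indE; last exact: measurable_itv.
apply: eq_integral => t _; rewrite muleC indicE; congr (_%:R%:E * _); congr nat_of_bool.
by apply/idP/idP; rewrite ?inE /= in_itv/= andbT.
Qed.

Lemma integral_itv_oo (b : R) (F : R -> \bar R) :
  \int[mu]_(t in `]0%R, b[) F t = \int[mu]_t ((0 < t < b)%R%:R%:E * F t).
Proof.
rewrite integral_indE; last exact: measurable_itv.
apply: eq_integral => t _; rewrite muleC indicE; congr (_%:R%:E * _); congr nat_of_bool.
by apply/idP/idP; rewrite ?inE /= in_itv/=.
Qed.

Lemma Av_le_ball_average x r (h : 'rV[R]_n -> R) (g : 'rV[R]_n -> \bar R) : (0 < r)%R ->
  (forall y, g y = (h y)%:E) -> (forall y, (0 <= h y)%R) ->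
  Av r g x <= (2 ^+ n)%:E * ball_average x r h.
Proof.
move=> r0 gh h0; have [v vE /andP[vlo vup]] := lebesgue_eball_lub x r0 n0.
have v0 : (0 < v)%R.
  by apply: lt_le_trans vlo; rewrite exprn_gt0// mulr_gt0// divr_gt0// ltr0n.
rewrite /ball_average vE /= integral_indE; last exact: measurable_eball.
rewrite /Av muleA -EFinM.
have -> : \int[la]_y ((enorm (y - x) < r)%R%:R%:E * g y) =
    \int[la]_y ((h y)%:E * (\1_(eball x r) y)%:E).
  by apply: eq_integral => y _; rewrite eball_indE muleC gh.
apply: lee_wpmul2r.
  by apply: integral_ge0 => y _; rewrite mule_ge0// lee_fin.
by rewrite lee_fin ler_pdivlMr// mulrC ler_pdivrMr ?exprn_gt0// -exprMn.
Qed.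

Lemma ball_average_le_Av x r (h : 'rV[R]_n -> R) (g : 'rV[R]_n -> \bar R) : (0 < r)%R ->
  (forall y, (h y)%:E <= g y) -> (forall y, (0 <= h y)%R) ->
  ball_average x r h <= (@ball_cst R n)%:E * Av r g x.
Proof.
move=> r0 gh h0; have [v vE /andP[vlo vup]] := lebesgue_eball_lub x r0 n0.
have v0 : (0 < v)%R.
  by apply: lt_le_trans vlo; rewrite exprn_gt0// mulr_gt0// divr_gt0// ltr0n.
have g0 y : 0 <= g y by apply: le_trans (gh y); rewrite lee_fin.
rewrite /ball_average vE /= integral_indE; last exact: measurable_eball.
rewrite /Av muleA -EFinM.
apply: (@le_trans _ _ ((v^-1)%:E * \int[la]_y ((enorm (y - x) < r)%R%:R%:E * g y))).
  rewrite lee_wpmul2l ?lee_fin ?invr_ge0 ?(ltW v0)//.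
  apply: le_integral_ge0 => y _; first by rewrite mule_ge0// lee_fin.
  by rewrite eball_indE muleC lee_wpmul2l// lee_fin.
apply: lee_wpmul2r; first by apply: integral_ge0 => y _; rewrite mule_ge0// lee_fin.
rewrite lee_fin -[leLHS]mul1r ler_pdivrMr// mulrAC ler_pdivlMr ?exprn_gt0// mul1r.
apply: le_trans (_ : (@ball_cst R n * (2 * (r / n%:R)) ^+ n <= _)%R).
  rewrite /ball_cst -exprMn le_eqVlt; apply/orP; left; apply/eqP; congr (_ ^+ _)%R.
  by field; rewrite pnatr_eq0 -lt0n.
by rewrite ler_wpM2l// ball_cst_ge0.
Qed.

Definition tent_inner f x : \bar R := \int[mu]_(t in `]0%R, +oo[)
  ball_average x (Num.sqrt t) (fun y => (normc (f (t, y)) ^+ 2)%R).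

Definition tent_energy P f : \bar R := \int[la]_x (tent_inner f x `^ (P / 2)).

Lemma tent_norm_finE P f : tent_norm P%:E f = tent_energy P f `^ P^-1.
Proof. by []. Qed.

Lemma ball_average_ge0 x r (h : 'rV[R]_n -> R) : (forall y, (0 <= h y)%R) ->
  0 <= ball_average x r h.
Proof.
move=> h0; rewrite /ball_average mule_ge0 ?lee_fin ?invr_ge0 ?fine_ge0//.
by apply: integral_ge0 => y _; rewrite lee_fin.
Qed.

Lemma tent_inner_ge0 f x : 0 <= tent_inner f x.
Proof.
by apply: integral_ge0 => t _; apply: ball_average_ge0 => y; exact: sqr_ge0.
Qed.

Lemma tent_energy_ge0 P f : 0 <= tent_energy P f.
Proof. by apply: integral_ge0 => x _; exact: poweR_ge0. Qed.

Lemma Asq_dens f x : measurable_fun half_space (@complex.Re R \o f) ->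
  measurable_fun half_space (@complex.Im R \o f) ->
  Asq (dens f) x <= (2 ^+ n)%:E * tent_inner f x.
Proof.
move=> m1 m2; have md := measurable_dens m1 m2; have d0 := @dens_ge0 R n f.
have p0 : (0 < 2 ^+ n :> R)%R by exact: exprn_gt0.
rewrite -lee_pdivrMl// /Asq -ge0_integralZl_EFin; [|by []|by move=> t _; pos|by mp|by rewrite invr_ge0 ltW].
rewrite /tent_inner integral_itv_infty; apply: le_integral_ge0 => t _.
  by rewrite mule_ge0 ?lee_fin ?invr_ge0 ?(ltW p0)//; pos.
have [t0|_] := boolP (0 < t)%R; last by rewrite !mul0e mule0.
rewrite !mul1e lee_pdivrMl//; apply: Av_le_ball_average; first by rewrite sqrtr_gt0.
  by move=> y; exact: dens_normc.
by move=> y; exact: sqr_ge0.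
Qed.

Lemma energy_dens P f : (0 < P)%R -> measurable_fun half_space (@complex.Re R \o f) ->
  measurable_fun half_space (@complex.Im R \o f) ->
  \int[la]_x (Asq (dens f) x `^ (P / 2)) <= ((2 ^+ n) `^ (P / 2))%:E * tent_energy P f.
Proof.
move=> P0 m1 m2; have md := measurable_dens m1 m2; have d0 := @dens_ge0 R n f.
have p0 : (0 < (2 ^+ n) `^ (P / 2) :> R)%R by rewrite powR_gt0 ?exprn_gt0.
have A0 x : 0 <= Asq (dens f) x by rewrite /Asq; pos.
have mA : measurable_fun setT (Asq (dens f)) by rewrite /Asq; mp.
rewrite -lee_pdivrMl// -ge0_integralZl_EFin; [|by []|by move=> x _; exact: poweR_ge0|by mp|by rewrite invr_ge0 ltW].
apply: le_integral_ge0 => x _.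
  by rewrite mule_ge0 ?lee_fin ?invr_ge0 ?(ltW p0)// poweR_ge0.
rewrite lee_pdivrMl// -poweR_EFin -poweRM ?tent_inner_ge0 ?lee_fin ?exprn_ge0//.
apply: gt0_ler_poweR; first by rewrite divr_ge0 ?ltW.
- by rewrite in_itv/= A0 leey.
- by rewrite in_itv/= leey andbT mule_ge0 ?tent_inner_ge0 ?lee_fin ?exprn_ge0.
- exact: Asq_dens.
Qed.

Section dominated.
Variables (S : R -> 'rV[R]_n -> \bar R) (c : R) (g : spacetime R n -> R[i]).
Hypothesis mS : measurable_fun [set: R * 'rV[R]_n] (fun p => S p.1 p.2).
Hypothesis S0 : forall t y, 0 <= S t y.
Hypothesis c0 : (0 <= c)%R.
Hypothesis gS : forall t y, (0 < t)%R -> (normc (g (t, y)) ^+ 2)%:E <= c%:E * S t y.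

Let ball_S x r t : (0 < t)%R -> (0 < r)%R ->
  ball_average x r (fun y => (normc (g (t, y)) ^+ 2)%R) <=
  (@ball_cst R n * c)%:E * Av r (S t) x.
Proof.
move=> t0 r0; rewrite EFinM -muleA.
rewrite -AvZ ?lee_fin//; [|by meas].
apply: ball_average_le_Av => // y; [exact: gS|exact: sqr_ge0].
Qed.

Let bc0 : (0 <= @ball_cst R n * c)%R. Proof. by rewrite mulr_ge0 ?ball_cst_ge0. Qed.

Lemma tent_inner_le x : tent_inner g x <= (@ball_cst R n * c)%:E * Asq S x.
Proof.
rewrite /tent_inner integral_itv_infty /Asq -ge0_integralZl_EFin; [|by []|by move=> t _; pos|by mp|by []].
apply: le_integral_ge0 => t _.
  by rewrite mule_ge0 ?lee_fin// ball_average_ge0// => y; exact: sqr_ge0.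
have [t0|_] := boolP (0 < t)%R; last by rewrite !mul0e mule0.
by rewrite !mul1e ball_S ?sqrtr_gt0.
Qed.

Lemma tent_energy_le P : (0 < P)%R ->
  tent_energy P g <= ((@ball_cst R n * c) `^ (P / 2))%:E * \int[la]_x (Asq S x `^ (P / 2)).
Proof.
move=> P0; have A0 x : 0 <= Asq S x by rewrite /Asq; pos.
have mA : measurable_fun setT (Asq S) by rewrite /Asq; mp.
rewrite -ge0_integralZl_EFin; [|by []|by move=> x _; exact: poweR_ge0|by mp|by rewrite powR_ge0].
apply: le_integral_ge0 => x _; first exact: poweR_ge0.
rewrite -poweR_EFin -poweRM ?lee_fin//.
apply: gt0_ler_poweR; first by rewrite divr_ge0 ?ltW.
- by rewrite in_itv/= tent_inner_ge0 leey.
- by rewrite in_itv/= leey andbT mule_ge0 ?lee_fin.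
- exact: tent_inner_le.
Qed.

Lemma tent_carleson_le x r : (0 < r)%R ->
  \int[mu]_(t in `]0%R, (r ^+ 2)%R[) ball_average x r (fun y => (normc (g (t, y)) ^+ 2)%R) <=
  (@ball_cst R n * c)%:E * \int[mu]_t ((0 < t < r ^+ 2)%R%:R%:E * Av r (S t) x).
Proof.
move=> r0; rewrite integral_itv_oo -ge0_integralZl_EFin; [|by []|by move=> t _; pos|by mp|by []].
apply: le_integral_ge0 => t _.
  by rewrite mule_ge0 ?lee_fin// ball_average_ge0// => y; exact: sqr_ge0.
have [/andP[t0 tr]|_] := boolP (0 < t < r ^+ 2)%R; last by rewrite !mul0e mule0.
by rewrite !mul1e ball_S.
Qed.

End dominated.

Lemma carleson_dens f x r : (0 < r)%R -> measurable_fun half_space (@complex.Re R \o f) ->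
  measurable_fun half_space (@complex.Im R \o f) ->
  \int[mu]_t ((0 < t < r ^+ 2)%R%:R%:E * Av r (dens f t) x) <=
  (2 ^+ n)%:E *
  \int[mu]_(t in `]0%R, (r ^+ 2)%R[) ball_average x r (fun y => (normc (f (t, y)) ^+ 2)%R).
Proof.
move=> r0 m1 m2; have md := measurable_dens m1 m2; have d0 := @dens_ge0 R n f.
have p0 : (0 < 2 ^+ n :> R)%R by exact: exprn_gt0.
rewrite -lee_pdivrMl// -ge0_integralZl_EFin; [|by []|by move=> t _; pos|by mp|by rewrite invr_ge0 ltW].
rewrite integral_itv_oo; apply: le_integral_ge0 => t _.
  by rewrite mule_ge0 ?lee_fin ?invr_ge0 ?(ltW p0)//; pos.
have [/andP[t0 tr]|_] := boolP (0 < t < r ^+ 2)%R; last by rewrite !mul0e mule0.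
rewrite !mul1e lee_pdivrMl//; apply: Av_le_ball_average => //.
  by move=> y; exact: dens_normc.
by move=> y; exact: sqr_ge0.
Qed.

End tent_links.

Section tent_sections.
Local Open Scope ereal_scope.
Context {R : realType} {n : nat}.
Implicit Types (f g : spacetime R n -> R[i]) (x y z : 'rV[R]_n) (r t c q P : R).
Local Notation mu := (@lebesgue_measure R).
Local Notation la := (@lebesgue_rV R n).
Hypothesis n0 : (0 < n)%N.

Lemma poweR_half_sqr (a : \bar R) : 0 <= a -> (a `^ 2^-1) `^ 2 = a.
Proof. by move=> a0; rewrite -poweRrM mulVf// poweRe1. Qed.

Lemma tent_norm_infty_ge0 f : 0 <= tent_norm_infty f.
Proof.
apply: le_trans; last first.
  by apply: ereal_sup_ubound; exists (0, 1)%R; [exact: ltr01|reflexivity].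
exact: poweR_ge0.
Qed.

Lemma carleson_le_norm f x r (M : R) : (0 < r)%R -> tent_norm_infty f <= M%:E ->
  \int[mu]_(t in `]0%R, (r ^+ 2)%R[) ball_average x r (fun y => (normc (f (t, y)) ^+ 2)%R)
  <= (M ^+ 2)%:E.
Proof.
move=> r0 fM; set J := (X in X <= _).
have J0 : 0 <= J.
  by apply: integral_ge0 => t _; apply: ball_average_ge0 => y; exact: sqr_ge0.
have JM : J `^ 2^-1 <= M%:E.
  by apply: le_trans fM; apply: ereal_sup_ubound; exists (x, r).
have M0 : (0 <= M)%R by rewrite -lee_fin; apply: le_trans JM; exact: poweR_ge0.
rewrite -(poweR_half_sqr J0) -powR_mulrn// -poweR_EFin; apply: gt0_ler_poweR => //.
- by rewrite in_itv/= poweR_ge0 leey.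
- by rewrite in_itv/= leey lee_fin M0.
Qed.

Lemma norm_infty_le f (M : R) : (0 <= M)%R ->
  (forall x r, (0 < r)%R ->
    \int[mu]_(t in `]0%R, (r ^+ 2)%R[) ball_average x r (fun y => (normc (f (t, y)) ^+ 2)%R)
    <= (M ^+ 2)%:E) -> tent_norm_infty f <= M%:E.
Proof.
move=> M0 fM; apply: ge_ereal_sup => _ [[x r] /= r0 <-].
rewrite [leRHS](_ : _ = (M ^+ 2)%:E `^ 2^-1); last first.
  by rewrite poweR_EFin -powR_mulrn// -powRrM mulfV// powRr1.
apply: gt0_ler_poweR; first by rewrite invr_ge0.
- rewrite in_itv/= leey andbT; apply: integral_ge0 => t _.
  by apply: ball_average_ge0 => y; exact: sqr_ge0.
- by rewrite in_itv/= leey lee_fin sqr_ge0.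
- exact: fM.
Qed.

Lemma tent_energy_fin P f : (0 < P)%R -> tent_norm P%:E f < +oo -> tent_energy P f < +oo.
Proof. by move=> P0; rewrite tent_norm_finE; apply: lty_poweRy; rewrite invr_neq0 ?gt_eqF. Qed.

Lemma tent_local_mass (p : \bar R) f r : 2%:E <= p -> tent_space p f -> (0 < r)%R ->
  local_mass (dens f) r 0%R < +oo.
Proof.
case: p => [P| |] // p2 [m1 m2 fin] r0; have md := measurable_dens m1 m2.
  rewrite lee_fin in p2; have P0 : (0 < P)%R by lra.
  apply: (@local_mass_Asq R n (dens f) n0 md _ (P / 2)) => //; first exact: dens_ge0.
    by rewrite ler_pdivlMr// mul1r.
  apply: le_lt_trans (energy_dens n0 P0 m1 m2) _.
  by rewrite lte_mul_pinfty ?lee_fin ?powR_ge0//; exact: tent_energy_fin.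
have N0 := tent_norm_infty_ge0 f.
have nf : tent_norm_infty f \is a fin_num by rewrite ge0_fin_numE.
pose M := fine (tent_norm_infty f).
have M0 : (0 <= M)%R by exact: fine_ge0.
apply: (@le_lt_trans _ _ (@spread_cst R n * (2 ^+ n * M ^+ 2))%:E); last exact: ltry.
apply: local_mass_carleson => //; [exact: dens_ge0|by rewrite mulr_ge0 ?exprn_ge0|].
move=> z; apply: le_trans (carleson_dens n0 z r0 m1 m2) _.
rewrite (EFinM (2 ^+ n)) lee_wpmul2l ?lee_fin ?exprn_ge0//; apply: carleson_le_norm => //.
by rewrite fineK.
Qed.

(** [B] is a null set containing every time at which a slice of [f] fails to be heatable. *)
Definition good f (B : set R) := [/\ measurable B, mu B = 0 &
  forall s : R, (0 < s)%R -> ~ B s ->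
    heatable (fun y => complex.Re (f (s, y))) /\ heatable (fun y => complex.Im (f (s, y)))].

Lemma good_exists (p : \bar R) f : 2%:E <= p -> tent_space p f -> exists B, good f B.
Proof.
move=> p2 tf; have [m1 m2 _] := tf.
have [B [mB B0 HB]] := @local_mass_good R n (dens f) (measurable_dens m1 m2)
  (@dens_ge0 R n f) (fun r => @tent_local_mass p f r p2 tf).
exists B; split => // s s0 /(HB s s0) fin.
have cutE (h : spacetime R n -> R) : (fun y => half_ext h s y) = (fun y => h (s, y)).
  by apply/funext => y; rewrite /half_ext s0 mul1r.
have mc (h : spacetime R n -> R) : measurable_fun half_space h -> measurable_fun setT (fun y => h (s, y)).
  move=> /measurable_half_ext mh; rewrite -cutE.
  by meas.
have le h1 h2 t x : (0 < t)%R -> (forall y, h1 y <= h2 y) -> (forall y, 0 <= h1 y) ->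
    hP t h2 x < +oo -> @hP R n t h1 x < +oo.
  by move=> t0 h12 h10; apply: le_lt_trans; exact: hP_le.
split; split; [exact: mc m1| |exact: mc m2|].
- move=> t x t0; apply: (le _ _ t x t0 _ _ (fin t x t0)) => y.
    by rewrite dens_normc// normc_sqr lee_fin lerDl sqr_ge0.
  by rewrite lee_fin sqr_ge0.
- move=> t x t0; apply: (le _ _ t x t0 _ _ (fin t x t0)) => y.
    by rewrite dens_normc// normc_sqr lee_fin lerDr sqr_ge0.
  by rewrite lee_fin sqr_ge0.
Qed.

End tent_sections.

(** * Triangle inequalities and removal of exceptional times *)

Section triangle.
Context {R : realType}.

Lemma sum_sqr_triangle (I : finType) (a b : I -> R) :
  \sum_i (a i + b i) ^+ 2 <=
  (Num.sqrt (\sum_i a i ^+ 2) + Num.sqrt (\sum_i b i ^+ 2)) ^+ 2.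
Proof.
set A := \sum_i a i ^+ 2; set B := \sum_i b i ^+ 2.
have A0 : 0 <= A by apply: sumr_ge0 => i _; exact: sqr_ge0.
have B0 : 0 <= B by apply: sumr_ge0 => i _; exact: sqr_ge0.
set p := Num.sqrt A; set q := Num.sqrt B.
have p0 : 0 <= p by exact: sqrtr_ge0.
have q0 : 0 <= q by exact: sqrtr_ge0.
have pA : p ^+ 2 = A by rewrite sqr_sqrtr.
have qB : q ^+ 2 = B by rewrite sqr_sqrtr.
pose C := \sum_i a i * b i.
have zero (c d : I -> R) : \sum_i c i ^+ 2 = 0 -> \sum_i c i * d i = 0.
  move=> /eqP; rewrite psumr_eq0; last by move=> i _; exact: sqr_ge0.
  move=> /allP c0; rewrite big1// => i _.
  by have /= := c0 i (mem_index_enum i); rewrite sqrf_eq0 => /eqP ->; rewrite mul0r.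
have -> : \sum_i (a i + b i) ^+ 2 = A + B + 2 * C.
  rewrite /A /B /C mulr_sumr -!big_split/=; apply: eq_bigr => i _; ring.
suff : C <= p * q by rewrite sqrrD pA qB; lra.
have [p0'|pn] := eqVneq p 0.
  rewrite p0' mul0r /C (zero a b) //.
  by have := esym pA; rewrite p0' expr0n.
have [q0'|qn] := eqVneq q 0.
  have CE : \sum_i a i * b i = \sum_i b i * a i by apply: eq_bigr => i _; exact: mulrC.
  rewrite q0' mulr0 /C CE (zero b a) //.
  by have := esym qB; rewrite q0' expr0n.
have pq : 0 < p * q by rewrite mulr_gt0// lt_neqAle eq_sym ?pn ?qn.
(* Cauchy-Schwarz by expanding this square; the degenerate cases [p = 0] and [q = 0] are already
   settled. *)
have : 0 <= \sum_i (q * a i - p * b i) ^+ 2 by apply: sumr_ge0 => i _; exact: sqr_ge0.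
have -> : \sum_i (q * a i - p * b i) ^+ 2 = q ^+ 2 * A + p ^+ 2 * B - 2 * (p * q) * C.
  rewrite /A /B /C !mulr_sumr -sumrN -!big_split/=; apply: eq_bigr => i _; ring.
rewrite -pA -qB => H.
rewrite -(ler_pM2l pq); nra.
Qed.

Local Open Scope ereal_scope.

Lemma minkowski_sqr d (T : measurableType d) (mu : {measure set T -> \bar R}) (a b : T -> R) :
  measurable_fun setT a -> measurable_fun setT b ->
  (\int[mu]_x ((a x + b x) ^+ 2)%:E) `^ 2^-1 <=
  (\int[mu]_x (a x ^+ 2)%:E) `^ 2^-1 + (\int[mu]_x (b x ^+ 2)%:E) `^ 2^-1.
Proof.
move=> ma mb.
have E (f : T -> R) : \int[mu]_x (f x ^+ 2)%:E = \int[mu]_x (`|(f x)%:E| `^ 2).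
  apply: eq_integral => x _; rewrite abse_EFin poweR_EFin powR_mulrn ?normr_ge0//.
  by rewrite real_normK// num_real.
rewrite !E; have := @minkowski_EFin _ _ _ mu a b 2 ma mb.
by rewrite unlock /Lnorm; apply; rewrite ler1n.
Qed.

(** Since [fine] sends [+oo] to [0], passing to real values can only decrease the square. *)
Lemma fine_sqrt_le (a : \bar R) : 0 <= a -> ((fine (a `^ 2^-1)) ^+ 2)%:E <= a.
Proof.
case: a => [a| |] //; last by move=> _; rewrite leey.
rewrite lee_fin => a0; rewrite poweR_EFin lee_fin.
by rewrite -powR_mulrn ?powR_ge0// -powRrM mulVf// powRr1.
Qed.

End triangle.

Section sections.
Context {R : realType} {n : nat}.
Implicit Types (B : set R) (h : spacetime R n -> R).

(** With the exceptional slices replaced by [0], every slice is heatable and joint measurability is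
    kept. *)
Definition good_part B h (s : R) (y : 'rV[R]_n) : R := \1_(~` B) s * half_ext h s y.

Lemma measurable_good_part B h : measurable B -> measurable_fun half_space h ->
  measurable_fun [set: R * 'rV[R]_n] (fun p => good_part B h p.1 p.2).
Proof.
move=> mB /measurable_half_ext mh; rewrite /good_part.
have mi : measurable_fun setT (\1_(~` B) : R -> R).
  by apply: measurable_indic; exact: measurableC.
by meas.
Qed.

Lemma good_partE B h s : 0 < s -> ~ B s -> good_part B h s = fun y => h (s, y).
Proof.
move=> s0 nB; apply/funext => y; rewrite /good_part /half_ext s0 indicE mem_set//.
by rewrite !mul1r.
Qed.

Lemma good_part0 B h s : ~ (0 < s /\ ~ B s) -> good_part B h s = fun=> 0.
Proof.
move=> nb; apply/funext => y; rewrite /good_part /half_ext.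
case: (boolP (0 < s)) => s0; last by rewrite mul0r mulr0.
by rewrite indicE memNset ?mul0r//= => nB; apply: nb.
Qed.

Lemma good_part_sqr B h s y : good_part B h s y ^+ 2 <= half_ext h s y ^+ 2.
Proof.
rewrite /good_part indicE; case: (s \in _); first by rewrite mul1r.
by rewrite mul0r expr0n/= sqr_ge0.
Qed.

End sections.

(** * An abstract quadratic operator and its extension to tent spaces *)

Section quadratic_operator.
Local Open Scope ereal_scope.
Context {R : realType} {n : nat}.
Implicit Types (f g : spacetime R n -> R[i]) (z : spacetime R n) (x y : 'rV[R]_n)
  (r s t : R) (u v : 'rV[R]_n -> R) (B : set R).
Local Notation mu := (@lebesgue_measure R).
Local Notation la := (@lebesgue_rV R n).
Hypothesis n0 : (0 < n)%N.
Variables (m : nat) (L : 'I_m -> R -> ('rV[R]_n -> R) -> 'rV[R]_n -> R).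
Variables (G : R -> ('rV[R]_n -> R) -> ('rV[R]_n -> R) -> 'rV[R]_n -> \bar R).
Variables (c C0 : R) (chi : R -> bool).

(** [L i] acts on real functions: the partial derivatives of the heat extension, or a single
    rescaled heat operator. The real part [u] and the imaginary part [v] of the datum contribute
    separately. *)
Definition Lsqr t u v x : R := (\sum_i (L i t u x ^+ 2 + L i t v x ^+ 2))%R.

Hypothesis mL : forall d (T : measurableType d) i (h : T -> R) (k : T -> 'rV[R]_n)
    (u : T -> 'rV[R]_n -> R), measurable_fun setT h -> measurable_fun setT k ->
  measurable_fun [set: T * 'rV[R]_n] (fun p => u p.1 p.2) ->
  measurable_fun setT (fun p => L i (h p) (u p) (k p)).
Hypothesis LD : forall i t u v x, (0 < t)%R -> heatable u -> heatable v ->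
  L i t (fun y => u y + v y)%R x = (L i t u x + L i t v x)%R.
Hypothesis LZ : forall i t u x (a : R), (0 < t)%R -> heatable u ->
  L i t (fun y => a * u y)%R x = (a * L i t u x)%R.
Hypothesis Lae : forall i t u v x (N : set 'rV[R]_n), measurable N -> la N = 0 ->
  (forall y, ~ N y -> u y = v y) -> L i t u x = L i t v x.
Hypothesis c0 : (0 < c)%R.
Hypothesis C00 : (0 <= C0)%R.
Hypothesis mchi : measurable_fun setT chi.
Hypothesis Ldiss : forall u v, heatable u -> heatable v ->
  dissipative (fun t y => (c * Lsqr t u v y)%:E) (fun t => G t u v).
Hypothesis LG0 : forall u v y, G 0%R u v y <= (C0 * (u y ^+ 2 + v y ^+ 2))%:E.

Let re f : spacetime R n -> R := @complex.Re R \o f.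
Let im f : spacetime R n -> R := @complex.Im R \o f.

Definition Lint f t x : \bar R := \int[mu]_s ((0 < s < t)%R%:R%:E *
  (Lsqr (t - s) (fun y => complex.Re (f (s, y))) (fun y => complex.Im (f (s, y))) x)%:E).

Definition Lop f z : \bar R := ((chi z.1)%:R%:E * Lint f z.1 z.2) `^ 2^-1.

Let Lsqr_ge0 t u v x : (0 <= Lsqr t u v x)%R.
Proof. by apply: sumr_ge0 => i _; rewrite addr_ge0 ?sqr_ge0. Qed.

Lemma Lint_ge0 f t x : 0 <= Lint f t x.
Proof. by apply: integral_ge0 => s _; rewrite mule_ge0 ?lee_fin. Qed.

(** An infinite value becomes [0]; by [Lop_fin_ae] this concerns only a null set. *)
Definition Lext f z : R[i] := ((fine (Lop f z))%:C)%C.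

Section one_function.
Variables (f : spacetime R n -> R[i]) (B : set R).
Hypothesis mre : measurable_fun half_space (re f).
Hypothesis mim : measurable_fun half_space (im f).
Hypothesis gB : good f B.

Let mB : measurable B. Proof. by case: gB. Qed.
Let ur := good_part B (re f).
Let ui := good_part B (im f).
Let mur : measurable_fun [set: R * 'rV[R]_n] (fun p => ur p.1 p.2).
Proof. exact: measurable_good_part. Qed.
Let mui : measurable_fun [set: R * 'rV[R]_n] (fun p => ui p.1 p.2).
Proof. exact: measurable_good_part. Qed.

Let hur s : heatable (ur s).
Proof.
case: (pselect ((0 < s)%R /\ ~ B s)) => [[s0 nB]|h].
  by rewrite /ur good_partE//; have [_ _ /(_ s s0 nB)[]] := gB.
by rewrite /ur good_part0//; exact: heatable_cst.
Qed.

Let hui s : heatable (ui s).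
Proof.
case: (pselect ((0 < s)%R /\ ~ B s)) => [[s0 nB]|h].
  by rewrite /ui good_partE//; have [_ _ /(_ s s0 nB)[]] := gB.
by rewrite /ui good_part0//; exact: heatable_cst.
Qed.

Let FF s t y : \bar R := (c * Lsqr t (ur s) (ui s) y)%:E.
Let GG s t : 'rV[R]_n -> \bar R := G t (ur s) (ui s).

Let mLu d (T : measurableType d) (h : T -> R) (k : T -> 'rV[R]_n) (l : T -> R) :
  measurable_fun setT h -> measurable_fun setT k -> measurable_fun setT l ->
  measurable_fun setT (fun p => Lsqr (h p) (ur (l p)) (ui (l p)) (k p)).
Proof.
move=> mh mk ml; rewrite /Lsqr; apply: mf_sum => i.
apply: mf_add; apply: mf_exprn; apply: mL => //.
  by apply: (mf_app2 mur); meas; exact: (mf_app ml measurable_fst).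
by apply: (mf_app2 mui); meas; exact: (mf_app ml measurable_fst).
Qed.

Lemma measurable_FF : measurable_fun [set: R * R * 'rV[R]_n] (fun p => FF p.1.1 p.1.2 p.2).
Proof. by rewrite /FF; meas; apply: mLu; meas. Qed.

Let FF0 s t y : 0 <= FF s t y.
Proof. by rewrite lee_fin mulr_ge0// ltW. Qed.

Let S := sqfun FF.
Let mS : measurable_fun [set: R * 'rV[R]_n] (fun p => S p.1 p.2).
Proof. exact: (measurable_sqfun measurable_FF FF0). Qed.
Let S0 t y : 0 <= S t y.
Proof. exact: sqfun_ge0. Qed.

(** The slices at exceptional times form a null set in [s], so they can be replaced by those of
    [good_part], to which the theory of [sqfun] applies. *)
Lemma Lint_sqfun t x : c%:E * Lint f t x = S t x.
Proof.
have E : Lint f t x = \int[mu]_s ((0 < s < t)%R%:R%:E * (Lsqr (t - s) (ur s) (ui s) x)%:E).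
  have [_ B0 _] := gB; rewrite /Lint; apply: (@eq_integral_null _ _ _ mu setT B _ _ mB B0).
  - by move=> s _; rewrite mule_ge0 ?lee_fin.
  - by move=> s _; rewrite mule_ge0 ?lee_fin.
  - move=> s _ nB; case: (boolP (0 < s < t)%R) => [/andP[s0 _]|]; last by rewrite !mul0e.
    by rewrite /ur /ui !good_partE.
rewrite E -ge0_integralZl_EFin; [|by []|by move=> s _; rewrite mule_ge0 ?lee_fin| |exact: ltW].
  by apply: eq_integral => s _; rewrite muleCA.
by meas; apply: mLu; meas.
Qed.

Let LintE t x : Lint f t x = (c^-1)%:E * S t x.
Proof. by rewrite -Lint_sqfun muleA -EFinM mulVf ?gt_eqF// mul1e. Qed.

Lemma measurable_Lop : measurable_fun [set: R * 'rV[R]_n] (Lop f).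
Proof.
rewrite (_ : Lop f = fun z => ((chi z.1)%:R%:E * ((c^-1)%:E * S z.1 z.2)) `^ 2^-1).
  by meas.
by apply/funext => z; rewrite /Lop LintE.
Qed.

Let dissFF s : dissipative (FF s) (GG s).
Proof. exact: Ldiss. Qed.

Let GGphi s y : GG s 0%R y <= C0%:E * dens f s y.
Proof.
apply: le_trans (LG0 _ _ _) _; rewrite /dens -EFinM lee_fin ler_wpM2l//.
by rewrite lerD// good_part_sqr.
Qed.

Let md : measurable_fun [set: R * 'rV[R]_n] (fun p => dens f p.1 p.2).
Proof. exact: measurable_dens. Qed.

Let ci0 : (0 <= c^-1)%R. Proof. by rewrite invr_ge0 ltW. Qed.

Lemma normc_Lext z : normc (Lext f z) = fine (Lop f z).
Proof.
rewrite /normc /= expr0n /= addr0 sqrtr_sqr ger0_norm// fine_ge0//.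
exact: poweR_ge0.
Qed.

Let Lext_le t y : (0 < t)%R -> (normc (Lext f (t, y)) ^+ 2)%:E <= (c^-1)%:E * S t y.
Proof.
move=> t0; rewrite normc_Lext -LintE; apply: le_trans (fine_sqrt_le _) _.
  by rewrite mule_ge0 ?lee_fin ?Lint_ge0.
rewrite -[leRHS]mul1e lee_wpmul2r ?Lint_ge0// lee_fin /=.
by case: (chi t).
Qed.

Lemma Lext_energy P : (2 <= P)%R -> tent_energy P (Lext f) <=
  (((@ball_cst R n * c^-1) `^ (P / 2)) *
   (@sqfun_cst R n C0 (P / 2) * (2 ^+ n) `^ (P / 2)))%:E * tent_energy P f.
Proof.
move=> P2; have P0 : (0 < P)%R by lra.
apply: le_trans (tent_energy_le n0 mS S0 ci0 Lext_le P0) _.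
rewrite EFinM -muleA lee_wpmul2l ?lee_fin ?powR_ge0//.
have q1 : (1 <= P / 2)%R by rewrite ler_pdivlMr// mul1r.
have := @sqfun_Asq R n FF GG (dens f) C0 n0 C00 measurable_FF md FF0 (@dens_ge0 R n f)
  dissFF GGphi (P / 2) q1.
move=> /le_trans; apply.
rewrite EFinM -muleA lee_wpmul2l ?lee_fin ?powR_ge0//.
exact: energy_dens.
Qed.

Definition carleson_cst : R := (@ball_cst R n * c^-1 *
  (@near_cst R n * C0 * @Kcst R n * (@spread_cst R n * 2 ^+ n)))%R.

Lemma carleson_cst_ge0 : (0 <= carleson_cst)%R.
Proof.
have h1 := @ball_cst_ge0 R n; have h2 := @near_cst_ge0 R n; have h3 := @Kcst_ge0 R n.
have h4 := @spread_cst_ge0 R n; have h5 : (0 <= 2 ^+ n :> R)%R by rewrite exprn_ge0.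
exact: (mulr_ge0 (mulr_ge0 h1 ci0) (mulr_ge0 (mulr_ge0 (mulr_ge0 h2 C00) h3) (mulr_ge0 h4 h5))).
Qed.

Lemma Lext_infty (M : R) : (0 <= M)%R -> tent_norm_infty f <= M%:E ->
  tent_norm_infty (Lext f) <= (Num.sqrt carleson_cst * M)%:E.
Proof.
move=> M0 fM; have K0 := carleson_cst_ge0.
apply: norm_infty_le; first by rewrite mulr_ge0 ?sqrtr_ge0.
move=> x r r0; apply: le_trans (tent_carleson_le n0 mS S0 ci0 Lext_le x r0) _.
rewrite exprMn sqr_sqrtr// /carleson_cst -(mulrA (_ * c^-1)%R) [leRHS]EFinM lee_wpmul2l//.
  by rewrite lee_fin mulr_ge0 ?ball_cst_ge0.
have := @sqfun_local R n FF GG (dens f) C0 C00 measurable_FF md FF0 (@dens_ge0 R n f)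
  dissFF GGphi r x r0.
move=> /le_trans; apply.
rewrite -(mulrA (_ * @Kcst R n)%R) [leRHS]EFinM lee_wpmul2l//.
  have h2 := @near_cst_ge0 R n; have h3 := @Kcst_ge0 R n.
  by rewrite lee_fin; exact: (mulr_ge0 (mulr_ge0 h2 C00) h3).
rewrite -(mulrA (@spread_cst R n)); apply: local_mass_carleson => //; first exact: dens_ge0.
  by rewrite mulr_ge0 ?exprn_ge0 ?sqr_ge0.
move=> z; apply: le_trans (carleson_dens n0 z r0 mre mim) _.
by rewrite [leRHS]EFinM lee_wpmul2l ?lee_fin ?exprn_ge0//; exact: carleson_le_norm.
Qed.

(** [sqfun_local] at the origin bounds the integral of the square function over the cylinders of
    height [N.+1 ^ 2] and radius [N.+1], which exhaust the half-space. *)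
Lemma Lint_fin_ae : (forall r, (0 < r)%R -> local_mass (dens f) r 0%R < +oo) ->
  \forall z \ae (@spacetime_measure R n), half_space z -> Lint f z.1 z.2 < +oo.
Proof.
move=> lf.
pose H (N : nat) (z : spacetime R n) : \bar R := (0 < z.1 < N.+1%:R ^+ 2)%R%:R%:E *
  ((enorm (z.2 - 0) < N.+1%:R)%R%:R%:E * S z.1 z.2).
have H0 N z : 0 <= H N z by rewrite /H !mule_ge0 ?lee_fin.
have mH N : measurable_fun setT (H N) by rewrite /H; meas.
have intH N : \int[@spacetime_measure R n]_z H N z < +oo.
  have N0 : (0 < N.+1%:R :> R)%R by rewrite ltr0n.
  have -> : \int[@spacetime_measure R n]_z H N z = \int[mu]_t \int[la]_y H N (t, y).
    exact: (fubini_tonelli1 (H N) (mH N) (H0 N)).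
  have -> : \int[mu]_t \int[la]_y H N (t, y) =
    ((N.+1%:R ^+ n)%:E * \int[mu]_t ((0 < t < N.+1%:R ^+ 2)%R%:R%:E * Av N.+1%:R (S t) 0%R)).
    rewrite -ge0_integralZl_EFin; [|by []|by move=> t _; pos|by mp|by rewrite exprn_ge0].
    apply: eq_integral => t _; rewrite /H /= ge0_integralZl_EFin; [|by []|by move=> y _; pos|by mp|by pos].
    rewrite muleCA; congr (_ * _); rewrite /Av muleA -EFinM mulfV ?mul1e//.
  rewrite lte_mul_pinfty ?lee_fin ?exprn_ge0//.
  have := @sqfun_local R n FF GG (dens f) C0 C00 measurable_FF md FF0 (@dens_ge0 R n f)
    dissFF GGphi N.+1%:R 0%R N0.
  move=> /le_lt_trans; apply; rewrite lte_mul_pinfty//; last exact: lf.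
  have h2 := @near_cst_ge0 R n; have h3 := @Kcst_ge0 R n.
  by rewrite lee_fin; exact: (mulr_ge0 (mulr_ge0 h2 C00) h3).
have ae : {ae @spacetime_measure R n, forall z N, H N z < +oo}.
  apply/ae_foralln => N.
  have int : (@spacetime_measure R n).-integrable setT (H N).
    apply/integrableP; split => //.
    by under eq_integral do rewrite gee0_abs//; exact: intH.
  have := integrable_ae measurableT int.
  by apply: filterS => z /(_ Logic.I) sf; rewrite -ge0_fin_numE.
apply: filterS ae => -[t y] /= Hfin; rewrite /half_space /= => -[/= t0 _].
move: t0; rewrite in_itv/= andbT => t0.
rewrite LintE lte_mul_pinfty ?lee_fin//.
pose b := (t + enorm y + 1)%R.
have bN : (b < (Num.truncn b).+1%:R)%R by exact: Num.Theory.truncnS_gt.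
have := Hfin (Num.truncn b); rewrite /H /=.
have e0 := enorm_ge0 y.
set N := (Num.truncn b).+1%:R in bN *; rewrite /b in bN.
rewrite subr0 t0 /= (_ : (t < N ^+ 2)%R = true); last by apply/idP; rewrite expr2; nra.
by rewrite (_ : (enorm y < N)%R = true) ?mul1e//; apply/idP; lra.
Qed.

(** Presents the square function as the square of an [L^2] norm in [s] of a measurable function, as
    Minkowski's inequality requires. *)
Lemma Lint_L2 t x : exists a : R -> R, [/\ measurable_fun setT a,
  forall s, ~~ (0 < s < t)%R -> a s = 0%R,
  Lint f t x = \int[mu]_s (a s ^+ 2)%:E &
  forall s, (0 < s < t)%R -> ~ B s -> a s = Num.sqrt (Lsqr (t - s)
    (fun y => complex.Re (f (s, y))) (fun y => complex.Im (f (s, y))) x)].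
Proof.
exists (fun s => (0 < s < t)%R%:R * Num.sqrt (Lsqr (t - s) (ur s) (ui s) x))%R; split.
- by meas; apply: mLu; meas.
- by move=> s /negbTE ->; rewrite mul0r.
- have [_ B0 _] := gB; rewrite /Lint; apply: (@eq_integral_null _ _ _ mu setT B _ _ mB B0).
  + by move=> s _; rewrite mule_ge0 ?lee_fin.
  + by move=> s _; rewrite lee_fin sqr_ge0.
  + move=> s _ nB; case: (boolP (0 < s < t)%R) => [/andP[s0 _]|].
      by rewrite /ur /ui !good_partE// !mul1r mul1e sqr_sqrtr.
    by rewrite !mul0e mul0r expr0n.
- move=> s st nB; rewrite st mul1r; have /andP[s0 _] := st.
  by rewrite /ur /ui !good_partE.
Qed.

End one_function.

Let re_im_sum t u v x :
  Lsqr t u v x = (\sum_(k : 'I_m * bool) (L k.1 t (if k.2 then u else v) x) ^+ 2)%R.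
Proof.
rewrite /Lsqr -(pair_bigA _ (fun i (b : bool) => (L i t (if b then u else v) x ^+ 2)%R)) /=.
by apply: eq_bigr => i _; rewrite big_bool.
Qed.

Lemma Lsqr_triangle t u v u' v' x : (0 < t)%R -> heatable u -> heatable v ->
  heatable u' -> heatable v' ->
  (Lsqr t (fun y => u y + u' y) (fun y => v y + v' y) x <=
  (Num.sqrt (Lsqr t u v x) + Num.sqrt (Lsqr t u' v' x)) ^+ 2)%R.
Proof.
move=> t0 gu gv gu' gv'; rewrite !re_im_sum.
apply: le_trans (sum_sqr_triangle _ _).
rewrite le_eqVlt; apply/orP; left; apply/eqP; apply: eq_bigr => -[i b] _ /=.
by case: b; rewrite LD.
Qed.

(** For fixed [s], the triangle inequality in the finitely many real components; then Minkowski in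
    [s]. The sum [f + g] needs no exceptional set of its own. *)
Lemma Lop_subadd f g B B' z : measurable_fun half_space (re f) ->
  measurable_fun half_space (im f) -> measurable_fun half_space (re g) ->
  measurable_fun half_space (im g) -> good f B -> good g B' ->
  Lop (fun w => f w + g w)%R z <= Lop f z + Lop g z.
Proof.
case: z => t x mf1 mf2 mg1 mg2 gf gg; rewrite /Lop /=.
case: (chi t); last by rewrite !mul0e poweR0r ?adde0.
rewrite !mul1e.
have [a [ma a0 aE aB]] := Lint_L2 mf1 mf2 gf t x.
have [b [mb b0 bE bB]] := Lint_L2 mg1 mg2 gg t x.
rewrite aE bE; apply: le_trans (minkowski_sqr mu ma mb).
apply: gt0_ler_poweR; first by rewrite invr_ge0.
- by rewrite in_itv/= leey Lint_ge0.
- rewrite in_itv/= leey andbT; apply: integral_ge0 => s _; rewrite lee_fin sqr_ge0 //.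
have [mB B0 hB] := gf; have [mB' B0' hB'] := gg.
have mBB : measurable (B `|` B') by exact: measurableU.
have BB0 : mu (B `|` B') = 0.
  by apply: null_set_setU.
pose X s := (0 < s < t)%R%:R%:E * (Lsqr (t - s) (fun y => complex.Re (f (s, y) + g (s, y)))
  (fun y => complex.Im (f (s, y) + g (s, y))) x)%:E.
have X0 s : 0 <= X s by rewrite mule_ge0 ?lee_fin.
(* The exceptional times of [f] and [g] are cut off by an indicator, so that the comparison of the
   integrands holds at every [s]. *)
rewrite [leLHS](_ : _ = \int[mu]_s ((\1_(~` (B `|` B')) s)%:E * X s)); last first.
  rewrite /Lint; apply: (@eq_integral_null _ _ _ mu setT _ _ _ mBB BB0) => [s _|s _|s _ nB].
  - exact: X0.
  - by apply: mule_ge0 (X0 s); rewrite lee_fin indicE.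
  - by rewrite indicE mem_set// mul1e.
apply: le_integral_ge0 => s _; first by apply: mule_ge0 (X0 s); rewrite lee_fin indicE.
rewrite indicE; case: (boolP (s \in _)) => [/set_mem/= nB|_]; last by rewrite mul0e lee_fin sqr_ge0.
rewrite mul1e /X; case: (boolP (0 < s < t)%R) => [st|_]; last by rewrite mul0e lee_fin sqr_ge0.
rewrite mul1e lee_fin aB ?bB//; [|by move=> h; apply: nB; right|by move=> h; apply: nB; left].
have /andP[s0 ts] := st.
have [h1 h2] := hB s s0 (fun h => nB (or_introl h)).
have [h3 h4] := hB' s s0 (fun h => nB (or_intror h)).
have ts0 : (0 < t - s)%R by rewrite subr_gt0.
apply: le_trans (Lsqr_triangle x ts0 h1 h2 h3 h4).
rewrite le_eqVlt; apply/orP; left; apply/eqP; congr (Lsqr _ _ _ _); apply/funext => y.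
  by case: (f (s, y)) (g (s, y)) => ? ? [].
by case: (f (s, y)) (g (s, y)) => ? ? [].
Qed.

Let heatableZ u (a : R) : heatable u -> heatable (fun y => a * u y)%R.
Proof.
move=> [mu_ uf]; split; first by meas.
move=> t x t0; rewrite (_ : (fun y => ((a * u y) ^+ 2)%:E) = fun y => (a ^+ 2)%:E * (u y ^+ 2)%:E).
  rewrite hPZ ?sqr_ge0//; [|by meas|by move=> y; rewrite lee_fin sqr_ge0].
  by rewrite lte_mul_pinfty ?lee_fin ?sqr_ge0//; exact: uf.
by apply/funext => y; rewrite exprMn EFinM.
Qed.

(** Multiplication by [a + ib] acts on the pair of real and imaginary parts as a similarity of ratio
    [sqrt (a^2 + b^2)]. *)
Lemma LsqrZ t u v x (a b : R) : (0 < t)%R -> heatable u -> heatable v ->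
  Lsqr t (fun y => a * u y - b * v y)%R (fun y => a * v y + b * u y)%R x =
  ((a ^+ 2 + b ^+ 2) * Lsqr t u v x)%R.
Proof.
move=> t0 gu gv; rewrite /Lsqr mulr_sumr; apply: eq_bigr => i _.
have -> : (fun y => a * u y - b * v y)%R = (fun y => a * u y + (- b) * v y)%R.
  by apply/funext => y; rewrite mulNr.
rewrite !LD ?LZ//; try exact: heatableZ.
by ring.
Qed.

Lemma Lint_scale f B (a : R[i]) t x : measurable_fun half_space (re f) ->
  measurable_fun half_space (im f) -> good f B ->
  Lint (fun w => a * f w)%R t x = (normc a ^+ 2)%:E * Lint f t x.
Proof.
move=> mf1 mf2 gf; have [al [ma a0 aE aB]] := Lint_L2 mf1 mf2 gf t x.
have [mB B0 hB] := gf.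
rewrite aE -ge0_integralZl_EFin; [|by []|by move=> s _; rewrite lee_fin sqr_ge0|by meas|by rewrite sqr_ge0].
have -> : \int[mu]_s ((normc a ^+ 2)%:E * (al s ^+ 2)%:E) =
  \int[mu]_s ((0 < s < t)%R%:R%:E * ((normc a ^+ 2)%:E * (al s ^+ 2)%:E)).
  apply: eq_integral => s _; case: (boolP (0 < s < t)%R) => [|/a0 ->]; first by rewrite mul1e.
  by rewrite mul0e expr0n mule0.
rewrite /Lint; apply: (@eq_integral_null _ _ _ mu setT B _ _ mB B0).
- by move=> s _; rewrite mule_ge0 ?lee_fin.
- by move=> s _; rewrite !mule_ge0 ?lee_fin ?sqr_ge0.
move=> s _ nB; case: (boolP (0 < s < t)%R) => [st|]; last by rewrite !mul0e.
rewrite !mul1e aB// sqr_sqrtr// -EFinM; have /andP[s0 ts] := st.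
have ts0 : (0 < t - s)%R by rewrite subr_gt0.
have [h1 h2] := hB s s0 nB.
rewrite normc_sqr -LsqrZ//; congr (_%:E); congr (Lsqr _ _ _ _); apply/funext => y.
  by case: a (f (s, y)) => ? ? [].
by case: a (f (s, y)) => ? ? [] ? ? /=; rewrite addrC.
Qed.

(** A null set of the product has null sections at almost every [s], by the definition of the
    product measure. *)
Lemma ae_sections f g : f = g %[ae @spacetime_measure R n in half_space] ->
  exists B : set R, [/\ measurable B, mu B = 0 & forall s, (0 < s)%R -> ~ B s ->
    exists N, [/\ measurable N, la N = 0 & forall y, ~ N y -> f (s, y) = g (s, y)]].
Proof.
move=> [A [mA A0 hA]].
have ms : measurable_fun setT (la \o xsection A) by exact: measurable_fun_xsection.
have : \int[mu]_s `|(la \o xsection A) s| = 0.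
  by rewrite -A0; apply: eq_integral => s _; rewrite gee0_abs.
move=> /(ae_eq_integral_abs mu measurableT ms) [B [mB B0 hB]].
exists B; split => // s s0 nB; exists (xsection A s); split.
- exact: measurable_xsection.
- by apply: contrapT => h; apply: nB; apply: hB => /(_ Logic.I).
move=> y nA; apply: contrapT => fg; apply: nA; apply/xsectionP; apply: hA => /=.
by move=> h; apply: fg; apply: h; split => //=; rewrite in_itv/= s0.
Qed.

Lemma Lint_ae f g t x : f = g %[ae @spacetime_measure R n in half_space] ->
  Lint f t x = Lint g t x.
Proof.
move=> /ae_sections[B [mB B0 hB]].
rewrite /Lint; apply: (@eq_integral_null _ _ _ mu setT B _ _ mB B0).
- by move=> s _; rewrite mule_ge0 ?lee_fin.
- by move=> s _; rewrite mule_ge0 ?lee_fin.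
move=> s _ nB; case: (boolP (0 < s < t)%R) => [/andP[s0 _]|]; last by rewrite !mul0e.
have [N [mN N0 hN]] := hB s s0 nB.
rewrite !mul1e; congr (_%:E); apply: eq_bigr => i _.
by congr (_ ^+ 2 + _ ^+ 2)%R; apply: (Lae _ _ _ mN N0) => y /hN ->.
Qed.

Section bounded_extension.
Variable p : \bar R.
Hypothesis p2 : 2%:E <= p.

Let tent_good f : tent_space p f -> exists B, good f B.
Proof. exact: good_exists. Qed.

Lemma Lop_fin_ae f : tent_space p f ->
  \forall z \ae (@spacetime_measure R n), half_space z -> Lop f z < +oo.
Proof.
move=> tf; have [B gB] := tent_good tf; have [m1 m2 _] := tf.
have := Lint_fin_ae m1 m2 gB (fun r => @tent_local_mass R n n0 p f r p2 tf).
apply: filterS => z h /h {h} Lf; rewrite /Lop poweR_lty// lte_mul_pinfty ?lee_fin//.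
Qed.

Lemma Lext_bound : exists2 C : R, (0 <= C)%R & forall f, tent_space p f ->
  tent_norm p (Lext f) <= C%:E * tent_norm p f.
Proof.
case: p p2 => [P| |] //; last first.
  move=> _; exists (Num.sqrt carleson_cst); first exact: sqrtr_ge0.
  move=> f tf; have [B gB] := @good_exists R n n0 +oo f (leey _) tf.
  have [m1 m2 fin] := tf.
  have N0 := tent_norm_infty_ge0 f.
  have nf : tent_norm_infty f = (fine (tent_norm_infty f))%:E.
    by rewrite fineK// ge0_fin_numE.
  rewrite /tent_norm [in leRHS]nf -EFinM.
  by apply: (Lext_infty m1 m2 gB (fine_ge0 N0)); rewrite -nf.
rewrite lee_fin => P2; have P0 : (0 < P)%R by lra.
set K := (((@ball_cst R n * c^-1) `^ (P / 2)) *
   (@sqfun_cst R n C0 (P / 2) * (2 ^+ n) `^ (P / 2)))%R.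
have K0 : (0 <= K)%R by rewrite /K !mulr_ge0// ?powR_ge0.
exists (K `^ P^-1)%R; first exact: powR_ge0.
move=> f tf; have [B gB] := @good_exists R n n0 P%:E f P2 tf.
have [m1 m2 fin] := tf.
rewrite !tent_norm_finE -poweR_EFin -poweRM ?lee_fin ?tent_energy_ge0//.
apply: gt0_ler_poweR; first by rewrite invr_ge0 ltW.
- by rewrite in_itv/= leey tent_energy_ge0.
- by rewrite in_itv/= leey andbT mule_ge0 ?lee_fin ?tent_energy_ge0.
- exact: (Lext_energy m1 m2 gB).
Qed.

Lemma Lext_bounded_sublinear : bounded_sublinear p Lext.
Proof.
have [C C_0 hC] := Lext_bound.
split.
- move=> f tf; have [B gB] := tent_good tf; have [m1 m2 fin] := tf; split.
  + apply: (@measurable_funS _ _ _ _ setT) => //.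
    exact: (mf_fine (measurable_Lop m1 m2 gB)).
  + exact: measurable_cst.
  + by apply: le_lt_trans (hC f tf) _; rewrite lte_mul_pinfty// lee_fin.
- move=> f g _ _ fg; apply: nearW => z _; rewrite /Lext /Lop.
  by rewrite (Lint_ae _ _ fg).
- move=> f g tf tg; have [B gB] := tent_good tf; have [m1 m2 _] := tf.
  have [B' gB'] := tent_good tg; have [m3 m4 _] := tg.
  apply: filterS2 (Lop_fin_ae tf) (Lop_fin_ae tg) => z hf hg /[dup] /hf ff /hg fg.
  rewrite !normc_Lext -lee_fin EFinD.
  have P0 h : 0 <= Lop h z by exact: poweR_ge0.
  have nf : Lop f z \is a fin_num by rewrite ge0_fin_numE.
  have ng : Lop g z \is a fin_num by rewrite ge0_fin_numE.
  have le := Lop_subadd z m1 m2 m3 m4 gB gB'.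
  rewrite !fineK// ge0_fin_numE//; apply: le_lt_trans le _.
  by rewrite lte_add_pinfty.
- move=> a f tf; have [B gB] := tent_good tf; have [m1 m2 _] := tf.
  apply: nearW => z _; rewrite !normc_Lext.
  have na : (0 <= normc a)%R by case: (a) => ? ?; exact: sqrtr_ge0.
  have -> : Lop (fun w => a * f w)%R z = (normc a)%:E * Lop f z.
    have c1 : 0 <= (normc a ^+ 2)%:E by rewrite lee_fin sqr_ge0.
    have c2 : 0 <= (chi z.1)%:R%:E * Lint f z.1 z.2 by rewrite mule_ge0 ?lee_fin ?Lint_ge0.
    rewrite /Lop (Lint_scale _ _ _ m1 m2 gB) muleCA (poweRM _ c1 c2).
    by rewrite poweR_EFin -powR_mulrn// -powRrM mulfV// powRr1.
  have : 0 <= Lop f z by exact: poweR_ge0.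
  case: (Lop f z) => [l| |] //= _.
  (* Here [Lop f z] is infinite, and both sides reduce to [0] through [fine]. *)
  have [->|an0] := eqVneq (normc a) 0%R; first by rewrite mul0e mulr0.
  by rewrite gt0_muley ?mulr0// lte_fin lt_neqAle eq_sym an0.
- by exists C.
Qed.

Lemma extends_Lop (Q : (spacetime R n -> R[i]) -> spacetime R n -> \bar R) :
  (forall f z, tent_space p f -> Q f z = Lop f z) -> extends_to_tent p Q.
Proof.
move=> QL; exists Lext; split; first exact: Lext_bounded_sublinear.
move=> f tf _; apply: filterS (Lop_fin_ae tf) => z h /h fin.
exists (fine (Lop f z)) => //; rewrite QL// fineK// ge0_fin_numE//.
exact: poweR_ge0.
Qed.

End bounded_extension.

End quadratic_operator.

(** * The gradient and truncated operators as instances *)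

Section null_sets.
Local Open Scope ereal_scope.
Context d (T : measurableType d) (R : realType).
Variable mu : {measure set T -> \bar R}.
Import HBNNSimple.

Lemma Rintegral_null (N : set T) (f g : T -> R) : measurable N -> mu N = 0 ->
  (forall x, ~ N x -> f x = g x) -> (\int[mu]_x f x = \int[mu]_x g x)%R.
Proof.
move=> mN N0 fg; rewrite /Rintegral; congr fine.
rewrite [LHS]integralE [RHS]integralE; congr (_ - _).
- by apply: (@eq_integral_null _ _ _ mu setT N _ _ mN N0) => // x _ nN; rewrite !funeposE fg.
- by apply: (@eq_integral_null _ _ _ mu setT N _ _ mN N0) => // x _ nN; rewrite !funenegE fg.
Qed.

(** Argued on simple functions, because the integrand in [s] of the truncated operator is not known
    to be measurable. *)
Lemma le_integral_scale (f : T -> \bar R) (c : R) : (0 < c)%R -> (forall x, 0 <= f x) ->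
  c%:E * \int[mu]_x f x <= \int[mu]_x (c%:E * f x).
Proof.
move=> c0 f0; rewrite -lee_pdivlMl// ge0_integralE//.
apply: ge_ereal_sup => _ /= [h hf <-]; rewrite lee_pdivlMl//.
rewrite -integralT_nnsfun -ge0_integralZl_EFin//; [|by move=> x _; rewrite lee_fin; exact: fun_ge0|exact/measurable_EFinP|exact: ltW].
apply: le_integral_ge0 => x _; first by rewrite mule_ge0 ?lee_fin ?(ltW c0)//; exact: fun_ge0.
rewrite lee_wpmul2l ?lee_fin ?(ltW c0)//.
by have := hf x; rewrite /patch; case: ifPn => // /negP; rewrite in_setT.
Qed.

Lemma integral_scale (f : T -> \bar R) (c : R) : (0 < c)%R -> (forall x, 0 <= f x) ->
  \int[mu]_x (c%:E * f x) = c%:E * \int[mu]_x f x.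
Proof.
move=> c0 f0; apply/eqP; rewrite eq_le le_integral_scale// andbT.
rewrite -lee_pdivrMl//; have ci0 : (0 < c^-1)%R by rewrite invr_gt0.
apply: le_trans (le_integral_scale ci0 _) _.
  by move=> x; rewrite mule_ge0// lee_fin ltW.
rewrite le_eqVlt; apply/orP; left; apply/eqP; apply: eq_integral => x _.
by rewrite muleA -EFinM mulVf ?gt_eqF// mul1e.
Qed.

End null_sets.

Section caloric_energy.
Context {R : realType} {n : nat}.
Implicit Types (x y : 'rV[R]_n) (r s t d : R) (u v w : 'rV[R]_n -> R).
Local Notation la := (@lebesgue_rV R n).

Lemma heatRD t u v x : 0 < t -> heatable u -> heatable v ->
  heatR t (fun y => u y + v y) x = heatR t u x + heatR t v x.
Proof.
move=> t0 gu gv; rewrite /heatR -RintegralA; [|exact: integrable_heatR..].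
by apply: eq_Rintegral => y _; rewrite mulrDr.
Qed.

Lemma heatRZ t u x (a : R) : 0 < t -> heatable u ->
  heatR t (fun y => a * u y) x = a * heatR t u x.
Proof.
move=> t0 gu; rewrite /heatR -RintegralZ; last exact: integrable_heatR.
by apply: eq_Rintegral => y _; rewrite mulrCA.
Qed.

Lemma dheatD (i : 'I_n) t u v x : 0 < t -> heatable u -> heatable v ->
  dheat i t (fun y => u y + v y) x = dheat i t u x + dheat i t v x.
Proof.
move=> t0 gu gv; rewrite /dheat -RintegralA; [|exact: integrable_dheat..].
by apply: eq_Rintegral => y _; rewrite mulrDr.
Qed.

Lemma dheatZ (i : 'I_n) t u x (a : R) : 0 < t -> heatable u ->
  dheat i t (fun y => a * u y) x = a * dheat i t u x.
Proof.
move=> t0 gu; rewrite /dheat -RintegralZ; last exact: integrable_dheat.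
by apply: eq_Rintegral => y _; rewrite mulrCA.
Qed.

(** The kernel formula does not give the identity at [t = 0], which must be the initial state of the
    energy; hence the case distinction. *)
Definition flow t u : 'rV[R]_n -> R := if 0 < t then heatR t u else u.

Lemma heatable_flow t u : heatable u -> heatable (flow t u).
Proof. by rewrite /flow; case: ltP => // t0 gu; exact: heatable_heatR. Qed.

Lemma flowE s t u x : heatable u -> 0 <= s -> s < t ->
  flow t u x = heatR (t - s) (flow s u) x.
Proof.
move=> gu s0 st; have t0 : 0 < t by exact: le_lt_trans st.
have ts : 0 < t - s by rewrite subr_gt0.
rewrite /flow t0; move: s0; rewrite le_eqVlt => /orP[/eqP s0|s0].
  by rewrite -s0 ltxx subr0.
by rewrite s0 (heatR_semigroup x gu ts s0) subrK.
Qed.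

Lemma dheat_flow (i : 'I_n) s t u x : heatable u -> 0 <= s -> s < t ->
  dheat i t u x = dheat i (t - s) (flow s u) x.
Proof.
move=> gu s0 st; have ts : 0 < t - s by rewrite subr_gt0.
rewrite /flow; move: s0; rewrite le_eqVlt => /orP[/eqP s0|s0].
  by rewrite -s0 ltxx subr0.
by rewrite s0 -(dheat_semigroup x i gu ts s0) subrK.
Qed.

Definition flow_energy t u v y : \bar R := (flow t u y ^+ 2 + flow t v y ^+ 2)%:E.

Lemma measurable_flow u : heatable u ->
  measurable_fun [set: R * 'rV[R]_n] (fun p => flow p.1 u p.2).
Proof.
move=> [mu _]; rewrite (_ : (fun _ => _) = fun p : R * 'rV[R]_n =>
   (0 < p.1)%R%:R * heatR p.1 u p.2 + (p.1 <= 0)%R%:R * u p.2).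
  meas; apply: measurable_heatR; meas.
apply/funext => p; rewrite /flow; case: ltP => _; first by rewrite mul1r mul0r addr0.
by rewrite mul0r mul1r add0r.
Qed.

Local Open Scope ereal_scope.

Lemma hP_flow_energy t u v s y : heatable u -> heatable v -> (0 < t)%R ->
  hP t (flow_energy s u v) y =
  hP t (fun y => (flow s u y ^+ 2)%:E) y + hP t (fun y => (flow s v y ^+ 2)%:E) y.
Proof.
move=> gu gv t0; have [mu _] := heatable_flow s gu; have [mv _] := heatable_flow s gv.
rewrite -hPD; [by []|by meas|by meas|by move=> z; rewrite lee_fin sqr_ge0..].
Qed.

End caloric_energy.

Section gradient_operator.
Local Open Scope ereal_scope.
Context {R : realType} {n : nat}.
Implicit Types (x y : 'rV[R]_n) (r s t d : R) (u v w : 'rV[R]_n -> R).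
Local Notation la := (@lebesgue_rV R n).
Local Notation mu := (@lebesgue_measure R).
Hypothesis n0 : (0 < n)%N.

Lemma hP_sqr_fin t u x : heatable u -> (0 < t)%R ->
  exists2 h : R, hP t (fun y => (u y ^+ 2)%:E) x = h%:E & (0 <= h)%R.
Proof.
move=> [mu_ uf] t0; have := uf t x t0.
have : 0 <= hP t (fun y => (u y ^+ 2)%:E) x by apply: hP_ge0 => y; rewrite lee_fin sqr_ge0.
by case: (hP _ _ _) => // h; rewrite lee_fin => h0 _; exists h.
Qed.

Lemma le_average (a k h : R) (b : 'I_n -> R) : (forall i, a + k * b i <= h)%R ->
  (a + k / n%:R * \sum_i b i <= h)%R.
Proof.
move=> H; have nR : (0 < n%:R :> R)%R by rewrite ltr0n.
have : (\sum_(i < n) (a + k * b i) <= \sum_(i < n) h)%R by apply: ler_sum => i _.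
rewrite big_split /= !sumr_const card_ord -mulr_sumr => S.
rewrite -(ler_pM2l nR) mulrDr mulrA mulrCA mulfV ?gt_eqF// mulr1.
by rewrite !mulr_natl.
Qed.

(** The mean over the coordinates [i] of the bounds [dheat_bessel]. *)
Lemma grad_bessel t u x : heatable u -> (0 < t)%R ->
  (heatR t u x ^+ 2 + t * (@grad_cst R n * \sum_i dheat i t u x ^+ 2))%:E <=
  hP t (fun y => (u y ^+ 2)%:E) x.
Proof.
move=> gu t0; have [h hE h0] := hP_sqr_fin x gu t0.
have H i : (heatR t u x ^+ 2 + t / 2 ^+ n.+1 * dheat i t u x ^+ 2 <= h)%R.
  by rewrite -lee_fin -hE; exact: dheat_bessel.
rewrite hE lee_fin; apply: le_trans (le_average H); rewrite le_eqVlt; apply/orP; left; apply/eqP.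
have nR : (0 < n%:R :> R)%R by rewrite ltr0n.
have p2 : (0 < 2 ^+ n.+1 :> R)%R by exact: exprn_gt0.
rewrite /grad_cst; set a := (heatR _ _ _ ^+ 2)%R; set X := (\sum_(i < n) _)%R.
set q := (2 ^+ n.+1)%R in p2 *.
by field; rewrite !gt_eqF.
Qed.

Lemma diss_fin_flow t u v y : heatable u -> heatable v -> (0 < t)%R ->
  hP t (flow_energy 0%R u v) y < +oo.
Proof.
move=> gu gv t0; rewrite hP_flow_energy//.
have [_ fu] := heatable_flow 0%R gu; have [_ fv] := heatable_flow 0%R gv.
by rewrite lte_add_pinfty ?fu ?fv.
Qed.

Lemma measurable_flow_energy u v : heatable u -> heatable v ->
  measurable_fun [set: R * 'rV[R]_n] (fun p => flow_energy p.1 u v p.2).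
Proof.
move=> /measurable_flow m1 /measurable_flow m2; rewrite /flow_energy.
by apply: mf_EFin; apply: mf_add; apply: mf_exprn.
Qed.

(** The flow is restarted at time [s] by the semigroup law, and [grad_bessel] over the elapsed time
    [t - s] is added for the real and imaginary parts. *)
Lemma dissipative_gradient u v : heatable u -> heatable v ->
  dissipative (fun t y => (@grad_cst R n * Lsqr (@dheat R n) t u v y)%:E)
              (fun t => flow_energy t u v).
Proof.
move=> gu gv; have gc := ltW (@grad_cst_gt0 R n n0).
have L0 t y : (0 <= Lsqr (@dheat R n) t u v y)%R.
  by apply: sumr_ge0 => i _; rewrite addr_ge0 ?sqr_ge0.
split.
- have [mu_ _] := gu; have [mv _] := gv; rewrite /Lsqr; meas; apply: mf_sum => i.
  by apply: mf_add; apply: mf_exprn; apply: measurable_dheat; meas.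
- exact: measurable_flow_energy.
- by move=> t y; rewrite lee_fin mulr_ge0.
- by move=> t y; rewrite lee_fin addr_ge0 ?sqr_ge0.
- by move=> t y t0; exact: diss_fin_flow.
- move=> s t y s0 st; have ts : (0 < t - s)%R by rewrite subr_gt0.
  rewrite hP_flow_energy//.
  have := leeD (grad_bessel y (heatable_flow s gu) ts) (grad_bessel y (heatable_flow s gv) ts).
  apply: le_trans; rewrite /flow_energy (flowE y gu s0 st) (flowE y gv s0 st) -EFinM -!EFinD lee_fin.
  rewrite /Lsqr big_split /=.
  under eq_bigr do rewrite (dheat_flow _ y gu s0 st).
  under [X in (_ + (t - s) * (_ * (_ + X)))%R]eq_bigr do rewrite (dheat_flow _ y gv s0 st).
  rewrite le_eqVlt; apply/orP; left; apply/eqP.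
  by set A := (\sum_i _)%R; set B := (\sum_i _)%R; ring.
Qed.

Lemma quad_max_regE (p : \bar R) f z : 2%:E <= p -> tent_space p f ->
  @quad_max_reg R n f z = Lop (@dheat R n) (fun=> true) f z.
Proof.
move=> p2 tf; have [B [mB B0 gB]] := @good_exists R n n0 p f p2 tf.
rewrite /quad_max_reg /Lop mul1e; congr (_ `^ _); rewrite integral_itv_oo /Lint.
apply: (@eq_integral_null _ _ _ mu setT B _ _ mB B0).
- by move=> s _; rewrite mule_ge0// lee_fin sqr_ge0.
- move=> s _; rewrite mule_ge0// lee_fin; apply: sumr_ge0 => i _.
  by rewrite addr_ge0 ?sqr_ge0.
move=> s _ nB; case: (boolP (0 < s < z.1)%R) => [/andP[s0 st]|]; last by rewrite !mul0e.
rewrite !mul1e; congr (_%:E); have [gu gv] := gB s s0 nB.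
have ts : (0 < z.1 - s)%R by rewrite subr_gt0.
rewrite /cenorm sqr_sqrtr; last by apply: sumr_ge0 => i _; exact: sqr_ge0.
apply: eq_bigr => i _; rewrite mxE normc_sqr /=.
by rewrite -(derive_heatR z.2 i gu ts) -(derive_heatR z.2 i gv ts).
Qed.

Lemma extends_gradient (p : \bar R) : 2%:E <= p -> extends_to_tent p (@quad_max_reg R n).
Proof.
move=> p2; apply: (@extends_Lop R n n0 n (@dheat R n) (fun t u v => flow_energy t u v)
  (@grad_cst R n) 1 (fun=> true)) => //.
- by move=> d T i h k u mh mk mu_; exact: measurable_dheat.
- by move=> i t u v x; exact: dheatD.
- by move=> i t u x a; exact: dheatZ.
- by move=> i t u v x N mN N0 uv; apply: (Rintegral_null mN N0) => y /uv ->.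
- exact: grad_cst_gt0.
- exact: dissipative_gradient.
- by move=> u v y; rewrite /flow_energy /flow ltxx mul1r.
- by move=> f z tf; exact: (quad_max_regE z p2).
Qed.

End gradient_operator.

Section truncated_operator.
Local Open Scope ereal_scope.
Context {R : realType} {n : nat}.
Implicit Types (x y : 'rV[R]_n) (r s t d : R) (u v w : 'rV[R]_n -> R).
Local Notation la := (@lebesgue_rV R n).
Local Notation mu := (@lebesgue_measure R).
Hypothesis n0 : (0 < n)%N.
Variable T : R.
Hypothesis T0 : (0 < T)%R.

(** The cutoff keeps the elapsed times at which [expR_decay] gives a positive loss; for
    [0 < s < t <= T] the elapsed time [t - s] satisfies it automatically. *)
Definition theat (i : 'I_1) t u x : R := ((t <= T)%R%:R * (Num.sqrt T)^-1 * heatR t u x)%R.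

Lemma Lsqr_theat t u v x :
  Lsqr theat t u v x = ((t <= T)%R%:R / T * (heatR t u x ^+ 2 + heatR t v x ^+ 2))%R.
Proof.
rewrite /Lsqr big_ord1 /theat !exprMn exprVn sqr_sqrtr ?(ltW T0)//.
by case: (t <= T)%R; rewrite ?expr1n ?expr0n /=; ring.
Qed.

Lemma heatR_sqr_fin t u x : heatable u -> (0 < t)%R ->
  exists2 h : R, hP t (fun y => (u y ^+ 2)%:E) x = h%:E & (heatR t u x ^+ 2 <= h)%R.
Proof.
move=> gu t0; have [h hE h0] := hP_sqr_fin x gu t0; exists h => //.
by rewrite -lee_fin -hE; exact: heatR_sqr_le.
Qed.

(* [e^(b + d) - e^b >= d] for [b, d >= 0], at [b = 1 - t/T] and [d = (t - s)/T]. *)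
Lemma expR_decay s t : (s < t)%R ->
  (expR (1 - t / T) + (t - s) * ((t <= T)%R%:R / T) <= expR (1 - s / T))%R.
Proof.
move=> st; have [tT|tT] := leP t T; last first.
  rewrite mul0r mulr0 addr0 ler_expR lerD2l lerN2 ler_pM2r ?invr_gt0//; exact: ltW.
set b := (1 - t / T)%R; set d := ((t - s) / T)%R.
have b0 : (0 <= b)%R by rewrite subr_ge0 ler_pdivrMr// mul1r.
have d0 : (0 <= d)%R by rewrite divr_ge0 ?(ltW T0)// subr_ge0 ltW.
have -> : (1 - s / T = b + d)%R by rewrite /b /d; ring.
rewrite (_ : (t - s) * (true%:R / T) = d)%R; last by rewrite mul1r.
rewrite (expRD b d).
have e1 : (1 <= expR b)%R by rewrite -expR0 ler_expR.
have e2 := expR_ge1Dx d.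
apply: (@le_trans _ _ (expR b * (1 + d))%R); last by rewrite ler_wpM2l ?expR_ge0.
by rewrite mulrDr mulr1 lerD2l ler_peMl.
Qed.

(** Jensen shows that the energy of the flow does not increase, so the loss comes entirely from the
    exponential factor, by [expR_decay]. That factor starts at [expR 1], the constant relating the
    initial energy to the datum. *)
Lemma dissipative_truncated u v : heatable u -> heatable v ->
  dissipative (fun t y => (1 * Lsqr theat t u v y)%:E)
              (fun t y => (expR (1 - t / T))%:E * flow_energy t u v y).
Proof.
move=> gu gv.
have fe0 t y : 0 <= flow_energy t u v y by rewrite lee_fin addr_ge0 ?sqr_ge0.
have mfe := measurable_flow_energy gu gv.
have mfl t : measurable_fun setT (flow_energy t u v).
  exact: (measurableT_comp mfe (mf_pair (mf_cst t) (@mf_id _ _))).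
split.
- have [mu_ _] := gu; have [mv _] := gv.
  rewrite (_ : (fun _ => _) = fun p : R * 'rV[R]_n => ((p.1 <= T)%R%:R / T *
     (heatR p.1 u p.2 ^+ 2 + heatR p.1 v p.2 ^+ 2))%:E); last first.
    by apply/funext => p; rewrite mul1r Lsqr_theat.
  by meas; apply: measurable_heatR; meas.
- by apply: mf_mule => //; meas.
- by move=> t y; rewrite lee_fin mul1r Lsqr_theat mulr_ge0 ?divr_ge0 ?addr_ge0 ?sqr_ge0 ?(ltW T0).
- by move=> t y; rewrite mule_ge0// lee_fin expR_ge0.
- move=> t y t0; rewrite hPZ ?expR_ge0//.
  by rewrite lte_mul_pinfty ?lee_fin ?expR_ge0//; exact: diss_fin_flow.
- move=> s t y s0 st; have ts : (0 < t - s)%R by rewrite subr_gt0.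
  rewrite hPZ ?expR_ge0// hP_flow_energy//.
  have [h1 E1 H1] := heatR_sqr_fin y (heatable_flow s gu) ts.
  have [h2 E2 H2] := heatR_sqr_fin y (heatable_flow s gv) ts.
  rewrite E1 E2 /flow_energy mul1r Lsqr_theat.
  rewrite (flowE y gu s0 st) (flowE y gv s0 st).
  have t0 : (0 < t)%R by exact: le_lt_trans st.
  have -> : heatR t u y = heatR (t - s) (flow s u) y.
    by rewrite -(flowE y gu s0 st) /flow t0.
  have -> : heatR t v y = heatR (t - s) (flow s v) y.
    by rewrite -(flowE y gv s0 st) /flow t0.
  have e := expR_decay st; set a := (heatR _ _ _ ^+ 2)%R in H1 *.
  set b := (heatR _ (flow s v) _ ^+ 2)%R in H2 *.
  have ab0 : (0 <= a + b)%R by rewrite addr_ge0 ?sqr_ge0.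
  apply: (@le_trans _ _ (expR (1 - s / T) * (a + b))%R).
    by rewrite (mulrA (t - s)%R) -mulrDl ler_wpM2r.
  by rewrite ler_wpM2l ?expR_ge0// lerD.
Qed.

Lemma quad_max_reg_truncE (p : \bar R) f z : 2%:E <= p -> tent_space p f ->
  @quad_max_reg_trunc R n T f z = Lop theat (fun t => 0 <= t <= T)%R f z.
Proof.
move=> p2 tf; have [B [mB B0 gB]] := @good_exists R n n0 p f p2 tf.
rewrite /quad_max_reg_trunc /Lop; congr (_ `^ _).
have -> : \1_(`[0%R, T] : set R) z.1 = (0 <= z.1 <= T)%R%:R :> R.
  rewrite indicE; congr (_%:R)%R; congr nat_of_bool.
  by apply/idP/idP; rewrite ?inE /= in_itv/=.
have [/andP[z0 zT]|_] := boolP (0 <= z.1 <= T)%R; last by rewrite mul0r !mul0e.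
have Ti0 : (0 < T^-1)%R by rewrite invr_gt0.
rewrite mul1r mul1e integral_itv_oo -integral_scale//; last first.
  by move=> s; rewrite mule_ge0// lee_fin sqr_ge0.
apply: (@eq_integral_null _ _ _ mu setT B _ _ mB B0).
- by move=> s _; rewrite !mule_ge0// lee_fin ?sqr_ge0 ?ltW.
- move=> s _; rewrite mule_ge0// lee_fin; apply: sumr_ge0 => i _.
  by rewrite addr_ge0 ?sqr_ge0.
move=> s _ nB; rewrite muleCA; case: (boolP (0 < s < z.1)%R) => [/andP[s0 st]|].
  rewrite !mul1e -EFinM; congr (_%:E); rewrite Lsqr_theat normc_sqr /=.
  by rewrite (_ : (z.1 - s <= T)%R) ?mul1r//; lra.
by rewrite !mul0e.
Qed.

Lemma extends_truncated (p : \bar R) : 2%:E <= p ->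
  extends_to_tent p (@quad_max_reg_trunc R n T).
Proof.
move=> p2; apply: (@extends_Lop R n n0 1 theat
  (fun t u v y => (expR (1 - t / T))%:E * flow_energy t u v y)
  1 (expR 1) (fun t => 0 <= t <= T)%R) => //.
- by move=> d U i h k u mh mk mu_; rewrite /theat; meas; exact: measurable_heatR.
- by move=> i t u v x t0 gu gv; rewrite /theat heatRD// mulrDr.
- by move=> i t u x a t0 gu; rewrite /theat heatRZ// mulrCA.
- move=> i t u v x N mN N0 uv; rewrite /theat; congr (_ * _)%R.
  by apply: (Rintegral_null mN N0) => y /uv ->.
- by meas.
- exact: dissipative_truncated.
- by move=> u v y; rewrite /flow_energy /flow ltxx mul0r subr0 -EFinM.
- by move=> f z tf; exact: (quad_max_reg_truncE z p2).
Qed.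

End truncated_operator.

Theorem theorem4p2 (R : realType) (n : nat) (hn : (0 < n)%N)
    (p : \bar R) (hp : (2%:E <= p)%E) :
  extends_to_tent p (@quad_max_reg R n) /\
  forall T : R, 0 < T -> extends_to_tent p (@quad_max_reg_trunc R n T).
Proof. by split=> [|T T0]; [exact: extends_gradient|exact: extends_truncated]. Qed.
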